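(* Let $n\in\mathbb{N}=\{1,2,3,\dots\}$ and let $\Bbbk$ be a field. Let $\mathcal{A}_n$, $\mathcal{B}_n$, $\mathcal{S}_{IS_n}$, $\mathcal{S}_{F_n^*}$ be the finite $2$-categories, and $\mathcal{C}\mapsto\Bbbk\mathcal{C}$, $\mathcal{C}\mapsto\overline{\mathcal{C}}$ the constructions, described in the context. Then: (i) Both $2$-categories $\overline{\Bbbk\mathcal{A}_n}$ and $\overline{\Bbbk\mathcal{B}_n}$ are fiat. (ii) Both $2$-categories $\Bbbk\mathcal{S}_{IS_n}$ and $\Bbbk\mathcal{S}_{F_n^*}$ are finitary but not fiat.
   Context: All $2$-categories are strict (categories enriched over the category of small categories). $\circ_1$ denotes vertical and $\circ_0$ horizontal composition of $2$-morphisms; $\mathbbm{1}_{\mathtt{i}}$ denotes the identity $1$-morphism of $\mathtt{i}$. **Monoids.** $\mathbf{n}=\{1,\dots,n\}$; $S_n$ is the symmetric group on $\mathbf{n}$. $\mathbf{B}_n$ is the monoid of all binary relations on $\mathbf{n}$, with $\beta\alpha=\{(z,x):\exists y,\ (z,y)\in\beta,\ (y,x)\in\alpha\}$, ordered by inclusion; $\pi\in S_n$ is identified with $\{(\pi(x),x):x\in\mathbf{n}\}$. $IS_n$ is the symmetric inverse monoid of all bijections between subsets of $\mathbf{n}$ (equivalently, all binary relations contained in some element of $S_n$). $\mathbf{P}_n$ is the partition monoid: its elements are the set partitions of $\overline{\mathbf{n}}=\{1,\dots,n,1',\dots,n'\}$ into nonempty parts. The product $\rho\pi$ is obtained as follows: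 regard $\rho$ as a partition of $\{1',\dots,n',1'',\dots,n''\}$ via $x\mapsto x'$, $x'\mapsto x''$; let $\tau$ be the finest partition of $\{1,\dots,n,1',\dots,n',1'',\dots,n''\}$ such that each part of $\rho$ and of $\pi$ is contained in a part of $\tau$; restrict $\tau$ to $\{1,\dots,n,1'',\dots,n''\}$ (intersecting parts with this set and discarding empty intersections), and rename $x''$ to $x'$. $\mathbf{P}_n$ is ordered by refinement: $\rho\le\tau$ iff each part of $\rho$ is contained in a part of $\tau$; $\vee$ is the join. $S_n\subset\mathbf{P}_n$ via $\sigma\mapsto\{\{x,\sigma(x)'\}:x\in\mathbf{n}\}$. $\mathbf{PP}_n\subset\mathbf{P}_n$ is the submonoid of partitions all of whose parts are propagating, i.e. meet both $\{1,\dots,n\}$ and $\{1',\dots,n'\}$. The dual symmetric inverse monoid $I_n^*$ (bijections between quotients of $\mathbf{n}$) is identified with $\mathbf{PP}_n$; it is an inverse monoid with group of units $S_n$. $F_n^*$ is its maximal factorizable submonoid, i.e. the submonoid of all elements $\sigma\varepsilon$ with $\sigma\in S_n$ and $\varepsilon$ an idempotent of $I_n^*$. **$\mathcal{A}_n$.** One object $\mathtt{i}$; $1$-morphisms are the elements of $S_n$, composed as in $S_n$, with identity $\mathrm{id}_{\mathbf{n}}$. $\mathrm{Hom}(\pi,\sigma)$ is the set of $\alpha\in\mathbf{B}_n$ with $\alpha\subseteq\pi\cap\sigma$; $\beta\circ_1\alpha=\beta\cap\alpha$; the identity $2$-morphism of $\pi$ is $\pi$; $\beta\circ_0\alpha=\beta\alpha$.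 **$\mathcal{B}_n$.** Same object, $1$-morphisms and their composition as $\mathcal{A}_n$. $\mathrm{Hom}(\pi,\sigma)$ is the set of $\alpha\in\mathbf{PP}_n$ with $\pi\le\alpha$ and $\sigma\le\alpha$; $\beta\circ_1\alpha=\beta\vee\alpha$; the identity $2$-morphism of $\pi$ is $\pi$; $\beta\circ_0\alpha=\beta\alpha$ (product in $\mathbf{P}_n$). **$\mathcal{S}_S$.** For a monoid $S$ with an admissible partial order $\le$ ($s\le t$ implies $sx\le tx$ and $xs\le xt$), $\mathcal{S}_S$ has one object; $1$-morphisms are the elements of $S$, composed by multiplication, with identity $1$; there is exactly one $2$-morphism $s\to t$ if $s\le t$ and none otherwise; compositions of $2$-morphisms are the only possible ones. For $S=IS_n$ and $S=F_n^*$ the order is the natural partial order of an inverse monoid: $s\le t$ iff $s=et$ for some idempotent $e\in S$. **Linearization.** For a finite category $\mathcal{D}$, let $\mathcal{D}_\Bbbk$ have the same objects and morphism spaces $\Bbbk[\mathcal{D}(\mathtt{i},\mathtt{j})]$ (formal linear combinations), with bilinear composition; $\mathcal{D}_\Bbbk^{\oplus}$ is the additive category whose objects are formal finite direct sums of objects of $\mathcal{D}$ and whose morphisms are matrices of morphisms in $\mathcal{D}_\Bbbk$. For a finite $2$-category $\mathcal{C}$, $\mathcal{C}_\Bbbk$ has the same objects, $\mathcal{C}_\Bbbk(\mathtt{i},\mathtt{j})=\mathcal{C}(\mathtt{i},\mathtt{j})_\Bbbk^{\oplus}$, and compositions extended biadditively and $\Bbbk$-bilinearly. $\Bbbk\mathcal{C}$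 has the same objects, $\Bbbk\mathcal{C}(\mathtt{i},\mathtt{j})$ is the idempotent completion of $\mathcal{C}_\Bbbk(\mathtt{i},\mathtt{j})$, with induced compositions. **Finitary.** A $\Bbbk$-linear category is finitary if it is additive, idempotent split and Krull–Schmidt with finitely many isomorphism classes of indecomposable objects and finite dimensional morphism spaces. A $2$-category is prefinitary (over $\Bbbk$) if it has finitely many objects, each $\mathcal{C}(\mathtt{i},\mathtt{j})$ is a finitary $\Bbbk$-linear category, and all compositions are biadditive and $\Bbbk$-linear whenever this makes sense. It is finitary if moreover all identity $1$-morphisms are indecomposable. ($\Bbbk\mathcal{C}$ is prefinitary for every finite $2$-category $\mathcal{C}$.) **$\overline{\mathcal{C}}$.** For prefinitary $\mathcal{C}$, on each $\mathrm{End}_{\mathcal{C}}(\mathbbm{1}_{\mathtt{i}})$ the operations $\circ_0,\circ_1$ coincide and are commutative; let $\varepsilon_{\mathtt{i}}^{(j)}$, $j=1,\dots,k_{\mathtt{i}}$, be the complete list of its primitive idempotents. $\overline{\mathcal{C}}$ has objects $\mathtt{i}^{(s)}$, $\mathtt{i}\in\mathcal{C}$, $1\le s\le k_{\mathtt{i}}$; the $1$-morphisms in $\overline{\mathcal{C}}(\mathtt{i}^{(s)},\mathtt{j}^{(t)})$ are those in $\mathcal{C}(\mathtt{i},\mathtt{j})$; $\mathrm{Hom}_{\overline{\mathcal{C}}}(\mathrm{F},\mathrm{G})=\varepsilon_{\mathtt{j}}^{(t)}\circ_0\mathrm{Hom}_{\mathcal{C}}(\mathrm{F},\mathrm{G})\circ_0\varepsilon_{\mathtt{i}}^{(s)}$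 for such $1$-morphisms; the identity $1$-morphism of $\mathtt{i}^{(s)}$ is $\mathbbm{1}_{\mathtt{i}}$; all compositions are induced from $\mathcal{C}$. **Fiat.** A finitary $2$-category $\mathcal{C}$ is fiat if there is a weak anti-involution $\star:\mathcal{C}\to\mathcal{C}^{\mathrm{co},\mathrm{op}}$ (reversing the directions of both $1$- and $2$-morphisms) such that for all objects $\mathtt{i},\mathtt{j}$ and every $1$-morphism $\mathrm{F}\in\mathcal{C}(\mathtt{i},\mathtt{j})$ there are $2$-morphisms $\eta:\mathbbm{1}_{\mathtt{i}}\to\mathrm{F}^\star\mathrm{F}$ and $\varepsilon:\mathrm{F}\mathrm{F}^\star\to\mathbbm{1}_{\mathtt{j}}$ with $(\varepsilon\circ_0\mathrm{id}_{\mathrm{F}})\circ_1(\mathrm{id}_{\mathrm{F}}\circ_0\eta)=\mathrm{id}_{\mathrm{F}}$ and $(\mathrm{id}_{\mathrm{F}^\star}\circ_0\varepsilon)\circ_1(\eta\circ_0\mathrm{id}_{\mathrm{F}^\star})=\mathrm{id}_{\mathrm{F}^\star}$.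
   Formalization: Non-fiatness of the hull of S_{F_n^*} is claimed only for n≥2 (for n=1, F_1^* is trivial and the hull is fiat). The overline construction is followed by idempotent completion of its hom-categories, since as described it need not preserve identity 2-morphisms, so is not a 2-category. *)

(* Defs.v *)
From HB Require Import structures.
From mathcomp Require Import all_boot all_fingroup all_algebra.
From mathcomp Require Import boolp.

Set Implicit Arguments.
Unset Strict Implicit.
Unset Printing Implicit Defensive.
Import GRing.Theory.
Local Open Scope ring_scope.

(* Transport of a morphism along equalities of its source and target; strict   *)
(* associativity and unitality of horizontal composition of 2-morphisms are    *)
(* equations up to such transports.                                            *)
Definition castH (T : Type) (H : T -> T -> Type) (X X' Y Y' : T)
    (eX : X = X') (eY : Y = Y') (a : H X Y) : H X' Y' :=
  ecast Z (H X' Z) eY (ecast Z (H Z Y) eX a).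
Arguments castH {T} H {X X' Y Y'} eX eY a.

Record category_laws (T : Type) (H : T -> T -> Type)
    (id : forall X, H X X)
    (comp : forall X Y Z, H Y Z -> H X Y -> H X Z) : Prop := CategoryLaws {
  cat_assoc : forall X Y Z W (c : H Z W) (b : H Y Z) (a : H X Y),
    comp _ _ _ c (comp _ _ _ b a) = comp _ _ _ (comp _ _ _ c b) a;
  cat_idl : forall X Y (a : H X Y), comp _ _ _ (id Y) a = a;
  cat_idr : forall X Y (a : H X Y), comp _ _ _ a (id X) = a }.

Record finCat := FinCat {
  fobj :> finType;
  fhom : fobj -> fobj -> finType;
  fid : forall X, fhom X X;
  fcomp : forall X Y Z, fhom Y Z -> fhom X Y -> fhom X Z;
  flaws : category_laws fid fcomp }.
Arguments fhom {D} X Y : rename.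
Arguments fid {D} X : rename.
Arguments fcomp {D X Y Z} b a : rename.

Record linCat (k : fieldType) := LinCat {
  lobj :> Type;
  lhom : lobj -> lobj -> lmodType k;
  lid : forall X, lhom X X;
  lcomp : forall X Y Z, lhom Y Z -> lhom X Y -> lhom X Z;
  llaws : category_laws lid lcomp;
  lcomp_linl : forall X Y Z (a : lhom X Y),
    linear (fun b : lhom Y Z => lcomp b a);
  lcomp_linr : forall X Y Z (b : lhom Y Z),
    linear (fun a : lhom X Y => lcomp b a) }.
Arguments lhom {k D} X Y : rename.
Arguments lid {k D} X : rename.
Arguments lcomp {k D X Y Z} b a : rename.

(* The laws of horizontal composition in a strict 2-category, except for the   *)
(* preservation of identity 2-morphisms                                        *)
(*   hcomp (id2 G) (id2 F) = id2 (comp1 G F),                                  *)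
(* which is added separately in fin2Cat and lin2Cat because it fails for the   *)
(* construction bar below.                                                     *)
Record hcomp_laws (ob : Type) (mor : ob -> ob -> Type)
    (hom : forall i j, mor i j -> mor i j -> Type)
    (id2 : forall i j (F : mor i j), hom i j F F)
    (vcomp : forall i j (F G H : mor i j),
       hom i j G H -> hom i j F G -> hom i j F H)
    (id1 : forall i, mor i i)
    (comp1 : forall i j l, mor j l -> mor i j -> mor i l)
    (hcomp : forall i j l (G G' : mor j l) (F F' : mor i j),
       hom j l G G' -> hom i j F F' ->
       hom i l (comp1 _ _ _ G F) (comp1 _ _ _ G' F')) : Prop := HcompLaws {
  hcomp_interchange : forall i j l (G G' G'' : mor j l) (F F' F'' : mor i j)
    (b' : hom _ _ G' G'') (b : hom _ _ G G')
    (a' : hom _ _ F' F'') (a : hom _ _ F F'),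
    vcomp _ _ _ _ _ (hcomp _ _ _ _ _ _ _ b' a') (hcomp _ _ _ _ _ _ _ b a) =
    hcomp _ _ _ _ _ _ _ (vcomp _ _ _ _ _ b' b) (vcomp _ _ _ _ _ a' a);
  comp1A : forall i j l m (H : mor l m) (G : mor j l) (F : mor i j),
    comp1 _ _ _ H (comp1 _ _ _ G F) = comp1 _ _ _ (comp1 _ _ _ H G) F;
  comp1l : forall i j (F : mor i j), comp1 _ _ _ (id1 j) F = F;
  comp1r : forall i j (F : mor i j), comp1 _ _ _ F (id1 i) = F;
  hcompA : forall i j l m (H H' : mor l m) (G G' : mor j l) (F F' : mor i j)
    (c : hom _ _ H H') (b : hom _ _ G G') (a : hom _ _ F F'),
    castH (@hom i m) (comp1A H G F) (comp1A H' G' F')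
      (hcomp _ _ _ _ _ _ _ c (hcomp _ _ _ _ _ _ _ b a)) =
    hcomp _ _ _ _ _ _ _ (hcomp _ _ _ _ _ _ _ c b) a;
  hcompl : forall i j (F F' : mor i j) (a : hom _ _ F F'),
    castH (@hom i j) (comp1l F) (comp1l F')
      (hcomp _ _ _ _ _ _ _ (id2 _ _ (id1 j)) a) = a;
  hcompr : forall i j (F F' : mor i j) (a : hom _ _ F F'),
    castH (@hom i j) (comp1r F) (comp1r F')
      (hcomp _ _ _ _ _ _ _ a (id2 _ _ (id1 i))) = a }.

Record fin2Cat := Fin2Cat {
  fob :> finType;
  fhcat : fob -> fob -> finCat;
  fone : forall i, fhcat i i;
  fcomp1 : forall i j l, fhcat j l -> fhcat i j -> fhcat i l;
  fhcomp : forall i j l (G G' : fhcat j l) (F F' : fhcat i j),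
    fhom G G' -> fhom F F' -> fhom (fcomp1 G F) (fcomp1 G' F');
  fhlaws : @hcomp_laws fob fhcat (fun i j F G => fhom F G)
    (fun i j F => fid F) (fun i j F G H b a => fcomp b a) fone fcomp1 fhcomp;
  fhcomp_id : forall i j l (G : fhcat j l) (F : fhcat i j),
    fhcomp (fid G) (fid F) = fid (fcomp1 G F) }.
Arguments fone {C} i : rename.
Arguments fcomp1 {C i j l} G F : rename.
Arguments fhcomp {C i j l G G' F F'} b a : rename.

(* A k-linear strict 2-category, except that horizontal composition need not   *)
(* preserve identity 2-morphisms.                                              *)
Record linSemi2Cat (k : fieldType) := LinSemi2Cat {
  lob :> Type;
  hcat : lob -> lob -> linCat k;
  one1 : forall i, hcat i i;
  comp1 : forall i j l, hcat j l -> hcat i j -> hcat i l;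
  hcomp : forall i j l (G G' : hcat j l) (F F' : hcat i j),
    lhom G G' -> lhom F F' -> lhom (comp1 G F) (comp1 G' F');
  hlaws : @hcomp_laws lob hcat (fun i j F G => lhom F G)
    (fun i j F => lid F) (fun i j F G H b a => lcomp b a) one1 comp1 hcomp;
  hcomp_linl : forall i j l (G G' : hcat j l) (F F' : hcat i j)
    (a : lhom F F'), linear (fun b : lhom G G' => hcomp b a);
  hcomp_linr : forall i j l (G G' : hcat j l) (F F' : hcat i j)
    (b : lhom G G'), linear (fun a : lhom F F' => hcomp b a) }.
Arguments hcat {k C} i j : rename.
Arguments one1 {k C} i : rename.
Arguments comp1 {k C i j l} G F : rename.
Arguments hcomp {k C i j l G G' F F'} b a : rename.

Record lin2Cat (k : fieldType) := Lin2Cat {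
  semi :> linSemi2Cat k;
  hcomp_id : forall (i j l : semi) (G : hcat j l) (F : hcat i j),
    hcomp (lid G) (lid F) = lid (comp1 G F) }.

Declare Scope twocat_scope.
Delimit Scope twocat_scope with C2.
Local Open Scope twocat_scope.
Notation "b \v a" := (lcomp b a) (at level 40, left associativity) : twocat_scope.
Notation "b \h a" := (hcomp b a) (at level 40, left associativity) : twocat_scope.
Notation "G \c F" := (comp1 G F) (at level 40, left associativity) : twocat_scope.

(* A morphism together with its source and target; equality of such triples is *)
(* equality up to transport, see tot_cast and tot_inj.                         *)
Section Tot.
Variables (T : Type) (H : T -> T -> Type).

Definition tot X Y (a : H X Y) : {XY : T * T & H XY.1 XY.2} :=
  existT (fun XY => H XY.1 XY.2) (X, Y) a.

Lemma tot_cast X X' Y Y' (eX : X = X') (eY : Y = Y') (a : H X Y) :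
  tot (castH H eX eY a) = tot a.
Proof. by case: _ / eX; case: _ / eY. Qed.

Lemma tot_castE X X' Y Y' (a : H X Y) (b : H X' Y') :
  tot a = tot b -> exists eX eY, castH H eX eY a = b.
Proof.
pose P XY (a' : H XY.1 XY.2) :=
  exists eX eY, castH H (X' := XY.1) (Y' := XY.2) eX eY a = a'.
move=> e; suff : P (projT1 (tot b)) (projT2 (tot b)) by [].
by case: _ / e; exists erefl, erefl.
Qed.

Lemma castH_id X Y (eX : X = X) (eY : Y = Y) (a : H X Y) : castH H eX eY a = a.
Proof. by rewrite (Prop_irrelevance eX erefl) (Prop_irrelevance eY erefl). Qed.

Lemma tot_inj X Y (a b : H X Y) : tot a = tot b -> a = b.
Proof. by case/tot_castE=> eX [eY <-]; rewrite castH_id. Qed.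

Lemma tot_src X X' Y Y' (a : H X Y) (b : H X' Y') : tot a = tot b -> X = X'.
Proof. by case/tot_castE. Qed.
Lemma tot_tgt X X' Y Y' (a : H X Y) (b : H X' Y') : tot a = tot b -> Y = Y'.
Proof. by case/tot_castE => ? []. Qed.
End Tot.

Section Linearization.
Variable k : fieldType.

(* Formal linear combinations of elements of A. *)
Definition fcomb (A : finType) : lmodType k := {ffun A -> k^o}.

Definition delta (A : finType) (a : A) : fcomb A := [ffun x => (x == a)%:R].

(* Bilinear extension of an operation on bases to formal linear combinations. *)
Definition lift2 (A B C : finType) (op : A -> B -> C)
    (u : fcomb A) (v : fcomb B) : fcomb C :=
  \sum_a \sum_b ((u : {ffun A -> k^o}) a * (v : {ffun B -> k^o}) b : k)
    *: delta (op a b).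

Lemma linear_sumE (V W : lmodType k) (f : V -> W) : linear f ->
  forall (I : finType) (c : I -> k) (v : I -> V),
    f (\sum_i c i *: v i) = \sum_i c i *: f (v i).
Proof.
move=> lf I c v; apply: (big_rec2 (fun x y => f x = y)) => [|i x y _ e].
  have := lf (-1) 0 0; rewrite scaler0 addr0 => e.
  by rewrite e scaleN1r addNr.
by rewrite lf e.
Qed.

Lemma fcombE (A : finType) (u : fcomb A) :
  u = \sum_a ((u : {ffun A -> k^o}) a : k) *: delta a.
Proof.
apply/ffunP => x; rewrite sum_ffunE (bigD1 x) //= big1 => [|y ne].
  by rewrite ffunE ffunE eqxx addr0 /GRing.scale /= mulr1.
by rewrite ffunE ffunE eq_sym (negbTE ne) scaler0.
Qed.

Lemma fcomb_ext (A : finType) (W : lmodType k) (f g : fcomb A -> W) :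
  linear f -> linear g -> (forall a, f (delta a) = g (delta a)) -> f =1 g.
Proof.
move=> lf lg e u; rewrite (fcombE u) !linear_sumE //.
by apply: eq_bigr => a _; rewrite e.
Qed.

Lemma lift2_linl (A B C : finType) (op : A -> B -> C) v :
  linear (fun u => lift2 op u v).
Proof.
move=> c u u'; rewrite /lift2 scaler_sumr -big_split /=; apply: eq_bigr => a _.
rewrite scaler_sumr -big_split /=; apply: eq_bigr => b _.
by rewrite !ffunE mulrDl scalerDl scalerA mulrA.
Qed.

Lemma lift2_linr (A B C : finType) (op : A -> B -> C) u :
  linear (fun v => lift2 op u v).
Proof.
move=> c v v'; rewrite /lift2 scaler_sumr -big_split /=; apply: eq_bigr => a _.
rewrite scaler_sumr -big_split /=; apply: eq_bigr => b _.
rewrite !ffunE mulrDr scalerDl scalerA; congr (_ *: _ + _).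
by rewrite mulrCA.
Qed.

Lemma lift2_delta (A B C : finType) (op : A -> B -> C) a b :
  lift2 op (delta a) (delta b) = delta (op a b).
Proof.
rewrite /lift2 (bigD1 a) //= (bigD1 b) //= !ffunE !eqxx mulr1 scale1r.
rewrite big1 => [|b' ne]; last by rewrite !ffunE (negbTE ne) mulr0 scale0r.
rewrite addr0 big1 ?addr0 // => a' ne; apply: big1 => b' _.
by rewrite !ffunE (negbTE ne) mul0r scale0r.
Qed.

Lemma linear_comp (U V W : lmodType k) (f : V -> W) (g : U -> V) :
  linear f -> linear g -> linear (fun x => f (g x)).
Proof. by move=> lf lg c x y; rewrite lg lf. Qed.

Lemma linear_idfun (V : lmodType k) : linear (fun x : V => x).
Proof. by []. Qed.

Lemma fcomb_ext2 (A B : finType) (W : lmodType k) (f g : fcomb A -> fcomb B -> W) :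
  (forall v, linear (f^~ v)) -> (forall u, linear (f u)) ->
  (forall v, linear (g^~ v)) -> (forall u, linear (g u)) ->
  (forall a b, f (delta a) (delta b) = g (delta a) (delta b)) -> f =2 g.
Proof.
move=> f1 f2 g1 g2 e u v; apply: (fcomb_ext (f := f^~ v) (g := g^~ v)) => // a.
exact: fcomb_ext.
Qed.

Lemma castH_linear (T : Type) (H : T -> T -> lmodType k) X X' Y Y'
  (eX : X = X') (eY : Y = Y') :
  linear (castH (fun X Y => H X Y) eX eY : H X Y -> H X' Y').
Proof. by case: _ / eX; case: _ / eY. Qed.

Section Lift2Laws.
Variables A B C E E' F G P Q : finType.

Lemma lift2A (g : E -> E') (f : fcomb E -> fcomb E') (o1 : C -> F -> E)
    (o2 : B -> A -> F) (o3 : G -> A -> E') (o4 : C -> B -> G) :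
  linear f -> (forall e, f (delta e) = delta (g e)) ->
  (forall c b a, g (o1 c (o2 b a)) = o3 (o4 c b) a) ->
  forall w v u, f (lift2 o1 w (lift2 o2 v u)) = lift2 o3 (lift2 o4 w v) u.
Proof.
move=> lf ef eo w v u; move: w; apply: fcomb_ext => [||c].
- exact: (linear_comp lf (lift2_linl o1 _)).
- exact: (linear_comp (lift2_linl o3 u) (lift2_linl o4 v)).
move: v; apply: fcomb_ext => [||b].
- exact: (linear_comp lf (linear_comp (lift2_linr o1 _) (lift2_linl o2 _))).
- exact: (linear_comp (lift2_linl o3 u) (lift2_linr o4 _)).
move: u; apply: fcomb_ext => [||a].
- exact: (linear_comp lf (linear_comp (lift2_linr o1 _) (lift2_linr o2 _))).
- exact: lift2_linr.
by rewrite !lift2_delta ef eo.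
Qed.

Lemma lift2_unitl (e : A) (g : E -> B) (f : fcomb E -> fcomb B) (o : A -> B -> E) :
  linear f -> (forall x, f (delta x) = delta (g x)) ->
  (forall b, g (o e b) = b) -> forall u, f (lift2 o (delta e) u) = u.
Proof.
move=> lf ef eo; apply: fcomb_ext => [||b] //.
  exact: (linear_comp lf (lift2_linr o _)).
by rewrite lift2_delta ef eo.
Qed.

Lemma lift2_unitr (e : B) (g : E -> A) (f : fcomb E -> fcomb A) (o : A -> B -> E) :
  linear f -> (forall x, f (delta x) = delta (g x)) ->
  (forall a, g (o a e) = a) -> forall u, f (lift2 o u (delta e)) = u.
Proof.
move=> lf ef eo; apply: fcomb_ext => [||b] //.
  exact: (linear_comp lf (lift2_linl o _)).
by rewrite lift2_delta ef eo.
Qed.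

Lemma lift2_interchange (v : F -> G -> E) (h' : A -> B -> F) (h : C -> E' -> G)
    (w : P -> Q -> E) (v1 : A -> C -> P) (v2 : B -> E' -> Q) :
  (forall b' a' b a, v (h' b' a') (h b a) = w (v1 b' b) (v2 a' a)) ->
  forall b' a' b a, lift2 v (lift2 h' b' a') (lift2 h b a) =
                    lift2 w (lift2 v1 b' b) (lift2 v2 a' a).
Proof.
move=> e b' a' b a; move: b'; apply: fcomb_ext => [||b'].
- exact: (linear_comp (lift2_linl v _) (lift2_linl h' _)).
- exact: (linear_comp (lift2_linl w _) (lift2_linl v1 _)).
move: a'; apply: fcomb_ext => [||a'].
- exact: (linear_comp (lift2_linl v _) (lift2_linr h' _)).
- exact: (linear_comp (lift2_linr w _) (lift2_linl v2 _)).
move: b; apply: fcomb_ext => [||b].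
- exact: (linear_comp (lift2_linr v _) (lift2_linl h _)).
- exact: (linear_comp (lift2_linl w _) (lift2_linr v1 _)).
move: a; apply: fcomb_ext => [||a].
- exact: (linear_comp (lift2_linr v _) (lift2_linr h _)).
- exact: (linear_comp (lift2_linr w _) (lift2_linr v2 _)).
by rewrite !lift2_delta e.
Qed.
End Lift2Laws.

Section LinCat.
Variable D : finCat.
Definition lin_hom (X Y : D) := fcomb (fhom X Y).
Definition lin_id (X : D) : lin_hom X X := delta (fid X).
Definition lin_comp (X Y Z : D) : lin_hom Y Z -> lin_hom X Y -> lin_hom X Z :=
  lift2 (@fcomp D X Y Z).

Lemma lin_laws : @category_laws D (fun X Y => lin_hom X Y) lin_id lin_comp.
Proof.
split=> [X Y Z W c b a|X Y a|X Y a].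
- apply: (lift2A (g := fun x => x) (f := fun x => x)) => //.
  exact: (cat_assoc (flaws D)).
- apply: (lift2_unitl (g := fun x => x) (f := fun x => x)) => //.
  exact: (cat_idl (flaws D)).
- apply: (lift2_unitr (g := fun x => x) (f := fun x => x)) => //.
  exact: (cat_idr (flaws D)).
Qed.

Definition linearize : linCat k :=
  @LinCat k D lin_hom lin_id lin_comp lin_laws
    (fun X Y Z a => @lift2_linl _ _ _ _ a) (fun X Y Z b => @lift2_linr _ _ _ _ b).
End LinCat.

Section Lin2Cat.
Variable C : fin2Cat.
Definition lin2_hcat (i j : C) := linearize (fhcat i j).
Definition lin2_hcomp (i j l : C) (G G' : lin2_hcat j l) (F F' : lin2_hcat i j) :
  lhom G G' -> lhom F F' -> lhom (fcomp1 G F : lin2_hcat i l) (fcomp1 G' F') :=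
  lift2 (@fhcomp C i j l G G' F F').

Let cast_delta (i j : C) (F F' G G' : lin2_hcat i j) (eF : F = F') (eG : G = G')
    (a : fhom F G) :
  castH (fun F G : lin2_hcat i j => lhom F G) eF eG (delta a) =
  delta (castH (fun F G : fhcat i j => fhom F G) eF eG a).
Proof. by case: _ / eF; case: _ / eG. Qed.

Lemma lin2_laws : @hcomp_laws C lin2_hcat (fun i j F G => lhom F G)
  (fun i j F => lid F) (fun i j F G H b a => lcomp b a)
  (@fone C) (@fcomp1 C) lin2_hcomp.
Proof.
have L := fhlaws C.
have cl (i j : C) (F F' G G' : lin2_hcat i j) (eF : F = F') (eG : G = G') :
  linear (castH (fun F G : lin2_hcat i j => lhom F G) eF eG : lhom F G -> lhom F' G').
  exact: (castH_linear (H := fun F G : lin2_hcat i j => lhom F G)).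
unshelve econstructor.
- exact: (comp1A L).
- exact: (comp1l L).
- exact: (comp1r L).
- move=> i j l G G' G'' F F' F'' b' b a' a.
  by apply: lift2_interchange => *; exact: (hcomp_interchange L).
- move=> i j l m H H' G G' F F' c b a.
  apply: (lift2A (cl _ _ _ _ _ _ _ _) (cast_delta _ _)) => *.
  exact: (hcompA L).
- move=> i j F F'; apply: (lift2_unitl (cl _ _ _ _ _ _ _ _) (cast_delta _ _)) => *.
  exact: (hcompl L).
- move=> i j F F'; apply: (lift2_unitr (cl _ _ _ _ _ _ _ _) (cast_delta _ _)) => *.
  exact: (hcompr L).
Qed.

Lemma lin2_id (i j l : C) (G : lin2_hcat j l) (F : lin2_hcat i j) :
  lin2_hcomp (lid G) (lid F) = lid (fcomp1 G F : lin2_hcat i l).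
Proof. by rewrite /lin2_hcomp /= lift2_delta (fhcomp_id G F). Qed.

Definition linearize2 : lin2Cat k :=
  @Lin2Cat k
    (@LinSemi2Cat k C lin2_hcat (@fone C) (@fcomp1 C) lin2_hcomp lin2_laws
       (fun i j l G G' F F' a => @lift2_linl _ _ _ _ a)
       (fun i j l G G' F F' b => @lift2_linr _ _ _ _ b))
    lin2_id.
End Lin2Cat.
End Linearization.

Section DepProd.
Variables (k : fieldType) (I : Type) (V : I -> lmodType k).

Definition dprod := forall i, V i.
Definition dprod_zero : dprod := fun i => 0.
Definition dprod_opp (u : dprod) : dprod := fun i => - u i.
Definition dprod_add (u v : dprod) : dprod := fun i => u i + v i.
Definition dprod_scale (c : k) (u : dprod) : dprod := fun i => c *: u i.

Lemma dprod_ext (u v : dprod) : (forall i, u i = v i) -> u = v.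
Proof. exact: functional_extensionality_dep. Qed.

HB.instance Definition _ := gen_eqMixin dprod.
HB.instance Definition _ := gen_choiceMixin dprod.

Fact dprod_addA : associative dprod_add.
Proof. by move=> u v w; apply: dprod_ext => i; exact: addrA. Qed.
Fact dprod_addC : commutative dprod_add.
Proof. by move=> u v; apply: dprod_ext => i; exact: addrC. Qed.
Fact dprod_add0 : left_id dprod_zero dprod_add.
Proof. by move=> u; apply: dprod_ext => i; exact: add0r. Qed.
Fact dprod_addN : left_inverse dprod_zero dprod_opp dprod_add.
Proof. by move=> u; apply: dprod_ext => i; exact: addNr. Qed.
HB.instance Definition _ :=
  GRing.isZmodule.Build dprod dprod_addA dprod_addC dprod_add0 dprod_addN.

Fact dprod_scaleA a b (u : dprod) :
  dprod_scale a (dprod_scale b u) = dprod_scale (a * b) u.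
Proof. by apply: dprod_ext => i; exact: scalerA. Qed.
Fact dprod_scale1 : left_id 1 dprod_scale.
Proof. by move=> u; apply: dprod_ext => i; exact: scale1r. Qed.
Fact dprod_scaleDr : right_distributive dprod_scale +%R.
Proof. by move=> a u v; apply: dprod_ext => i; exact: scalerDr. Qed.
Fact dprod_scaleDl (u : dprod) : {morph dprod_scale^~ u : a b / a + b}.
Proof. by move=> a b; apply: dprod_ext => i; exact: scalerDl. Qed.
HB.instance Definition _ := GRing.Zmodule_isLmodule.Build k dprod
  dprod_scaleA dprod_scale1 dprod_scaleDr dprod_scaleDl.

Lemma dprodE (c : k) (u v : dprod) i : (c *: u + v) i = c *: u i + v i.
Proof. by []. Qed.
End DepProd.

(* The bijection between 'I_(m * n) and 'I_m * 'I_n in lexicographic order;    *)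
(* with this order formal direct sums compose strictly associatively.          *)
Section PairIndex.
Variables m n : nat.

Fact idx1_subproof (p : 'I_(m * n)) : (p %/ n < m)%N.
Proof. by rewrite ltn_divLR; case: n p => [|//] [p]; rewrite muln0. Qed.
Fact idx2_subproof (p : 'I_(m * n)) : (p %% n < n)%N.
Proof. by rewrite ltn_mod; case: n p => [|//] [p]; rewrite muln0. Qed.
Definition idx1 (p : 'I_(m * n)) : 'I_m := Ordinal (idx1_subproof p).
Definition idx2 (p : 'I_(m * n)) : 'I_n := Ordinal (idx2_subproof p).

Fact idx_subproof (i : 'I_m) (j : 'I_n) : (i * n + j < m * n)%N.
Proof.
by rewrite (leq_trans (n := i.+1 * n)) ?leq_mul2r ?ltn_ord ?orbT // mulSn addnC ltn_add2r.
Qed.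
Definition idx (i : 'I_m) (j : 'I_n) : 'I_(m * n) := Ordinal (idx_subproof i j).

Lemma idx1K i j : idx1 (idx i j) = i.
Proof.
have n0 : (0 < n)%N by case: n j => [[]|].
by apply: val_inj; rewrite /= divnMDl // divn_small ?addn0.
Qed.
Lemma idx2K i j : idx2 (idx i j) = j.
Proof. by apply: val_inj; rewrite /= modnMDl modn_small. Qed.
Lemma idxK p : idx (idx1 p) (idx2 p) = p.
Proof. by apply: val_inj; rewrite /= -divn_eq. Qed.

Lemma sum_idx (V : nmodType) (f : 'I_(m * n) -> V) :
  \sum_p f p = \sum_i \sum_j f (idx i j).
Proof.
rewrite pair_big /= (reindex (fun ij : 'I_m * 'I_n => idx ij.1 ij.2)) //=.
exists (fun p => (idx1 p, idx2 p)) => [[i j] _|p _] /=; first by rewrite idx1K idx2K.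
exact: idxK.
Qed.
End PairIndex.

Section LinearFacts.
Variables (k : fieldType) (V W : lmodType k) (f : V -> W).
Hypothesis lf : linear f.
Lemma linear_f0 : f 0 = 0.
Proof. by have := lf (-1) 0 0; rewrite scaler0 addr0 scaleN1r addNr. Qed.
Lemma linear_fsum I (r : seq I) (P : pred I) (v : I -> V) :
  f (\sum_(i <- r | P i) v i) = \sum_(i <- r | P i) f (v i).
Proof.
elim/big_rec2 : _ => [|i x y _ <-]; first exact: linear_f0.
by have := lf 1 (v i) y; rewrite !scale1r.
Qed.
End LinearFacts.

(* Formal finite direct sums. *)
Record fsum (T : Type) := FSum { fsn : nat; fsi :> 'I_fsn -> T }.

Section AddCat.
Variables (k : fieldType) (D : linCat k).

Definition add_hom (X Y : fsum D) : lmodType k :=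
  dprod (fun ij : 'I_(fsn Y) * 'I_(fsn X) => lhom (X ij.2) (Y ij.1)).
Definition entry (X Y : fsum D) (a : add_hom X Y) i j : lhom (X j) (Y i) := a (i, j).
Definition mat (X Y : fsum D) (E : forall i j, lhom (X j) (Y i)) : add_hom X Y :=
  fun ij => E ij.1 ij.2.
Definition add_id (X : fsum D) : add_hom X X := mat (fun i j =>
  if j =P i is ReflectT e
  then castH (fun x y : D => lhom x y) erefl (f_equal X e) (lid (X j)) else 0).
Arguments add_id X : clear implicits.
Definition add_comp (X Y Z : fsum D) (b : add_hom Y Z) (a : add_hom X Y) :
  add_hom X Z := mat (fun i j => \sum_l lcomp (entry b i l) (entry a l j)).

Lemma mat_ext (X Y : fsum D) (a b : add_hom X Y) :
  (forall i j, entry a i j = entry b i j) -> a = b.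
Proof. by move=> e; apply: dprod_ext => -[i j]; exact: e. Qed.

Lemma add_id_diag (X : fsum D) i : entry (add_id X) i i = lid (X i).
Proof. by rewrite /entry /add_id /mat /=; case: eqP => // e; rewrite castH_id. Qed.
Lemma add_id_off (X : fsum D) i j : j != i -> entry (add_id X) i j = 0.
Proof. by rewrite /entry /add_id /mat /=; case: eqP. Qed.

Lemma lcomp0r (X Y Z : D) (b : lhom Y Z) : lcomp b (0 : lhom X Y) = 0.
Proof. exact: linear_f0 (lcomp_linr (X := X) b). Qed.
Lemma lcomp0l (X Y Z : D) (a : lhom X Y) : lcomp (0 : lhom Y Z) a = 0.
Proof. exact: linear_f0 (lcomp_linl (Z := Z) a). Qed.
Lemma lcomp_sumr (X Y Z : D) (b : lhom Y Z) I (r : seq I) (P : pred I) (v : I -> lhom X Y) :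
  lcomp b (\sum_(i <- r | P i) v i) = \sum_(i <- r | P i) lcomp b (v i).
Proof. exact: linear_fsum (lcomp_linr (X := X) b) _ _ _ _. Qed.
Lemma lcomp_suml (X Y Z : D) (a : lhom X Y) I (r : seq I) (P : pred I) (v : I -> lhom Y Z) :
  lcomp (\sum_(i <- r | P i) v i) a = \sum_(i <- r | P i) lcomp (v i) a.
Proof. exact: linear_fsum (lcomp_linl (Z := Z) a) _ _ _ _. Qed.

Lemma add_laws : @category_laws (fsum D) (fun X Y => add_hom X Y) add_id add_comp.
Proof.
split=> [X Y Z W c b a|X Y a|X Y a]; apply: mat_ext => i j; rewrite /entry /=.
- rewrite /add_comp /mat /=.
  under eq_bigr => l _ do rewrite /entry /= lcomp_sumr.
  under [RHS]eq_bigr => l _ do rewrite /entry /= lcomp_suml.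
  rewrite exchange_big /=; apply: eq_bigr => l _; apply: eq_bigr => l' _.
  exact: cat_assoc (llaws D) _ _ _ _ _ _ _.
- rewrite /add_comp /mat /= (bigD1 i) //= add_id_diag (cat_idl (llaws D)).
  by rewrite big1 ?addr0 // => l ne; rewrite add_id_off // lcomp0l.
- rewrite /add_comp /mat /= (bigD1 j) //= add_id_diag (cat_idr (llaws D)).
  by rewrite big1 ?addr0 // => l ne; rewrite add_id_off ?lcomp0r // eq_sym.
Qed.

Lemma add_comp_linl (X Y Z : fsum D) (a : add_hom X Y) :
  linear (fun b : add_hom Y Z => add_comp b a).
Proof.
move=> c b b'; apply: mat_ext => i j; rewrite /entry dprodE /add_comp /mat /=.
rewrite scaler_sumr -big_split; apply: eq_bigr => l _.
exact: (lcomp_linl (entry a l j)).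
Qed.
Lemma add_comp_linr (X Y Z : fsum D) (b : add_hom Y Z) :
  linear (fun a : add_hom X Y => add_comp b a).
Proof.
move=> c a a'; apply: mat_ext => i j; rewrite /entry dprodE /add_comp /mat /=.
rewrite scaler_sumr -big_split; apply: eq_bigr => l _.
exact: (lcomp_linr (entry b i l)).
Qed.

Definition additive_closure : linCat k :=
  @LinCat k (fsum D) add_hom add_id add_comp add_laws add_comp_linl add_comp_linr.

Lemma fsum_ext (X Y : fsum D) (e : fsn X = fsn Y) :
  (forall i, X i = Y (cast_ord e i)) -> X = Y.
Proof.
case: X Y e => [n X] [m Y] /= e; case: _ / e Y => Y h; congr FSum.
by apply: funext => i; rewrite h; congr Y; apply: val_inj.
Qed.

Lemma fsn_eq (X Y : fsum D) : X = Y -> fsn X = fsn Y.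
Proof. by move=> ->. Qed.

Lemma tot_entry (X Y X' Y' : fsum D) (eX : X = X') (eY : Y = Y') (a : add_hom X Y)
    i j i' j' : val i = val i' -> val j = val j' ->
  tot (H := fun x y : D => lhom x y)
    (entry (castH (fun X Y => add_hom X Y) eX eY a) i' j') =
  tot (H := fun x y : D => lhom x y) (entry a i j).
Proof.
case: _ / eX j'; case: _ / eY i' => i' j' ei ej.
by rewrite (val_inj ei) (val_inj ej).
Qed.
End AddCat.
Arguments add_id {k D} X.

Section Add2Cat.
Variables (k : fieldType) (C : lin2Cat k).

Definition add2_hcat (i j : C) := additive_closure (hcat i j).
Definition add2_one (i : C) : add2_hcat i i := FSum (fun _ : 'I_1 => one1 i).
Definition add2_comp1 (i j l : C) (G : add2_hcat j l) (F : add2_hcat i j) :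
  add2_hcat i l := FSum (fun p : 'I_(fsn G * fsn F) => comp1 (G (idx1 p)) (F (idx2 p))).
Definition add2_hcomp (i j l : C) (G G' : add2_hcat j l) (F F' : add2_hcat i j)
    (b : lhom G G') (a : lhom F F') : lhom (add2_comp1 G F) (add2_comp1 G' F') :=
  mat (X := add2_comp1 G F) (Y := add2_comp1 G' F')
    (fun p q => hcomp (entry b (idx1 p) (idx1 q)) (entry a (idx2 p) (idx2 q))).

Let L := hlaws C.
Let tt2 (i j : C) (F G : hcat i j) (a : lhom F G) := tot (H := fun x y : hcat i j => lhom x y) a.

Lemma hcomp0r (i j l : C) (G G' : hcat j l) (F F' : hcat i j) (b : lhom G G') :
  hcomp b (0 : lhom F F') = 0.
Proof. exact: linear_f0 (hcomp_linr (F := F) (F' := F') b). Qed.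
Lemma hcomp0l (i j l : C) (G G' : hcat j l) (F F' : hcat i j) (a : lhom F F') :
  hcomp (0 : lhom G G') a = 0.
Proof. exact: linear_f0 (hcomp_linl (G := G) (G' := G') a). Qed.
Lemma hcomp_sumr (i j l : C) (G G' : hcat j l) (F F' : hcat i j) (b : lhom G G')
    I (r : seq I) (P : pred I) (v : I -> lhom F F') :
  hcomp b (\sum_(i <- r | P i) v i) = \sum_(i <- r | P i) hcomp b (v i).
Proof. exact: linear_fsum (hcomp_linr (F := F) (F' := F') b) _ _ _ _. Qed.
Lemma hcomp_suml (i j l : C) (G G' : hcat j l) (F F' : hcat i j) (a : lhom F F')
    I (r : seq I) (P : pred I) (v : I -> lhom G G') :
  hcomp (\sum_(i <- r | P i) v i) a = \sum_(i <- r | P i) hcomp (v i) a.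
Proof. exact: linear_fsum (hcomp_linl (G := G) (G' := G') a) _ _ _ _. Qed.

Lemma tot_hcomp (i j l : C) (G1 G1' G2 G2' : hcat j l) (F1 F1' F2 F2' : hcat i j)
    (b1 : lhom G1 G1') (b2 : lhom G2 G2') (a1 : lhom F1 F1') (a2 : lhom F2 F2') :
  tt2 b1 = tt2 b2 -> tt2 a1 = tt2 a2 -> tt2 (hcomp b1 a1) = tt2 (hcomp b2 a2).
Proof.
move=> hb ha; have [e1 [e2 eb]] := tot_castE hb; have [e3 [e4 ea]] := tot_castE ha.
by destruct e1, e2, e3, e4; rewrite -eb -ea.
Qed.

Lemma tot_hcompA (i j l m : C) (H H' : hcat l m) (G G' : hcat j l) (F F' : hcat i j)
  (c : lhom H H') (b : lhom G G') (a : lhom F F') :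
  tt2 (hcomp c (hcomp b a)) = tt2 (hcomp (hcomp c b) a).
Proof. by rewrite -(hcompA L) /tt2 tot_cast. Qed.
Lemma tot_hcompl (i j : C) (F F' : hcat i j) (a : lhom F F') :
  tt2 (hcomp (lid (one1 j)) a) = tt2 a.
Proof. by rewrite -[in RHS](hcompl L a) /tt2 tot_cast. Qed.
Lemma tot_hcompr (i j : C) (F F' : hcat i j) (a : lhom F F') :
  tt2 (hcomp a (lid (one1 i))) = tt2 a.
Proof. by rewrite -[in RHS](hcompr L a) /tt2 tot_cast. Qed.

Let divnM' x a b : (x %/ (a * b) = x %/ b %/ a)%N.
Proof. by rewrite mulnC divnMA. Qed.

Lemma add2_A (i j l m : C) (H : add2_hcat l m) (G : add2_hcat j l) (F : add2_hcat i j) :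
  add2_comp1 H (add2_comp1 G F) = add2_comp1 (add2_comp1 H G) F.
Proof.
refine (@fsum_ext k (hcat i m) (add2_comp1 H (add2_comp1 G F)) (add2_comp1 (add2_comp1 H G) F)
  (mulnA (fsn H) (fsn G) (fsn F)) _) => p /=; rewrite (comp1A L).
congr (comp1 (comp1 (H _) (G _)) (F _)); apply: val_inj => /=.
- exact: divnM'.
- exact: (esym (modn_divl _ _ _)).
- by rewrite modn_dvdm // dvdn_mull.
Qed.
Lemma add2_l (i j : C) (F : add2_hcat i j) : add2_comp1 (add2_one j) F = F.
Proof.
refine (@fsum_ext k (hcat i j) (add2_comp1 (add2_one j) F) F (mul1n (fsn F)) _) => p /=; rewrite (comp1l L).
by congr (F _); apply: val_inj; rewrite /= modn_small // -[X in (_ < X)%N]mul1n.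
Qed.
Lemma add2_r (i j : C) (F : add2_hcat i j) : add2_comp1 F (add2_one i) = F.
Proof.
refine (@fsum_ext k (hcat i j) (add2_comp1 F (add2_one i)) F (muln1 (fsn F)) _) => p /=; rewrite (comp1r L).
by congr (F _); apply: val_inj; rewrite /= divn1.
Qed.

Lemma tot_entry_eq (i j : C) (F F' : add2_hcat i j) (a : lhom F F') p p' q q' :
  p = p' -> q = q' -> tt2 (entry a p q) = tt2 (entry a p' q').
Proof. by move=> -> ->. Qed.

Lemma add2_laws : @hcomp_laws C add2_hcat (fun i j F G => lhom F G)
  (fun i j F => lid F) (fun i j F G H b a => lcomp b a)
  add2_one add2_comp1 add2_hcomp.
Proof.
exists add2_A add2_l add2_r.
- move=> i j l G G' G'' F F' F'' b' b a' a; apply: mat_ext => p q.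
  rewrite /entry /= /add_comp /mat /= sum_idx /add2_hcomp /entry /mat /=.
  rewrite hcomp_suml; apply: eq_bigr => r _; rewrite hcomp_sumr; apply: eq_bigr => s _.
  by rewrite /entry /= (hcomp_interchange L) idx1K idx2K.
- move=> i j l m H H' G G' F F' c b a; apply: mat_ext => p' q'.
  pose p : 'I_(fsn (add2_comp1 H' (add2_comp1 G' F'))) := cast_ord (esym (mulnA _ _ _)) p'.
  pose q : 'I_(fsn (add2_comp1 H (add2_comp1 G F))) := cast_ord (esym (mulnA _ _ _)) q'.
  apply: (@tot_inj _ (fun x y : hcat _ _ => lhom x y)).
  refine (etrans (tot_entry _ _ _ (i := p) (j := q) (i' := p') (j' := q') erefl erefl) _).
  rewrite -/(tt2 _) -/(tt2 _) /entry /add2_hcomp /mat /= tot_hcompA.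
  apply: tot_hcomp; first apply: tot_hcomp.
  + by apply: tot_entry_eq; apply: val_inj; exact: divnM'.
  + by apply: tot_entry_eq; apply: val_inj; exact: (esym (modn_divl _ _ _)).
  + by apply: tot_entry_eq; apply: val_inj; rewrite /= modn_dvdm // dvdn_mull.
- move=> i j F F' a; apply: mat_ext => p' q'.
  pose p : 'I_(fsn (add2_comp1 (add2_one j) F')) := cast_ord (esym (mul1n _)) p'.
  pose q : 'I_(fsn (add2_comp1 (add2_one j) F)) := cast_ord (esym (mul1n _)) q'.
  apply: (@tot_inj _ (fun x y : hcat _ _ => lhom x y)).
  refine (etrans (tot_entry _ _ _ (i := p) (j := q) (i' := p') (j' := q') erefl erefl) _).
  rewrite -/(tt2 _) -/(tt2 _) /entry /add2_hcomp /mat /=.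
  rewrite !(ord1 (idx1 _)) (@add_id_diag _ _ (add2_one j)) tot_hcompl.
  by apply: tot_entry_eq; apply: val_inj; rewrite /= modn_small.
- move=> i j F F' a; apply: mat_ext => p' q'.
  pose p : 'I_(fsn (add2_comp1 F' (add2_one i))) := cast_ord (esym (muln1 _)) p'.
  pose q : 'I_(fsn (add2_comp1 F (add2_one i))) := cast_ord (esym (muln1 _)) q'.
  apply: (@tot_inj _ (fun x y : hcat _ _ => lhom x y)).
  refine (etrans (tot_entry _ _ _ (i := p) (j := q) (i' := p') (j' := q') erefl erefl) _).
  rewrite -/(tt2 _) -/(tt2 _) /entry /add2_hcomp /mat /=.
  rewrite !(ord1 (idx2 _)) (@add_id_diag _ _ (add2_one i)) tot_hcompr.
  by apply: tot_entry_eq; apply: val_inj; rewrite /= divn1.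
Qed.

Lemma add2_hcomp_linl (i j l : C) (G G' : add2_hcat j l) (F F' : add2_hcat i j)
  (a : lhom F F') : linear (fun b : lhom G G' => add2_hcomp b a).
Proof. by move=> c b b'; apply: mat_ext => p q; exact: (hcomp_linl (entry a _ _)). Qed.
Lemma add2_hcomp_linr (i j l : C) (G G' : add2_hcat j l) (F F' : add2_hcat i j)
  (b : lhom G G') : linear (fun a : lhom F F' => add2_hcomp b a).
Proof. by move=> c a a'; apply: mat_ext => p q; exact: (hcomp_linr (entry b _ _)). Qed.

Definition add2_semi : linSemi2Cat k :=
  @LinSemi2Cat k C add2_hcat add2_one add2_comp1 add2_hcomp add2_laws
    add2_hcomp_linl add2_hcomp_linr.

Lemma add2_id (i j l : add2_semi) (G : hcat j l) (F : hcat i j) :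
  hcomp (lid G) (lid F) = lid (comp1 G F).
Proof.
apply: mat_ext => p q; have [->|ne] := eqVneq q p.
  by rewrite add_id_diag /entry /= /add2_hcomp /mat /= !add_id_diag hcomp_id.
rewrite add_id_off // /entry /= /add2_hcomp /mat /=.
have [e1|n1] := eqVneq (idx1 q) (idx1 p); last by rewrite (add_id_off n1) hcomp0l.
have [e2|n2] := eqVneq (idx2 q) (idx2 p); last by rewrite (add_id_off n2) hcomp0r.
by move: ne; rewrite -(idxK q) e1 e2 idxK eqxx.
Qed.

Definition additive_closure2 : lin2Cat k := @Lin2Cat k add2_semi add2_id.
End Add2Cat.

(* The image of a linear endomorphism, as a subspace. *)
Section LinearImage.
Variables (k : fieldType) (V : lmodType k) (p : V -> V).

Definition in_image : pred V := fun v => `[< exists u, v = p u >].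
Record image (lp : linear p) := Image { imval : V; _ : in_image imval }.
Variable lp : linear p.
HB.instance Definition _ := [isSub for @imval lp].
HB.instance Definition _ := [Choice of image lp by <:].

Fact image_closed : subsemimod_closed in_image.
Proof.
split; first split.
- by apply/asboolP; exists 0; rewrite linear_f0.
- move=> _ _ /asboolP[u ->] /asboolP[v ->]; apply/asboolP; exists (u + v).
  by have := lp 1 u v; rewrite !scale1r.
- move=> c _ /asboolP[u ->]; apply/asboolP; exists (c *: u).
  by have := lp c u 0; rewrite !addr0 (linear_f0 lp) addr0.
Qed.
HB.instance Definition _ :=
  GRing.SubChoice_isSubLmodule.Build k V in_image (image lp) image_closed.

Lemma imvalE (x : image lp) : exists u, imval x = p u.
Proof. by case: x => v /= /asboolP. Qed.
Lemma imval_fix (x : image lp) : (forall u, p (p u) = p u) -> p (imval x) = imval x.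
Proof. by move=> pp; have [u ->] := imvalE x. Qed.
Lemma imval_lin : linear (@imval lp). Proof. by []. Qed.
Lemma imval_inj : injective (@imval lp). Proof. exact: val_inj. Qed.

Definition in_im (v : V) (h : exists u, v = p u) : image lp := Image lp (asboolT h).
End LinearImage.

Definition image_mod (k : fieldType) (V : lmodType k) (p : V -> V) (lp : linear p) :
  lmodType k := image lp.

Section Karoubi.
Variables (k : fieldType) (D : linCat k).

Record kobj := KObj {
  kob : D;
  kidem : lhom kob kob;
  kidemP : kidem \v kidem = kidem }.

(* The morphisms from (X, e) to (Y, f) are the elements of f \v Hom(X, Y) \v e. *)
Definition kproj (X Y : kobj) (a : lhom (kob X) (kob Y)) : lhom (kob X) (kob Y) :=
  kidem Y \v (a \v kidem X).

Lemma kproj_lin (X Y : kobj) : linear (@kproj X Y).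
Proof. exact: linear_comp (lcomp_linr (kidem Y)) (lcomp_linl (kidem X)). Qed.

Definition kar_hom (X Y : kobj) : lmodType k := image_mod (@kproj_lin X Y).

Let A (X Y Z W : D) (c : lhom Z W) (b : lhom Y Z) (a : lhom X Y) := cat_assoc (llaws D) c b a.

Lemma kproj_idem (X Y : kobj) a : kproj (kproj a) = kproj a :> lhom (kob X) (kob Y).
Proof. by rewrite /kproj !A kidemP -!A kidemP. Qed.
Lemma kfix (X Y : kobj) (a : kar_hom X Y) : kproj (imval a) = imval a.
Proof. exact: imval_fix (@kproj_idem X Y). Qed.
Lemma kfixl (X Y : kobj) (a : kar_hom X Y) : kidem Y \v imval a = imval a.
Proof. by rewrite -kfix /kproj A kidemP. Qed.
Lemma kfixr (X Y : kobj) (a : kar_hom X Y) : imval a \v kidem X = imval a.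
Proof. by rewrite -kfix /kproj -!A kidemP. Qed.

Fact kar_id_subproof (X : kobj) : exists u, kidem X = kproj u.
Proof. by exists (kidem X); rewrite /kproj !kidemP. Qed.
Definition kar_id (X : kobj) : kar_hom X X := in_im _ (kar_id_subproof X).

Fact kar_comp_subproof (X Y Z : kobj) (b : kar_hom Y Z) (a : kar_hom X Y) :
  exists u, imval b \v imval a = kproj u.
Proof. by exists (imval b \v imval a); rewrite /kproj -A kfixr A kfixl. Qed.
Definition kar_comp (X Y Z : kobj) (b : kar_hom Y Z) (a : kar_hom X Y) : kar_hom X Z :=
  in_im _ (kar_comp_subproof b a).

Lemma kar_laws : @category_laws kobj (fun X Y => kar_hom X Y) kar_id kar_comp.
Proof.
split=> [X Y Z W c b a|X Y a|X Y a]; apply: imval_inj => /=.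
- exact: A.
- exact: kfixl.
- exact: kfixr.
Qed.

Lemma kar_comp_linl (X Y Z : kobj) (a : kar_hom X Y) :
  linear (fun b : kar_hom Y Z => kar_comp b a).
Proof. by move=> c b b'; apply: imval_inj; exact: (lcomp_linl (imval a)). Qed.
Lemma kar_comp_linr (X Y Z : kobj) (b : kar_hom Y Z) :
  linear (fun a : kar_hom X Y => kar_comp b a).
Proof. by move=> c a a'; apply: imval_inj; exact: (lcomp_linr (imval b)). Qed.

Definition karoubi : linCat k :=
  @LinCat k kobj kar_hom kar_id kar_comp kar_laws kar_comp_linl kar_comp_linr.

Lemma kobj_ext (X Y : kobj) (e : kob X = kob Y) :
  castH (fun x y : D => lhom x y) e e (kidem X) = kidem Y -> X = Y.
Proof.
case: X Y e => [X f hf] [Y g hg] /= e; destruct e => /= efg; destruct efg.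
by rewrite (Prop_irrelevance hf hg).
Qed.

Lemma tot_imval (X X' Y Y' : kobj) (eX : X = X') (eY : Y = Y') (a : kar_hom X Y) :
  tot (H := fun x y : D => lhom x y)
    (imval (castH (fun X Y => kar_hom X Y) eX eY a)) =
  tot (H := fun x y : D => lhom x y) (imval a).
Proof. by destruct eX, eY. Qed.
End Karoubi.

Section TotLemmas.
Variables (k : fieldType) (C : linSemi2Cat k).
Let L := hlaws C.

Definition tot2 (i j : C) (F G : hcat i j) (a : lhom F G) :=
  tot (H := fun x y : hcat i j => lhom x y) a.

Lemma tot2_inj (i j : C) (F G : hcat i j) (a b : lhom F G) :
  tot2 a = tot2 b -> a = b.
Proof. exact: (@tot_inj _ (fun x y : hcat i j => lhom x y)). Qed.

Lemma tot2_cast (i j : C) (F F' G G' : hcat i j) (eF : F = F') (eG : G = G')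
    (a : lhom F G) :
  tot2 (castH (fun x y : hcat i j => lhom x y) eF eG a) = tot2 a.
Proof. exact: (tot_cast (H := fun x y : hcat i j => lhom x y)). Qed.

Lemma tot2_h (i j l : C) (G1 G1' G2 G2' : hcat j l) (F1 F1' F2 F2' : hcat i j)
    (b1 : lhom G1 G1') (b2 : lhom G2 G2') (a1 : lhom F1 F1') (a2 : lhom F2 F2') :
  tot2 b1 = tot2 b2 -> tot2 a1 = tot2 a2 -> tot2 (b1 \h a1) = tot2 (b2 \h a2).
Proof.
move=> hb ha; have [e1 [e2 eb]] := tot_castE hb; have [e3 [e4 ea]] := tot_castE ha.
by destruct e1, e2, e3, e4; rewrite -eb -ea.
Qed.

Lemma tot2_v (i j : C) (F G H F' G' H' : hcat i j)
    (b : lhom G H) (b' : lhom G' H') (a : lhom F G) (a' : lhom F' G') :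
  tot2 b = tot2 b' -> tot2 a = tot2 a' -> tot2 (b \v a) = tot2 (b' \v a').
Proof.
move=> hb ha; have [e1 [e2 eb]] := tot_castE hb; have [e3 [e4 ea]] := tot_castE ha.
by destruct e1, e2, e3; rewrite (castH_id _ e4) in ea *; rewrite -eb -ea castH_id.
Qed.

Lemma tot2_A (i j l m : C) (H H' : hcat l m) (G G' : hcat j l) (F F' : hcat i j)
  (c : lhom H H') (b : lhom G G') (a : lhom F F') :
  tot2 (c \h (b \h a)) = tot2 (c \h b \h a).
Proof. by rewrite -(hcompA L) tot2_cast. Qed.
Lemma tot2_l (i j : C) (F F' : hcat i j) (a : lhom F F') :
  tot2 (lid (one1 j) \h a) = tot2 a.
Proof. by rewrite -[in RHS](hcompl L a) tot2_cast. Qed.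
Lemma tot2_r (i j : C) (F F' : hcat i j) (a : lhom F F') :
  tot2 (a \h lid (one1 i)) = tot2 a.
Proof. by rewrite -[in RHS](hcompr L a) tot2_cast. Qed.
End TotLemmas.

(* Idempotent completion of the categories of 1-morphisms. Preservation of     *)
(* identity 2-morphisms is not needed in the input, and holds in the output.   *)
Section Karoubi2.
Variables (k : fieldType) (C : linSemi2Cat k).
Let L := hlaws C.

Definition kar2_hcat (i j : C) := karoubi (hcat i j).
Fact kar2_one_subproof (i : C) : lid (one1 i) \v lid (one1 i) = lid (one1 i).
Proof. exact: cat_idl (llaws _) _ _ _. Qed.
Definition kar2_one (i : C) : kar2_hcat i i := KObj (kar2_one_subproof i).

Fact kar2_comp1_subproof (i j l : C) (G : kar2_hcat j l) (F : kar2_hcat i j) :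
  (kidem G \h kidem F) \v (kidem G \h kidem F) = kidem G \h kidem F.
Proof. by rewrite (hcomp_interchange L) !kidemP. Qed.
Definition kar2_comp1 (i j l : C) (G : kar2_hcat j l) (F : kar2_hcat i j) :
  kar2_hcat i l := KObj (kar2_comp1_subproof G F).

Fact kar2_hcomp_subproof (i j l : C) (G G' : kar2_hcat j l) (F F' : kar2_hcat i j)
    (b : lhom G G') (a : lhom F F') :
  exists u, imval b \h imval a = @kproj _ _ (kar2_comp1 G F) (kar2_comp1 G' F') u.
Proof.
exists (imval b \h imval a); rewrite /kproj /= !(hcomp_interchange L).
by rewrite !kfixr !kfixl.
Qed.
Definition kar2_hcomp (i j l : C) (G G' : kar2_hcat j l) (F F' : kar2_hcat i j)
    (b : lhom G G') (a : lhom F F') : lhom (kar2_comp1 G F) (kar2_comp1 G' F') :=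
  in_im _ (kar2_hcomp_subproof b a).

Lemma kar2_A (i j l m : C) (H : kar2_hcat l m) (G : kar2_hcat j l) (F : kar2_hcat i j) :
  kar2_comp1 H (kar2_comp1 G F) = kar2_comp1 (kar2_comp1 H G) F.
Proof.
refine (@kobj_ext k (hcat i m) (kar2_comp1 H (kar2_comp1 G F))
  (kar2_comp1 (kar2_comp1 H G) F) (comp1A L _ _ _) _).
by apply: tot2_inj; rewrite tot2_cast /= tot2_A.
Qed.
Lemma kar2_l (i j : C) (F : kar2_hcat i j) : kar2_comp1 (kar2_one j) F = F.
Proof.
refine (@kobj_ext k (hcat i j) (kar2_comp1 (kar2_one j) F) F (comp1l L _) _).
by apply: tot2_inj; rewrite tot2_cast /= tot2_l.
Qed.
Lemma kar2_r (i j : C) (F : kar2_hcat i j) : kar2_comp1 F (kar2_one i) = F.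
Proof.
refine (@kobj_ext k (hcat i j) (kar2_comp1 F (kar2_one i)) F (comp1r L _) _).
by apply: tot2_inj; rewrite tot2_cast /= tot2_r.
Qed.

Lemma kar2_laws : @hcomp_laws C kar2_hcat (fun i j F G => lhom F G)
  (fun i j F => lid F) (fun i j F G H b a => lcomp b a)
  kar2_one kar2_comp1 kar2_hcomp.
Proof.
exists kar2_A kar2_l kar2_r.
- by move=> i j l G G' G'' F F' F'' b' b a' a; apply: imval_inj; exact: (hcomp_interchange L).
- move=> i j l m H H' G G' F F' c b a; apply: imval_inj; apply: tot2_inj.
  refine (etrans (tot_imval _ _ _) _); exact: tot2_A.
- move=> i j F F' a; apply: imval_inj; apply: tot2_inj.
  refine (etrans (tot_imval _ _ _) _); exact: tot2_l.
- move=> i j F F' a; apply: imval_inj; apply: tot2_inj.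
  refine (etrans (tot_imval _ _ _) _); exact: tot2_r.
Qed.

Lemma kar2_hcomp_linl (i j l : C) (G G' : kar2_hcat j l) (F F' : kar2_hcat i j)
  (a : lhom F F') : linear (fun b : lhom G G' => kar2_hcomp b a).
Proof. by move=> c b b'; apply: imval_inj; exact: (hcomp_linl (imval a)). Qed.
Lemma kar2_hcomp_linr (i j l : C) (G G' : kar2_hcat j l) (F F' : kar2_hcat i j)
  (b : lhom G G') : linear (fun a : lhom F F' => kar2_hcomp b a).
Proof. by move=> c a a'; apply: imval_inj; exact: (hcomp_linr (imval b)). Qed.

Definition kar2_semi : linSemi2Cat k :=
  @LinSemi2Cat k C kar2_hcat kar2_one kar2_comp1 kar2_hcomp kar2_laws
    kar2_hcomp_linl kar2_hcomp_linr.

Lemma kar2_id (i j l : kar2_semi) (G : hcat j l) (F : hcat i j) :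
  lid G \h lid F = lid (G \c F).
Proof. exact: imval_inj. Qed.

Definition karoubi2 : lin2Cat k := @Lin2Cat k kar2_semi kar2_id.
End Karoubi2.

Definition linear_hull (k : fieldType) (C : fin2Cat) : lin2Cat k :=
  karoubi2 (additive_closure2 (linearize2 k C)).

Definition primitive_idempotent (k : fieldType) (D : linCat k) (X : D)
    (e : lhom X X) : Prop :=
  [/\ e \v e = e, e <> 0 &
   forall f g : lhom X X, f \v f = f -> g \v g = g -> f \v g = 0 -> g \v f = 0 ->
     e = f + g -> f = 0 \/ g = 0].

(* The objects of bar C are pairs of an object i of C and a primitive          *)
(* idempotent of End(one1 i); Hom(F, G) is eps_t \h Hom_C(F, G) \h eps_s with   *)
(* identities eps_t \h lid F \h eps_s; 1-morphisms, their composition, the      *)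
(* identity 1-morphisms and the compositions of 2-morphisms are those of C.    *)
(* As soon as some one1 i has two orthogonal primitive idempotents, horizontal *)
(* composition in bar C does not preserve identity 2-morphisms, see            *)
(* bar_hcomp_not_id; it satisfies all the other laws.                          *)
Section Bar.
Variables (k : fieldType) (C : lin2Cat k).
Let L := hlaws C.

Record bar_ob := BarOb {
  bob : C;
  beps : lhom (one1 bob) (one1 bob);
  bepsP : primitive_idempotent beps }.

Let bepsK (s : bar_ob) : beps s \v beps s = beps s. Proof. by have [] := bepsP s. Qed.

Definition bproj (s t : bar_ob) (F G : hcat (bob s) (bob t)) (a : lhom F G) : lhom F G :=
  castH (fun x y : hcat (bob s) (bob t) => lhom x y)
    (etrans (comp1l (hlaws C) _) (comp1r (hlaws C) F))
    (etrans (comp1l (hlaws C) _) (comp1r (hlaws C) G))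
    (beps t \h (a \h beps s)).

Lemma tot_bproj (s t : bar_ob) (F G : hcat (bob s) (bob t)) (a : lhom F G) :
  tot2 (bproj a) = tot2 (beps t \h (a \h beps s)).
Proof. exact: tot2_cast. Qed.

Lemma bproj_lin (s t : bar_ob) (F G : hcat (bob s) (bob t)) : linear (@bproj s t F G).
Proof.
refine (linear_comp (castH_linear (H := fun x y : hcat _ _ => lhom x y) _ _) _).
exact: linear_comp (hcomp_linr (beps t)) (hcomp_linl (beps s)).
Qed.

Definition bar_hom (s t : bar_ob) (F G : hcat (bob s) (bob t)) : lmodType k :=
  image_mod (@bproj_lin s t F G).

Lemma beps_hh (s : bar_ob) : tot2 (beps s \h beps s) = tot2 (beps s).
Proof.
have -> : beps s \h beps s = (beps s \h lid _) \v (lid _ \h beps s).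
  by rewrite (hcomp_interchange L) (cat_idl (llaws _)) (cat_idr (llaws _)).
by rewrite -[in RHS](bepsK s); apply: tot2_v; [exact: tot2_r|exact: tot2_l].
Qed.

Lemma bproj_comp (s t : bar_ob) (F G H : hcat (bob s) (bob t))
    (b : lhom G H) (a : lhom F G) :
  bproj b \v bproj a = bproj (b \v a).
Proof.
apply: tot2_inj; rewrite tot_bproj.
have -> : beps t \h (b \v a \h beps s) =
    (beps t \h (b \h beps s)) \v (beps t \h (a \h beps s)).
  by rewrite !(hcomp_interchange L) !bepsK.
by apply: tot2_v; exact: tot_bproj.
Qed.

Lemma bprojl (s t : bar_ob) (F G : hcat (bob s) (bob t)) (a : bar_hom F G) :
  tot2 (beps t \h imval a) = tot2 (imval a).
Proof.
have [u ->] := imvalE a; rewrite tot_bproj.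
rewrite (tot2_h erefl (tot_bproj u)) tot2_A.
exact: tot2_h (beps_hh t) erefl.
Qed.
Lemma bprojr (s t : bar_ob) (F G : hcat (bob s) (bob t)) (a : bar_hom F G) :
  tot2 (imval a \h beps s) = tot2 (imval a).
Proof.
have [u ->] := imvalE a; rewrite tot_bproj.
rewrite (tot2_h (tot_bproj u) erefl) -tot2_A.
apply: tot2_h => //; rewrite -tot2_A.
by apply: tot2_h => //; exact: beps_hh.
Qed.

Fact bar_id_subproof (s t : bar_ob) (F : hcat (bob s) (bob t)) :
  exists u, bproj (lid F) = bproj u.
Proof. by exists (lid F). Qed.
Definition bar_id (s t : bar_ob) (F : hcat (bob s) (bob t)) : bar_hom F F :=
  in_im _ (bar_id_subproof F).
Fact bar_vcomp_subproof (s t : bar_ob) (F G H : hcat (bob s) (bob t))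
    (b : bar_hom G H) (a : bar_hom F G) : exists u, imval b \v imval a = bproj u.
Proof.
have [v ->] := imvalE b; have [u ->] := imvalE a.
by exists (v \v u); exact: bproj_comp.
Qed.
Definition bar_vcomp (s t : bar_ob) (F G H : hcat (bob s) (bob t))
    (b : bar_hom G H) (a : bar_hom F G) : bar_hom F H :=
  in_im _ (bar_vcomp_subproof b a).

Lemma bar_cat_laws (s t : bar_ob) : @category_laws (hcat (bob s) (bob t))
  (fun F G => bar_hom F G) (fun F => bar_id F) (fun F G H b a => bar_vcomp b a).
Proof.
split=> [X Y Z W c b a|X Y a|X Y a]; apply: imval_inj => /=.
- exact: cat_assoc (llaws _) _ _ _ _ _ _ _.
- by have [u ->] := imvalE a; rewrite bproj_comp (cat_idl (llaws _)).
- by have [u ->] := imvalE a; rewrite bproj_comp (cat_idr (llaws _)).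
Qed.
Lemma bar_vcomp_linl (s t : bar_ob) (X Y Z : hcat (bob s) (bob t)) (a : bar_hom X Y) :
  linear (fun b : bar_hom Y Z => bar_vcomp b a).
Proof. by move=> c b b'; apply: imval_inj; exact: (lcomp_linl (imval a)). Qed.
Lemma bar_vcomp_linr (s t : bar_ob) (X Y Z : hcat (bob s) (bob t)) (b : bar_hom Y Z) :
  linear (fun a : bar_hom X Y => bar_vcomp b a).
Proof. by move=> c a a'; apply: imval_inj; exact: (lcomp_linr (imval b)). Qed.

Definition bar_hcat (s t : bar_ob) : linCat k :=
  @LinCat k (hcat (bob s) (bob t)) (@bar_hom s t) (@bar_id s t) (@bar_vcomp s t)
    (bar_cat_laws s t) (@bar_vcomp_linl s t) (@bar_vcomp_linr s t).

Fact bar_hcomp_subproof (s t u : bar_ob) (G G' : bar_hcat t u) (F F' : bar_hcat s t)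
    (b : lhom G G') (a : lhom F F') :
  exists x, imval b \h imval a = @bproj s u (G \c F) (G' \c F') x.
Proof.
exists (imval b \h imval a); apply: tot2_inj; rewrite tot_bproj.
rewrite -[LHS](tot2_h (bprojl b) (bprojr a)) -tot2_A.
exact: tot2_h erefl (tot2_A _ _ _).
Qed.
Definition bar_hcomp (s t u : bar_ob) (G G' : bar_hcat t u) (F F' : bar_hcat s t)
    (b : lhom G G') (a : lhom F F') : lhom (G \c F : bar_hcat s u) (G' \c F') :=
  in_im _ (bar_hcomp_subproof b a).

Lemma tot_imval_bar (s t : bar_ob) (X X' Y Y' : bar_hcat s t) (eX : X = X')
    (eY : Y = Y') (a : lhom X Y) :
  tot2 (imval (castH (fun X Y : bar_hcat s t => lhom X Y) eX eY a)) = tot2 (imval a).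
Proof. by destruct eX, eY. Qed.

Lemma tot_bar_one (s : bar_ob) : tot2 (bproj (s := s) (t := s) (lid (one1 (bob s)))) = tot2 (beps s).
Proof.
rewrite tot_bproj -[RHS]beps_hh; apply: tot2_h => //; exact: tot2_l.
Qed.

Lemma bar_laws : @hcomp_laws bar_ob bar_hcat (fun s t F G => lhom F G)
  (fun s t F => lid F) (fun s t F G H b a => lcomp b a)
  (fun s => one1 (bob s)) (fun s t u G F => G \c F) bar_hcomp.
Proof.
exists (fun s t u v => @comp1A _ _ _ _ _ _ _ _ L (bob s) (bob t) (bob u) (bob v))
       (fun s t => @comp1l _ _ _ _ _ _ _ _ L (bob s) (bob t))
       (fun s t => @comp1r _ _ _ _ _ _ _ _ L (bob s) (bob t)).
- by move=> i j l G G' G'' F F' F'' b' b a' a; apply: imval_inj; exact: (hcomp_interchange L).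
- move=> i j l m H H' G G' F F' c b a; apply: imval_inj; apply: tot2_inj.
  rewrite tot_imval_bar; exact: tot2_A.
- move=> i j F F' a; apply: imval_inj; apply: tot2_inj.
  rewrite tot_imval_bar -[RHS]bprojl; exact: tot2_h (tot_bar_one j) erefl.
- move=> i j F F' a; apply: imval_inj; apply: tot2_inj.
  rewrite tot_imval_bar -[RHS]bprojr; exact: tot2_h erefl (tot_bar_one i).
Qed.

Lemma bar_hcomp_linl (i j l : bar_ob) (G G' : bar_hcat j l) (F F' : bar_hcat i j)
  (a : lhom F F') : linear (fun b : lhom G G' => bar_hcomp b a).
Proof. by move=> c b b'; apply: imval_inj; exact: (hcomp_linl (imval a)). Qed.
Lemma bar_hcomp_linr (i j l : bar_ob) (G G' : bar_hcat j l) (F F' : bar_hcat i j)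
  (b : lhom G G') : linear (fun a : lhom F F' => bar_hcomp b a).
Proof. by move=> c a a'; apply: imval_inj; exact: (hcomp_linr (imval b)). Qed.

Definition bar : linSemi2Cat k :=
  @LinSemi2Cat k bar_ob bar_hcat (fun s => one1 (bob s)) (fun s t u G F => G \c F)
    bar_hcomp bar_laws bar_hcomp_linl bar_hcomp_linr.

Lemma bar_hcomp_not_id (i : C) (e e' : lhom (one1 i) (one1 i))
    (pe : primitive_idempotent e) (pe' : primitive_idempotent e') :
  e' \v e = 0 ->
  let s := BarOb pe in let t := BarOb pe' in
  let F : @hcat k bar s t := one1 i in let G : @hcat k bar t s := one1 i in
  lid G \h lid F <> lid (G \c F).
Proof.
move=> ee' s t F G.
have F0 : imval (lid F) = 0.
  apply: tot2_inj; refine (etrans (@tot_bproj s t _ _ _) _).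
  have -> : tot2 (beps t \h (lid (one1 i) \h beps s)) = tot2 (e' \h e).
    by apply: tot2_h => //; exact: tot2_l.
  have -> : e' \h e = (e' \h lid _) \v (lid _ \h e).
    by rewrite (hcomp_interchange L) (cat_idl (llaws _)) (cat_idr (llaws _)).
  by rewrite -ee'; apply: tot2_v; [exact: tot2_r|exact: tot2_l].
move=> /(f_equal (@imval _ _ _ _)) h.
have : imval (lid (G \c F)) = 0.
  rewrite -h; change (imval (lid G) \h imval (lid F) = 0).
  by rewrite F0; exact: (linear_f0 (hcomp_linr (imval (lid G)))).
move=> /(f_equal (fun a => tot2 a)) {}h; have {h} := etrans (esym (@tot_bproj s s _ _ _)) h.
have -> : tot2 (e \h (lid (one1 i \c one1 i) \h e)) = tot2 e.
  rewrite -[RHS](beps_hh s); apply: tot2_h => //.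
  rewrite -hcomp_id -[RHS]tot2_l -[RHS]tot2_l tot2_A //.
have -> : tot2 (0 : lhom (one1 i \c one1 i) (one1 i \c one1 i)) = tot2 (0 : lhom (one1 i) (one1 i)).
  rewrite -[LHS](tot2_cast (comp1l L _) (comp1l L _)).
  by rewrite (linear_f0 (castH_linear (H := fun x y : hcat _ _ => lhom x y) _ _)).
by move=> /tot2_inj e0; have [] := pe.
Qed.

(* The 1-morphism G \c F from s to u in bar C stands for eps_u G F eps_s,       *)
(* whereas the composite of eps_u G eps_t and eps_t F eps_s is its summand     *)
(* cut out by the idempotent eps_u \h lid G \h eps_t \h lid F \h eps_s.         *)
(* Idempotent completion makes this summand available and turns bar C into a   *)
(* strict 2-category. When idempotents split in C, they also split in the      *)
(* categories bar_hcat s t (bar_idempotent_split), so that the completion only *)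
(* replaces these by equivalent categories, F corresponding to                 *)
(* (F, eps_t \h lid F \h eps_s).                                               *)
Definition overline : lin2Cat k := karoubi2 bar.
End Bar.

Section FinitaryCategories.
Variables (k : fieldType) (D : linCat k).

Definition is_iso (X Y : D) (f : lhom X Y) : Prop :=
  exists g : lhom Y X, g \v f = lid X /\ f \v g = lid Y.
Definition isomorphic (X Y : D) : Prop := exists f : lhom X Y, is_iso f.

Definition is_zero (X : D) : Prop := lid X = 0.

Definition is_biproduct (n : nat) (X : 'I_n -> D) (S : D) : Prop :=
  exists (inj : forall i, lhom (X i) S) (prj : forall i, lhom S (X i)),
    [/\ forall i, prj i \v inj i = lid (X i),
        forall i j, i != j -> prj i \v inj j = 0
      & \sum_i inj i \v prj i = lid S].

Definition is_additive : Prop :=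
  forall (n : nat) (X : 'I_n -> D), exists S, is_biproduct X S.

Definition idempotent_split : Prop :=
  forall (X : D) (e : lhom X X), e \v e = e ->
    exists (Y : D) (r : lhom X Y) (s : lhom Y X), r \v s = lid Y /\ s \v r = e.

Definition indecomposable (X : D) : Prop :=
  ~ is_zero X /\
  forall Y : 'I_2 -> D, is_biproduct Y X -> exists i, is_zero (Y i).

Definition local_endomorphism_ring (X : D) : Prop :=
  ~ is_zero X /\
  forall a b : lhom X X, ~ is_iso a -> ~ is_iso b -> ~ is_iso (a + b).

Definition krull_schmidt : Prop :=
  forall X : D, exists (n : nat) (Y : 'I_n -> D),
    is_biproduct Y X /\ forall i, local_endomorphism_ring (Y i).

Definition finitely_many_indecomposables : Prop :=
  exists (n : nat) (Y : 'I_n -> D),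
    forall X : D, indecomposable X -> exists i, isomorphic X (Y i).

Definition finite_dimensional_homs : Prop :=
  forall X Y : D, exists (n : nat) (b : 'I_n -> lhom X Y),
    forall a : lhom X Y, exists c : 'I_n -> k, a = \sum_i c i *: b i.

Definition finitary_category : Prop :=
  [/\ is_additive, idempotent_split, krull_schmidt,
      finitely_many_indecomposables & finite_dimensional_homs].
End FinitaryCategories.

Lemma bar_idempotent_split (k : fieldType) (C : lin2Cat k) (s t : bar_ob C) :
  idempotent_split (hcat (bob s) (bob t)) -> idempotent_split (bar_hcat s t).
Proof.
move=> sp X e ee; have [Y [r [q [rq qr]]]] := sp X (imval e) (f_equal (@imval _ _ _ _) ee).
pose r' : bar_hom X Y := in_im (@bproj_lin k C s t X Y) (ex_intro _ r erefl).
pose q' : bar_hom Y X := in_im (@bproj_lin k C s t Y X) (ex_intro _ q erefl).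
exists Y, r', q'; split; apply: imval_inj; rewrite /= bproj_comp ?rq ?qr //.
apply: tot2_inj; rewrite tot_bproj -[RHS](bprojl e).
exact: tot2_h erefl (bprojr e).
Qed.

Section Fiat.
Variables (k : fieldType) (C : lin2Cat k).
Notation L := (hlaws C).

Definition prefinitary : Prop :=
  (exists (n : nat) (f : 'I_n -> C), forall i, exists x, f x = i) /\
  forall i j : C, finitary_category (hcat i j).

Definition finitary : Prop :=
  prefinitary /\ forall i : C, indecomposable (one1 i).

Definition cast2 (i j : C) (F F' G G' : hcat i j) (eF : F = F') (eG : G = G')
    (a : lhom F G) : lhom F' G' :=
  castH (fun x y : hcat i j => lhom x y) eF eG a.

(* A k-linear pseudofunctor to the 2-category with reversed 1- and             *)
(* 2-morphisms, which is the identity on objects, together with an invertible  *)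
(* icon from the identity to its square.                                       *)
Record weak_anti_involution := WeakAntiInvolution {
  star : forall i j : C, hcat i j -> hcat j i;
  star2 : forall (i j : C) (F G : hcat i j), lhom F G -> lhom (star G) (star F);
  star2_linear : forall (i j : C) (F G : hcat i j), linear (@star2 i j F G);
  star2_id : forall (i j : C) (F : hcat i j), star2 (lid F) = lid (star F);
  star2_comp : forall (i j : C) (F G H : hcat i j) (b : lhom G H) (a : lhom F G),
    star2 (b \v a) = star2 a \v star2 b;
  star_mul : forall (i j l : C) (G : hcat j l) (F : hcat i j),
    lhom (star F \c star G) (star (G \c F));
  star_mul_iso : forall (i j l : C) (G : hcat j l) (F : hcat i j),
    is_iso (star_mul G F);
  star_mul_nat : forall (i j l : C) (G G' : hcat j l) (F F' : hcat i j)
    (b : lhom G G') (a : lhom F F'),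
    star2 (b \h a) \v star_mul G' F' = star_mul G F \v (star2 a \h star2 b);
  star_one : forall i : C, lhom (one1 i) (star (one1 i));
  star_one_iso : forall i : C, is_iso (star_one i);
  star_mulA : forall (i j l m : C) (H : hcat l m) (G : hcat j l) (F : hcat i j),
    cast2 erefl (f_equal (@star i m) (comp1A L H G F))
      (star_mul H (G \c F) \v (star_mul G F \h lid (star H))) =
    cast2 (comp1A L (star F) (star G) (star H)) erefl
      (star_mul (H \c G) F \v (lid (star F) \h star_mul H G));
  star_mul1l : forall (i j : C) (F : hcat i j),
    cast2 (comp1r L (star F)) (f_equal (@star i j) (comp1l L F))
      (star_mul (one1 j) F \v (lid (star F) \h star_one j)) = lid (star F);
  star_mul1r : forall (i j : C) (F : hcat i j),
    cast2 (comp1l L (star F)) (f_equal (@star i j) (comp1r L F))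
      (star_mul F (one1 i) \v (star_one i \h lid (star F))) = lid (star F);
  star_star : forall (i j : C) (F : hcat i j), lhom F (star (star F));
  star_star_iso : forall (i j : C) (F : hcat i j), is_iso (star_star F);
  star_star_nat : forall (i j : C) (F G : hcat i j) (a : lhom F G),
    star2 (star2 a) \v star_star F = star_star G \v a;
  star_star_mul : forall (i j l : C) (G : hcat j l) (F : hcat i j),
    star2 (star_mul G F) \v star_star (G \c F) =
    star_mul (star F) (star G) \v (star_star G \h star_star F);
  star_star_one : forall i : C,
    star2 (star_one i) \v star_star (one1 i) = star_one i }.

Definition adjunction (i j : C) (F : hcat i j) (G : hcat j i)
    (eta : lhom (one1 i) (G \c F)) (eps : lhom (F \c G) (one1 j)) : Prop :=
  cast2 erefl (comp1l L F) (eps \h lid F)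
    \v cast2 (comp1r L F) (comp1A L F G F) (lid F \h eta) = lid F /\
  cast2 (comp1A L G F G) (comp1r L G) (lid G \h eps)
    \v cast2 (comp1l L G) erefl (eta \h lid G) = lid G.

Definition fiat : Prop :=
  finitary /\ exists S : weak_anti_involution, forall (i j : C) (F : hcat i j),
    exists (eta : lhom (one1 i) (star S F \c F)) (eps : lhom (F \c star S F) (one1 j)),
      adjunction eta eps.
End Fiat.

Section OrderedMonoids.

Record ordMonoid := OrdMonoid {
  om :> finType;
  om_one : om;
  om_mul : om -> om -> om;
  om_le : rel om;
  om_mulA : associative om_mul;
  om_mul1l : left_id om_one om_mul;
  om_mul1r : right_id om_one om_mul;
  om_refl : reflexive om_le;
  om_anti : antisymmetric om_le;
  om_trans : transitive om_le;
  om_le_mull : forall x s t, om_le s t -> om_le (om_mul x s) (om_mul x t);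
  om_le_mulr : forall x s t, om_le s t -> om_le (om_mul s x) (om_mul t x) }.

Variable S : ordMonoid.

Definition ord_hom (s t : S) : finType := {_ : unit | om_le s t}.

Lemma ord_hom_eq (s t : S) (a b : ord_hom s t) : a = b.
Proof. by apply: val_inj; case: (val a); case: (val b). Qed.

Definition ord_id (s : S) : ord_hom s s := exist _ tt (om_refl s).
Definition ord_comp (s t u : S) (b : ord_hom t u) (a : ord_hom s t) : ord_hom s u :=
  exist _ tt (om_trans (valP a) (valP b)).
Lemma ord_laws : @category_laws S (fun s t => ord_hom s t) ord_id ord_comp.
Proof. by split=> *; exact: ord_hom_eq. Qed.
Definition ord_cat : finCat := @FinCat S ord_hom ord_id ord_comp ord_laws.

Fact ord_hcomp_subproof (t t' s s' : S) (b : ord_hom t t') (a : ord_hom s s') :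
  om_le (om_mul t s) (om_mul t' s').
Proof. exact: om_trans (om_le_mulr _ (valP b)) (om_le_mull _ (valP a)). Qed.
Definition ord_hcomp (t t' s s' : S) (b : ord_hom t t') (a : ord_hom s s') :
  ord_hom (om_mul t s) (om_mul t' s') := exist _ tt (ord_hcomp_subproof b a).

Lemma ord_hlaws : @hcomp_laws unit (fun _ _ => S) (fun _ _ s t => ord_hom s t)
  (fun _ _ s => ord_id s) (fun _ _ s t u b a => ord_comp b a)
  (fun _ => om_one S) (fun _ _ _ t s => om_mul t s)
  (fun _ _ _ t t' s s' b a => ord_hcomp b a).
Proof.
by exists (fun _ _ _ _ => @om_mulA S) (fun _ _ => @om_mul1l S) (fun _ _ => @om_mul1r S)
  => *; exact: ord_hom_eq.
Qed.

Definition ord_2cat : fin2Cat :=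
  @Fin2Cat unit (fun _ _ => ord_cat) (fun _ => om_one S) (fun _ _ _ t s => om_mul t s)
    (fun _ _ _ t t' s s' b a => ord_hcomp b a) ord_hlaws
    (fun _ _ _ t s => ord_hom_eq _ _).
End OrderedMonoids.

Definition natural_le (S : finType) (mul : S -> S -> S) (s t : S) : bool :=
  [exists e, (mul e e == e) && (s == mul e t)].

(* In a monoid faithfully represented by partial bijections and closed under   *)
(* inverses, the natural order is inclusion, hence an admissible partial order. *)
Section NaturalOrder.
Variables (S : finType) (one : S) (mul : S -> S -> S) (X : Type) (K : S -> X -> X -> Prop).
Hypothesis K_inj : forall s t, (forall x y, K s x y <-> K t x y) -> s = t.
Hypothesis K_one : forall x y, K one x y <-> x = y.
Hypothesis K_mul : forall t s x z, K (mul t s) x z <-> exists2 y, K s x y & K t y z.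
Hypothesis K_fun : forall s x y y', K s x y -> K s x y' -> y = y'.
Hypothesis K_cofun : forall s x x' y, K s x y -> K s x' y -> x = x'.
Hypothesis K_inv : forall s, exists s', forall x y, K s' x y <-> K s y x.

Lemma rep_mulA : associative mul.
Proof.
move=> u t s; apply: K_inj => x w; split.
- move=> /K_mul[z /K_mul[y h1 h2] h3]; apply/K_mul; exists y => //; apply/K_mul.
  by exists z.
- move=> /K_mul[y h1 /K_mul[z h2 h3]]; apply/K_mul; exists z => //; apply/K_mul.
  by exists y.
Qed.
Lemma rep_mul1l : left_id one mul.
Proof.
move=> s; apply: K_inj => x y; split; first by move=> /K_mul[z h /K_one <-].
by move=> h; apply/K_mul; exists y => //; apply/K_one.
Qed.
Lemma rep_mul1r : right_id one mul.
Proof.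
move=> s; apply: K_inj => x y; split; first by move=> /K_mul[z /K_one <-].
by move=> h; apply/K_mul; exists x => //; apply/K_one.
Qed.

Lemma rep_idem e x y : mul e e = e -> K e x y -> x = y.
Proof.
move=> ee h; have := h; rewrite -ee => /K_mul[z h1 h2].
by move: h2; rewrite -(K_fun h h1) => /(K_cofun h).
Qed.

Lemma natural_leP s t : reflect (forall x y, K s x y -> K t x y) (natural_le mul s t).
Proof.
apply: (iffP existsP) => [[e /andP[/eqP ee /eqP ->]] x y|st].
  by move=> /K_mul[z h1 h2]; rewrite -(rep_idem ee h2).
have [s' Ks'] := K_inv s; exists (mul s s').
have Ke x y : K (mul s s') x y <-> x = y /\ exists w, K s w y.
  split=> [/K_mul[w /Ks' h1 h2]|[-> [w h]]]; last by apply/K_mul; exists w => //; apply/Ks'.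
  by rewrite (K_fun h1 h2); split=> //; exists w.
apply/andP; split; apply/eqP; apply: K_inj => x y.
  split=> [/K_mul[z /Ke[<- _]]|h] //; apply/K_mul; exists y => //.
  by have [_ hw] := (Ke _ _).1 h; apply/Ke.
split=> [h|/K_mul[z h1 /Ke[e [w h2]]]].
  by apply/K_mul; exists y; [exact: st|apply/Ke; split=> //; exists x].
by move: h1; rewrite e => h1; have -> := K_cofun h1 (st _ _ h2).
Qed.

Lemma natural_le_refl : reflexive (natural_le mul).
Proof. by move=> s; apply/natural_leP. Qed.
Lemma natural_le_anti : antisymmetric (natural_le mul).
Proof. by move=> s t /andP[/natural_leP h1 /natural_leP h2]; apply: K_inj; split; auto. Qed.
Lemma natural_le_trans : transitive (natural_le mul).
Proof. by move=> t s u /natural_leP h1 /natural_leP h2; apply/natural_leP; auto. Qed.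
Lemma natural_le_mull x s t : natural_le mul s t -> natural_le mul (mul x s) (mul x t).
Proof.
move=> /natural_leP h; apply/natural_leP => u v /K_mul[w h1 h2].
by apply/K_mul; exists w; auto.
Qed.
Lemma natural_le_mulr x s t : natural_le mul s t -> natural_le mul (mul s x) (mul t x).
Proof.
move=> /natural_leP h; apply/natural_leP => u v /K_mul[w h1 h2].
by apply/K_mul; exists w; auto.
Qed.

Definition natural_ordMonoid : ordMonoid :=
  @OrdMonoid S one mul (natural_le mul) rep_mulA rep_mul1l rep_mul1r
    natural_le_refl natural_le_anti natural_le_trans natural_le_mull natural_le_mulr.
End NaturalOrder.

Section Relations.
Variable n : nat.

(* (z, x) \in a means that a relates x to z. *)
Definition brel := {set 'I_n * 'I_n}.
Definition rcomp (b a : brel) : brel :=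
  [set zx | [exists y, ((zx.1, y) \in b) && ((y, zx.2) \in a)]].
Definition graph (s : 'S_n) : brel := [set zx | zx.1 == s zx.2].

Lemma rcompP (b a : brel) z x :
  reflect (exists2 y, (z, y) \in b & (y, x) \in a) ((z, x) \in rcomp b a).
Proof.
by rewrite inE; apply: (iffP existsP) => [[y /andP[]]|[y h1 h2]]; exists y => //; apply/andP.
Qed.
Lemma graphE (s : 'S_n) z x : ((z, x) \in graph s) = (z == s x).
Proof. by rewrite inE. Qed.

(* Composition of functions, x |-> t (s x); the product of perm.v is reversed. *)
Definition scomp (t s : 'S_n) : 'S_n := (s * t)%g.

Lemma graph_comp (t s : 'S_n) : rcomp (graph t) (graph s) = graph (scomp t s).
Proof.
apply/setP => -[z x]; rewrite graphE permM; apply/rcompP/eqP => [[y]|->].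
  by rewrite !graphE => /eqP-> /eqP->.
by exists (s x); rewrite graphE.
Qed.
Lemma rcompS (b b' a a' : brel) : b \subset b' -> a \subset a' -> rcomp b a \subset rcomp b' a'.
Proof.
move=> /subsetP hb /subsetP ha; apply/subsetP => -[z x] /rcompP[y h1 h2].
by apply/rcompP; exists y; auto.
Qed.
Lemma rcompA (c b a : brel) : rcomp c (rcomp b a) = rcomp (rcomp c b) a.
Proof.
apply/setP => -[w x]; apply/rcompP/rcompP => [[z hc /rcompP[y hb ha]]|[y /rcompP[z hc hb] ha]].
  by exists y => //; apply/rcompP; exists z.
by exists z => //; apply/rcompP; exists y.
Qed.
Lemma rcomp1l (a : brel) : rcomp (graph 1%g) a = a.
Proof.
apply/setP => -[z x]; apply/rcompP/idP => [[y]|h].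
  by rewrite graphE perm1 => /eqP->.
by exists z => //; rewrite graphE perm1.
Qed.
Lemma rcomp1r (a : brel) : rcomp a (graph 1%g) = a.
Proof.
apply/setP => -[z x]; apply/rcompP/idP => [[y h]|h].
  by rewrite graphE perm1 => /eqP e; rewrite -e.
by exists x => //; rewrite graphE perm1.
Qed.

Definition homA (s t : 'S_n) : finType :=
  {a : brel | a \subset graph s :&: graph t}.

Fact A_id_subproof (s : 'S_n) : graph s \subset graph s :&: graph s.
Proof. by rewrite setIid. Qed.
Definition A_id s : homA s s := exist _ (graph s) (A_id_subproof s).
Fact A_comp_subproof (s t u : 'S_n) (b : homA t u) (a : homA s t) :
  val b :&: val a \subset graph s :&: graph u.
Proof.
have := valP a; have := valP b; rewrite !subsetI => /andP[_ h1] /andP[h2 _].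
by rewrite (subset_trans (subsetIr _ _) h2) (subset_trans (subsetIl _ _) h1).
Qed.
Definition A_comp (s t u : 'S_n) (b : homA t u) (a : homA s t) : homA s u :=
  exist _ (val b :&: val a) (A_comp_subproof b a).
Lemma A_laws : @category_laws 'S_n (fun s t => homA s t) A_id A_comp.
Proof.
split=> [s t u v c b a|s t a|s t a]; apply: val_inj => /=.
- by rewrite setIA.
- by apply/setIidPr; have := valP a; rewrite subsetI => /andP[].
- by apply/setIidPl; have := valP a; rewrite subsetI => /andP[].
Qed.
Definition A_cat : finCat := @FinCat 'S_n homA A_id A_comp A_laws.

Fact A_hcomp_subproof (t t' s s' : 'S_n) (b : homA t t') (a : homA s s') :
  rcomp (val b) (val a) \subset graph (scomp t s) :&: graph (scomp t' s').
Proof.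
have := valP a; have := valP b; rewrite !subsetI => /andP[h1 h2] /andP[h3 h4].
by rewrite -!graph_comp !rcompS.
Qed.
Definition A_hcomp (t t' s s' : 'S_n) (b : homA t t') (a : homA s s') :
  homA (scomp t s) (scomp t' s') :=
  exist _ (rcomp (val b) (val a)) (A_hcomp_subproof b a).

Lemma scompA (u t s : 'S_n) : scomp u (scomp t s) = scomp (scomp u t) s.
Proof. by rewrite /scomp mulgA. Qed.
Lemma scomp1l (s : 'S_n) : scomp 1%g s = s. Proof. exact: mulg1. Qed.
Lemma scomp1r (s : 'S_n) : scomp s 1%g = s. Proof. exact: mul1g. Qed.

Let val_cast (s s' t t' : 'S_n) (es : s = s') (et : t = t') (a : homA s t) :
  val (castH (fun x y => homA x y) es et a) = val a.
Proof. by destruct es, et. Qed.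

Lemma A_hlaws : @hcomp_laws unit (fun _ _ => 'S_n) (fun _ _ s t => homA s t)
  (fun _ _ s => A_id s) (fun _ _ s t u b a => A_comp b a)
  (fun _ => 1%g) (fun _ _ _ t s => scomp t s)
  (fun _ _ _ t t' s s' b a => A_hcomp b a).
Proof.
exists (fun _ _ _ _ => scompA) (fun _ _ => scomp1l) (fun _ _ => scomp1r).
- move=> _ _ _ t t' t'' s s' s'' b' b a' a; apply: val_inj; apply/setP => -[z x] /=.
  have := valP a; have := valP a'; rewrite !subsetI.
  move=> /andP[/subsetP h1 _] /andP[_ /subsetP h2].
  apply/setIP/rcompP => [[/rcompP[y hb' ha'] /rcompP[w hb ha]]|[y /setIP[hb' hb] /setIP[ha' ha]]].
    have e : y = w by move: (h1 _ ha') (h2 _ ha); rewrite !graphE => /eqP-> /eqP->.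
    by exists y; apply/setIP; split=> //; rewrite e.
  by split; apply/rcompP; exists y.
- by move=> *; apply: val_inj; rewrite val_cast /= rcompA.
- by move=> *; apply: val_inj; rewrite val_cast /= rcomp1l.
- by move=> *; apply: val_inj; rewrite val_cast /= rcomp1r.
Qed.

Lemma A_hcomp_id (t s : 'S_n) : A_hcomp (A_id t) (A_id s) = A_id (scomp t s).
Proof. by apply: val_inj; exact: graph_comp. Qed.

Definition A_2cat : fin2Cat :=
  @Fin2Cat unit (fun _ _ => A_cat) (fun _ => 1%g) (fun _ _ _ t s => scomp t s)
    (fun _ _ _ t t' s s' b a => A_hcomp b a) A_hlaws
    (fun _ _ _ t s => A_hcomp_id t s).

(* Bijections between subsets of 'I_n, given by their graphs. *)
Definition partial_bijection (a : brel) : bool :=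
  [forall p in a, forall q in a, (p.1 == q.1) == (p.2 == q.2)].
Definition IS : finType := {a : brel | partial_bijection a}.

Lemma pbijP (a : brel) : reflect
  (forall z x z' x', (z, x) \in a -> (z', x') \in a -> (z = z' <-> x = x'))
  (partial_bijection a).
Proof.
apply: (iffP idP) => [/'forall_in_'forall_in_eqP h z x z' x' hp hq|h].
  by have /= e := h _ hp _ hq; split => /eqP; [rewrite e|rewrite -e] => /eqP.
apply/'forall_in_'forall_in_eqP => -[z x] hp [z' x'] hq /=.
by have e := h _ _ _ _ hp hq; apply/eqP/eqP => /e.
Qed.

Fact IS_one_subproof : partial_bijection (graph 1%g).
Proof. by apply/pbijP => z x z' x'; rewrite !graphE !perm1 => /eqP-> /eqP->. Qed.
Definition IS_one : IS := exist _ (graph 1%g) IS_one_subproof.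
Fact IS_mul_subproof (t s : IS) : partial_bijection (rcomp (val t) (val s)).
Proof.
apply/pbijP => z x z' x' /rcompP[y h1 h2] /rcompP[y' h1' h2'].
have /pbijP ht := valP t; have /pbijP hs := valP s.
exact: iff_trans (ht _ _ _ _ h1 h1') (hs _ _ _ _ h2 h2').
Qed.
Definition IS_mul (t s : IS) : IS := exist _ (rcomp (val t) (val s)) (IS_mul_subproof t s).

Let KIS (s : IS) (x y : 'I_n) : Prop := (y, x) \in val s.

Lemma KIS_inj s t : (forall x y, KIS s x y <-> KIS t x y) -> s = t.
Proof. by move=> h; apply: val_inj; apply/setP => -[y x]; apply/idP/idP => /h. Qed.
Lemma KIS_one x y : KIS IS_one x y <-> x = y.
Proof. by rewrite /KIS graphE perm1; split=> [/eqP->|->]. Qed.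
Lemma KIS_mul t s x z : KIS (IS_mul t s) x z <-> exists2 y, KIS s x y & KIS t y z.
Proof. by split=> [/rcompP[y]|[y h1 h2]]; [exists y|apply/rcompP; exists y]. Qed.
Lemma KIS_fun s x y y' : KIS s x y -> KIS s x y' -> y = y'.
Proof. by move=> h1 h2; have /pbijP h := valP s; apply/(h _ _ _ _ h1 h2). Qed.
Lemma KIS_cofun s x x' y : KIS s x y -> KIS s x' y -> x = x'.
Proof. by move=> h1 h2; have /pbijP h := valP s; apply/(h _ _ _ _ h1 h2). Qed.
Lemma KIS_inv s : exists s', forall x y, KIS s' x y <-> KIS s y x.
Proof.
have h : partial_bijection [set zx | (zx.2, zx.1) \in val s].
  apply/pbijP => z x z' x'; rewrite !inE /= => h1 h2; have /pbijP h := valP s.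
  exact: iff_sym (h _ _ _ _ h1 h2).
by exists (exist (fun a : brel => partial_bijection a) _ h) => x y; rewrite /KIS inE.
Qed.

Definition IS_ordMonoid : ordMonoid :=
  natural_ordMonoid KIS_inj KIS_one KIS_mul KIS_fun KIS_cofun KIS_inv.
End Relations.

Section Partitions.
Variable T : finType.
Implicit Types (S P Q : {set {set T}}) (u v w : T).

Definition same_part S : rel T := fun u v => [exists B in S, (u \in B) && (v \in B)].

(* The finest partition of T such that each member of S is contained in a part. *)
Definition finest S : {set {set T}} := equivalence_partition (connect (same_part S)) setT.
Definition refines P Q : bool := [forall B in P, [exists A in Q, B \subset A]].
Definition pjoin P Q : {set {set T}} := finest (P :|: Q).

Lemma same_partP S u v : reflect (exists B, [/\ B \in S, u \in B & v \in B]) (same_part S u v).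
Proof.
apply: (iffP exists_inP) => [[B hB /andP[]]|[B [hB hu hv]]]; exists B => //.
by rewrite hu hv.
Qed.
Lemma same_part_sym S : symmetric (same_part S).
Proof. by move=> u v; apply/same_partP/same_partP => -[B []]; exists B. Qed.

Lemma connect_same_equiv S : {in setT & &, equivalence_rel (connect (same_part S))}.
Proof.
have /equivalence_relP[h1 h2] : equivalence_rel (connect (same_part S)).
  apply/equivalence_relP; split=> [u|u v huv]; first exact: connect0.
  exact: same_connect (sym_connect_sym (@same_part_sym S)) _ _ huv.
by move=> u v w _ _ _; split=> // huv; rewrite (h2 _ _ huv).
Qed.

Lemma finest_partition S : partition (finest S) setT.
Proof. exact/equivalence_partitionP/connect_same_equiv. Qed.

Section OnePart.
Variable P : {set {set T}}.
Hypothesis hP : partition P setT.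
Let coverP u : u \in cover P. Proof. by have /andP[/eqP-> _] := hP; rewrite inE. Qed.
Let trivP : trivIset P. Proof. by have /and3P[] := hP. Qed.

Lemma same_partE u v : same_part P u v = (v \in pblock P u).
Proof.
apply/same_partP/idP => [[B [hB hu hv]]|h]; first by rewrite (def_pblock trivP hB hu).
by exists (pblock P u); rewrite h mem_pblock coverP pblock_mem ?coverP.
Qed.
Lemma same_part_refl u : same_part P u u.
Proof. by rewrite same_partE mem_pblock. Qed.
Lemma same_part_trans u v w : same_part P u v -> same_part P v w -> same_part P u w.
Proof.
rewrite !same_partE => h; have -> // : pblock P v = pblock P u.
by rewrite (def_pblock trivP _ h) // pblock_mem.
Qed.
Lemma same_part_id : equivalence_partition (same_part P) setT = P.
Proof.
rewrite -[RHS](equivalence_partition_pblock hP); congr equivalence_partition.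
by apply: funext => u; apply: funext => v; exact: same_partE.
Qed.
End OnePart.

Lemma same_finest S u v : same_part (finest S) u v = connect (same_part S) u v.
Proof.
rewrite (same_partE (finest_partition S)).
by rewrite (pblock_equivalence_partition (@connect_same_equiv S)) ?inE.
Qed.

Lemma partition_inj P Q : partition P setT -> partition Q setT ->
  (forall u v, same_part P u v = same_part Q u v) -> P = Q.
Proof.
move=> hP hQ e; rewrite -(same_part_id hP) -(same_part_id hQ).
by congr equivalence_partition; apply: funext => u; apply: funext => v; exact: e.
Qed.

Lemma refinesP P Q : partition P setT -> partition Q setT ->
  reflect (forall u v, same_part P u v -> same_part Q u v) (refines P Q).
Proof.
move=> hP hQ; apply: (iffP forall_inP) => [h u v /same_partP[B [hB hu hv]]|h B hB].
  have /exists_inP[A hA /subsetP s] := h _ hB.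
  by apply/same_partP; exists A; rewrite hA !s.
have [u hu] : exists u, u \in B.
  by apply/set0Pn; apply: contraTneq hB => ->; have /and3P[] := hP.
apply/exists_inP; exists (pblock Q u).
  by rewrite pblock_mem //; have /andP[/eqP-> _] := hQ; rewrite inE.
apply/subsetP => v hv; rewrite -(same_partE hQ); apply: h.
by apply/same_partP; exists B.
Qed.

Lemma connect_inv (e : rel T) (X : Type) (f : T -> X) :
  (forall u v, e u v -> f u = f v) -> forall u v, connect e u v -> f u = f v.
Proof.
move=> h u v /connectP[p]; elim: p u => [|x p IH] u /=; first by move=> _ ->.
by move=> /andP[/h -> /IH]; apply.
Qed.
End Partitions.

Section PartitionMonoid.
Variable n : nat.

(* inl x stands for x, and inr x for x'. *)
Notation I2 := ('I_n + 'I_n)%type.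
Notation I3 := ('I_n + 'I_n + 'I_n)%type.
Notation sets := {set {set I2}}.
Implicit Types (P Q R : sets) (s t : 'S_n).

(* In I3 the vertices x, x', x'' are inl (inl x), inl (inr x) and inr x.      *)
Definition layer01 (z : I2) : I3 := inl z.
Definition layer12 (z : I2) : I3 :=
  match z with inl x => inl (inr x) | inr x => inr x end.
Definition layer02 (z : I2) : I3 :=
  match z with inl x => inl (inl x) | inr x => inr x end.

Definition pmul_gen R P : {set {set I3}} :=
  [set layer01 @: A | A : {set I2} in P] :|: [set layer12 @: A | A : {set I2} in R].

Definition pmul R P : sets :=
  [set layer02 @^-1: B | B : {set I3} in finest (pmul_gen R P)] :\ set0.

(* I_n^* is identified with the monoid of partitions satisfying isPP below. *)
Definition propagating P : bool :=
  [forall B in P, [exists x, inl x \in B] && [exists x, inr x \in B]].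

Definition pperm s : sets := [set [set inl x; inr (s x)] | x : 'I_n].

Definition isPP P : bool := partition P setT && propagating P.

(* Labellings by booleans which are constant on the parts of a partition.     *)
Definition lab (f g : {ffun 'I_n -> bool}) (z : I2) : bool :=
  match z with inl x => f x | inr x => g x end.
Definition const P (f g : {ffun 'I_n -> bool}) : Prop :=
  forall z w, same_part P z w -> lab f g z = lab f g w.

Lemma constP P z w : partition P setT ->
  same_part P z w <-> (forall f g, const P f g -> lab f g z = lab f g w).
Proof.
move=> hP; split=> [h f g|h]; first exact.
pose f := [ffun x => same_part P z (inl x)]; pose g := [ffun x => same_part P z (inr x)].
have e u : lab f g u = same_part P z u by case: u => x; rewrite /= ffunE.
have : const P f g.
  move=> u v huv; rewrite !e; apply/idP/idP => h'; apply: (same_part_trans hP h') => //.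
  by rewrite same_part_sym.
by move=> /h; rewrite !e (same_part_refl hP) => <-.
Qed.

Lemma const_inj P Q : partition P setT -> partition Q setT ->
  (forall f g, const P f g <-> const Q f g) -> P = Q.
Proof.
move=> hP hQ h; apply: partition_inj => // z w; apply/idP/idP => /constP k.
  by apply/(constP _ _ hQ) => f g /h; exact: k.
by apply/(constP _ _ hP) => f g /h; exact: k.
Qed.

Lemma refines_const P Q : partition P setT -> partition Q setT ->
  reflect (forall f g, const Q f g -> const P f g) (refines P Q).
Proof.
move=> hP hQ; apply: (iffP (refinesP hP hQ)) => h.
  by move=> f g hQc z w /h; exact: hQc.
by move=> z w /(constP _ _ hP) k; apply/(constP _ _ hQ) => f g /h; exact: k.
Qed.

Lemma pjoin_partition P Q : partition (pjoin P Q) setT.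
Proof. exact: finest_partition. Qed.

Lemma same_pjoin P Q z w : same_part P z w || same_part Q z w -> same_part (pjoin P Q) z w.
Proof.
move=> h; rewrite same_finest connect1 //; apply/same_partP.
by case/orP: h => /same_partP[B [h1 h2 h3]]; exists B; rewrite inE h1 ?orbT.
Qed.

Lemma const_join P Q f g : const (pjoin P Q) f g <-> const P f g /\ const Q f g.
Proof.
split=> [h|[h1 h2]]; first by split=> z w k; apply: h; apply: same_pjoin; rewrite k ?orbT.
move=> z w; rewrite same_finest; apply: connect_inv => u v /same_partP[B [hB hu hv]].
by move: hB; rewrite inE => /orP[hB|hB]; [apply: h1|apply: h2]; apply/same_partP; exists B.
Qed.

Lemma pmul_partition R P : partition (pmul R P) setT.
Proof.
have hF := finest_partition (pmul_gen R P).
have /and3P[/eqP hc /trivIsetP ht _] := hF.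
apply/and3P; split; last by rewrite !inE eqxx.
- apply/eqP/setP => z; rewrite inE; apply/bigcupP.
  have hz : layer02 z \in cover (finest (pmul_gen R P)) by rewrite hc inE.
  exists (layer02 @^-1: pblock (finest (pmul_gen R P)) (layer02 z)); last first.
    by rewrite inE mem_pblock.
  rewrite !inE; apply/andP; split.
    by apply/set0Pn; exists z; rewrite inE mem_pblock.
  by apply: imset_f; rewrite pblock_mem.
- apply/trivIsetP => _ _ /setD1P[_ /imsetP[A hA ->]] /setD1P[_ /imsetP[B hB ->]] ne.
  have /ht : A != B by apply: contraNneq ne => ->.
  move=> /(_ hA hB); rewrite -!setI_eq0 => /eqP e.
  by rewrite -preimsetI e preimset0.
Qed.

Lemma same_pmul R P z w :
  same_part (pmul R P) z w = connect (same_part (pmul_gen R P)) (layer02 z) (layer02 w).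
Proof.
rewrite -same_finest; apply/same_partP/same_partP.
  by move=> [_ [/setD1P[_ /imsetP[B hB ->]]]]; rewrite !inE => h1 h2; exists B.
move=> [B [hB h1 h2]]; exists (layer02 @^-1: B); rewrite !inE h1 h2; split=> //.
apply/andP; split; first by apply/set0Pn; exists z; rewrite inE.
exact: imset_f.
Qed.

Lemma same_gen R P u v : same_part (pmul_gen R P) u v ->
  (exists z w, [/\ same_part P z w, u = layer01 z & v = layer01 w]) \/
  (exists z w, [/\ same_part R z w, u = layer12 z & v = layer12 w]).
Proof.
move=> /same_partP[B []]; rewrite inE => /orP[] /imsetP[A hA ->] /imsetP[z hz ->] /imsetP[w hw ->].
  by left; exists z, w; split=> //; apply/same_partP; exists A.
by right; exists z, w; split=> //; apply/same_partP; exists A.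
Qed.
Lemma gen01 R P z w : same_part P z w ->
  connect (same_part (pmul_gen R P)) (layer01 z) (layer01 w).
Proof.
move=> /same_partP[A [hA hz hw]]; apply: connect1; apply/same_partP.
by exists (layer01 @: A); rewrite inE !imset_f.
Qed.
Lemma gen12 R P z w : same_part R z w ->
  connect (same_part (pmul_gen R P)) (layer12 z) (layer12 w).
Proof.
move=> /same_partP[A [hA hz hw]]; apply: connect1; apply/same_partP.
by exists (layer12 @: A); rewrite inE !imset_f ?orbT.
Qed.

Lemma propagatingP P : partition P setT ->
  reflect ((forall x, exists y, same_part P (inl x) (inr y)) /\
           (forall y, exists x, same_part P (inl x) (inr y))) (propagating P).
Proof.
move=> hP; have hc z : z \in cover P by have /andP[/eqP-> _] := hP; rewrite inE.
apply: (iffP forall_inP) => [h|[h1 h2] B hB].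
  split=> x.
    have /andP[_ /existsP[y hy]] := h _ (pblock_mem (hc (inl x))).
    by exists y; rewrite (same_partE hP).
  have /andP[/existsP[y hy] _] := h _ (pblock_mem (hc (inr x))).
  by exists y; rewrite same_part_sym (same_partE hP).
have [u hu] : exists u, u \in B.
  by apply/set0Pn; apply: contraTneq hB => ->; have /and3P[] := hP.
have tP : trivIset P by have /and3P[] := hP.
have eB : pblock P u = B by exact: def_pblock.
case: u hu eB => x hu eB.
  have [y] := h1 x; rewrite (same_partE hP) eB => hy.
  by apply/andP; split; apply/existsP; [exists x|exists y].
have [y] := h2 x; rewrite same_part_sym (same_partE hP) eB => hy.
by apply/andP; split; apply/existsP; [exists y|exists x].
Qed.

Lemma const_mul R P f h : isPP P ->
  const (pmul R P) f h <-> exists2 g, const P f g & const R g h.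
Proof.
move=> /andP[hP /(propagatingP hP)[hl hr]]; split=> [hc|[g h1 h2]]; last first.
  pose F (u : I3) := match u with inl z => lab f g z | inr x => h x end.
  have e02 z : F (layer02 z) = lab f h z by case: z.
  have e12 z : F (layer12 z) = lab g h z by case: z.
  move=> z w; rewrite same_pmul -!e02; apply: connect_inv => u v /same_gen[].
    by move=> [{}z [{}w [k -> ->]]]; exact: h1.
  by move=> [{}z [{}w [k -> ->]]]; rewrite !e12; exact: h2.
have key x x' : connect (same_part (pmul_gen R P)) (inl (inl x)) (inl (inl x')) -> f x = f x'.
  by move=> k; apply: (hc (inl x) (inl x')); rewrite same_pmul.
have key2 x x' : connect (same_part (pmul_gen R P)) (inl (inl x)) (inr x') -> f x = h x'.
  by move=> k; apply: (hc (inl x) (inr x')); rewrite same_pmul.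
have key3 x x' : connect (same_part (pmul_gen R P)) (inr x) (inr x') -> h x = h x'.
  by move=> k; apply: (hc (inr x) (inr x')); rewrite same_pmul.
pose g := [ffun y => [exists x, same_part P (inl x) (inr y) && f x]].
have gE x y : same_part P (inl x) (inr y) -> g y = f x.
  move=> hxy; rewrite ffunE; apply/existsP/idP => [[x' /andP[hx' fx']]|fx]; last first.
    by exists x; rewrite hxy.
  rewrite -(key x' x) //; apply: (@gen01 R P (inl x') (inl x)).
  by apply: (same_part_trans hP hx'); rewrite same_part_sym.
have sy := sym_connect_sym (@same_part_sym _ (pmul_gen R P)).
have pt y : exists x, g y = f x /\ connect (same_part (pmul_gen R P)) (inl (inl x)) (inl (inr y)).
  have [x hx] := hr y; exists x; rewrite (gE _ _ hx); split=> //.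
  exact: (@gen01 R P (inl x) (inr y)).
exists g.
  move=> [x|y] [x'|y'] k /=; have := gen01 R k.
  - exact: key.
  - by move=> _; rewrite (gE _ _ k).
  - by move=> _; apply: gE; rewrite same_part_sym.
  - have [x [-> c]] := pt y; have [x' [-> c']] := pt y' => kk.
    apply: key; apply: (connect_trans c); apply: (connect_trans kk).
    by rewrite sy.
move=> [y|z] [y'|z'] k /=; have := gen12 P k => /= kk.
- have [x [-> c]] := pt y; have [x' [-> c']] := pt y'.
  by apply: key; apply: (connect_trans c); apply: (connect_trans kk); rewrite sy.
- by have [x [-> c]] := pt y; apply: key2; exact: connect_trans kk.
- by have [x [-> c]] := pt y'; apply/esym/key2; apply: (connect_trans c); rewrite sy.
- exact: key3.
Qed.

Lemma isPP_partition P : isPP P -> partition P setT. Proof. by case/andP. Qed.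

Lemma isPP_mul R P : isPP R -> isPP P -> isPP (pmul R P).
Proof.
move=> /andP[hR /(propagatingP hR)[hl hr]] hPP.
have /andP[hP /(propagatingP hP)[hl' hr']] := hPP.
rewrite /isPP pmul_partition /=; apply/(propagatingP (pmul_partition _ _)).
have st x y z : same_part P (inl x) (inr y) -> same_part R (inl y) (inr z) ->
    same_part (pmul R P) (inl x) (inr z).
  by move=> /(gen01 R) k /(gen12 P) k'; rewrite same_pmul; exact: connect_trans k k'.
split=> [x|z].
  by have [y hy] := hl' x; have [z hz] := hl y; exists z; exact: st hy hz.
by have [y hy] := hr z; have [x hx] := hr' y; exists x; exact: st hx hy.
Qed.

Lemma isPP_join P Q : isPP P -> isPP (pjoin P Q).
Proof.
move=> /andP[hP /(propagatingP hP)[hl hr]].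
rewrite /isPP pjoin_partition /=; apply/(propagatingP (pjoin_partition _ _)).
split=> [x|y].
  by have [y hy] := hl x; exists y; apply: same_pjoin; rewrite hy.
by have [x hx] := hr y; exists x; apply: same_pjoin; rewrite hx.
Qed.

Lemma pperm_in s x : [set inl x; inr (s x)] \in pperm s.
Proof. exact: imset_f. Qed.
Lemma pperm_partition s : partition (pperm s) setT.
Proof.
apply/and3P; split.
- apply/eqP/setP => z; rewrite inE; apply/bigcupP.
  case: z => x; first by exists [set inl x; inr (s x)]; rewrite ?pperm_in // !inE eqxx.
  exists [set inl (s^-1%g x); inr (s (s^-1%g x))]; first exact: pperm_in.
  by rewrite permKV !inE eqxx orbT.
- apply/trivIsetP => _ _ /imsetP[x _ ->] /imsetP[y _ ->] ne.
  have {}ne : x != y by apply: contraNneq ne => ->.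
  rewrite -setI_eq0; apply/eqP/setP => -[z|z]; rewrite !inE /=.
    by apply/negP => /andP[/orP[/eqP[->]|//] /orP[/eqP[e]|//]]; rewrite e eqxx in ne.
  apply/negP => /andP[/eqP[->] /eqP[/perm_inj e]]; by rewrite e eqxx in ne.
- apply/negP => /imsetP[x _ e].
  by have := set11 (inl x : I2); have := in_set0 (inl x : I2); rewrite e !inE eqxx.
Qed.
Lemma same_pperm s x : same_part (pperm s) (inl x) (inr (s x)).
Proof.
by apply/same_partP; exists [set inl x; inr (s x)]; rewrite pperm_in !inE !eqxx ?orbT.
Qed.
Lemma pperm_isPP s : isPP (pperm s).
Proof.
rewrite /isPP pperm_partition; apply/(propagatingP (pperm_partition s)); split=> x.
  by exists (s x); exact: same_pperm.
by exists (s^-1%g x); rewrite -{2}(permKV s x); exact: same_pperm.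
Qed.
Lemma const_perm s f g : const (pperm s) f g <-> (forall x, f x = g (s x)).
Proof.
split=> [h x|h z w /same_partP[_ [/imsetP[x _ ->]]]]; first exact: h (same_pperm s x).
by rewrite !inE => /orP[] /eqP-> /orP[] /eqP-> /=.
Qed.

Lemma pmul_perm t s : pmul (pperm t) (pperm s) = pperm (scomp t s).
Proof.
apply: const_inj; [exact: pmul_partition|exact: pperm_partition|] => f h.
split=> [/(const_mul _ _ _ (pperm_isPP s))[g /const_perm h1 /const_perm h2]|/const_perm h1].
  by apply/const_perm => x; rewrite h1 h2 permM.
apply/(const_mul _ _ _ (pperm_isPP s)); exists [ffun x => h (t x)].
  by apply/const_perm => x; rewrite h1 ffunE permM.
by apply/const_perm => x; rewrite ffunE.
Qed.

(* Bijections between quotients act as partial bijections on labellings.      *)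
Lemma const_fun P f g g' : isPP P -> const P f g -> const P f g' -> g = g'.
Proof.
move=> /andP[hP /(propagatingP hP)[_ hr]] h1 h2; apply/ffunP => y.
by have [x hx] := hr y; have /= <- := h1 _ _ hx; have /= <- := h2 _ _ hx.
Qed.
Lemma const_cofun P f f' g : isPP P -> const P f g -> const P f' g -> f = f'.
Proof.
move=> /andP[hP /(propagatingP hP)[hl _]] h1 h2; apply/ffunP => x.
by have [y hy] := hl x; have /= -> := h1 _ _ hy; have /= -> := h2 _ _ hy.
Qed.

Lemma pmulA P Q R : isPP P -> isPP Q -> isPP R -> pmul R (pmul Q P) = pmul (pmul R Q) P.
Proof.
move=> hP hQ hR; have hQP := isPP_mul hQ hP.
apply: const_inj; [exact: pmul_partition|exact: pmul_partition|] => f h.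
rewrite !const_mul //; split=> [[v /const_mul[]// u h1 h2 h3]|[u h1 /const_mul[]// v h2 h3]].
  by exists u => //; apply/const_mul => //; exists v.
by exists v => //; apply/const_mul => //; exists u.
Qed.
Lemma const_one f g : const (pperm 1%g) f g <-> f = g.
Proof.
split=> [/const_perm h|->]; first by apply/ffunP => x; rewrite h perm1.
by apply/const_perm => x; rewrite perm1.
Qed.
Lemma pmul1l P : isPP P -> pmul (pperm 1%g) P = P.
Proof.
move=> hP; apply: const_inj; [exact: pmul_partition|exact: isPP_partition|] => f h.
rewrite const_mul //; split=> [[g h1 /const_one <-]//|h1].
by exists h => //; apply/const_one.
Qed.
Lemma pmul1r P : isPP P -> pmul P (pperm 1%g) = P.
Proof.
move=> hP; apply: const_inj; [exact: pmul_partition|exact: isPP_partition|] => f h.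
rewrite const_mul ?pperm_isPP //; split=> [[g /const_one -> //]|h1].
by exists f => //; apply/const_one.
Qed.

Lemma refines_mul P P' R R' : isPP P -> isPP P' -> refines P P' -> isPP R -> isPP R' ->
  refines R R' -> refines (pmul R P) (pmul R' P').
Proof.
move=> hP hP' /(refines_const (isPP_partition hP) (isPP_partition hP')) h1.
move=> hR hR' /(refines_const (isPP_partition hR) (isPP_partition hR')) h2.
apply/refines_const; [exact: pmul_partition|exact: pmul_partition|] => f h.
by rewrite !const_mul // => -[g k1 k2]; exists g; auto.
Qed.

Definition homB s t : finType :=
  {P : sets | [&& isPP P, refines (pperm s) P & refines (pperm t) P]}.

Lemma homBP s t (a : homB s t) :
  [/\ isPP (val a), forall f g, const (val a) f g -> const (pperm s) f g
    & forall f g, const (val a) f g -> const (pperm t) f g].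
Proof.
have /and3P[h1] := valP a.
by move=> /(refines_const (pperm_partition s) (isPP_partition h1)) h2
          /(refines_const (pperm_partition t) (isPP_partition h1)) h3.
Qed.

Fact B_id_subproof s : [&& isPP (pperm s), refines (pperm s) (pperm s) & refines (pperm s) (pperm s)].
Proof.
by rewrite pperm_isPP andbb; apply/refines_const => //; exact: pperm_partition.
Qed.
Definition B_id s : homB s s := exist _ (pperm s) (B_id_subproof s).

Fact B_comp_subproof s t u (b : homB t u) (a : homB s t) :
  [&& isPP (pjoin (val b) (val a)), refines (pperm s) (pjoin (val b) (val a))
    & refines (pperm u) (pjoin (val b) (val a))].
Proof.
have [b1 b2 b3] := homBP b; have [a1 a2 a3] := homBP a; rewrite isPP_join //=.
apply/andP; split; apply/(refines_const (pperm_partition _) (pjoin_partition _ _)) => f g;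
  by move=> /const_join[]; auto.
Qed.
Definition B_comp s t u (b : homB t u) (a : homB s t) : homB s u :=
  exist _ (pjoin (val b) (val a)) (B_comp_subproof b a).

Lemma B_laws : @category_laws 'S_n (fun s t => homB s t) B_id B_comp.
Proof.
split=> [s t u v c b a|s t a|s t a]; apply: val_inj => /=.
- apply: const_inj; [exact: pjoin_partition|exact: pjoin_partition|] => f g.
  by rewrite !const_join; tauto.
- have [h1 h2 h3] := homBP a.
  apply: const_inj; [exact: pjoin_partition|exact: isPP_partition|] => f g.
  by rewrite !const_join; split=> [[]|h] //; split=> //; exact: h3.
- have [h1 h2 h3] := homBP a.
  apply: const_inj; [exact: pjoin_partition|exact: isPP_partition|] => f g.
  by rewrite !const_join; split=> [[]|h] //; split=> //; exact: h2.
Qed.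
Definition B_cat : finCat := @FinCat 'S_n homB B_id B_comp B_laws.

Fact B_hcomp_subproof t t' s s' (b : homB t t') (a : homB s s') :
  [&& isPP (pmul (val b) (val a)), refines (pperm (scomp t s)) (pmul (val b) (val a))
    & refines (pperm (scomp t' s')) (pmul (val b) (val a))].
Proof.
have /and3P[b1 b2 b3] := valP b; have /and3P[a1 a2 a3] := valP a.
by rewrite isPP_mul // -!pmul_perm !refines_mul // pperm_isPP.
Qed.
Definition B_hcomp t t' s s' (b : homB t t') (a : homB s s') :
  homB (scomp t s) (scomp t' s') :=
  exist _ (pmul (val b) (val a)) (B_hcomp_subproof b a).

Let val_cast (s s' t t' : 'S_n) (es : s = s') (et : t = t') (a : homB s t) :
  val (castH (fun x y => homB x y) es et a) = val a.
Proof. by destruct es, et. Qed.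

Lemma B_hlaws : @hcomp_laws unit (fun _ _ => 'S_n) (fun _ _ s t => homB s t)
  (fun _ _ s => B_id s) (fun _ _ s t u b a => B_comp b a)
  (fun _ => 1%g) (fun _ _ _ t s => scomp t s)
  (fun _ _ _ t t' s s' b a => B_hcomp b a).
Proof.
exists (fun _ _ _ _ => @scompA n) (fun _ _ => @scomp1l n) (fun _ _ => @scomp1r n).
- move=> _ _ _ t t' t'' s s' s'' b' b a' a; apply: val_inj => /=.
  have [b1 b2 b3] := homBP b; have [a1 a2 a3] := homBP a.
  have [b1' b2' b3'] := homBP b'; have [a1' a2' a3'] := homBP a'.
  apply: const_inj; [exact: pjoin_partition|exact: pmul_partition|] => f h.
  rewrite const_join !const_mul ?isPP_join //; split.
    move=> [[g k1 k2] [g' k1' k2']].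
    have e := const_fun (pperm_isPP s') (a2' _ _ k1) (a3 _ _ k1').
    by exists g; apply/const_join; split=> //; rewrite e.
  by move=> [g /const_join[k1 k2] /const_join[k3 k4]]; split; exists g.
- move=> i j l m u u' t t' s s' c b a; apply: val_inj; rewrite val_cast /= pmulA //.
  + by case: (homBP a).
  + by case: (homBP b).
  + by case: (homBP c).
- by move=> i j s s' a; apply: val_inj; rewrite val_cast /= pmul1l //; case: (homBP a).
- by move=> i j s s' a; apply: val_inj; rewrite val_cast /= pmul1r //; case: (homBP a).
Qed.

Lemma B_hcomp_id t s : B_hcomp (B_id t) (B_id s) = B_id (scomp t s).
Proof. by apply: val_inj; exact: pmul_perm. Qed.

Definition B_2cat : fin2Cat :=
  @Fin2Cat unit (fun _ _ => B_cat) (fun _ => 1%g) (fun _ _ _ t s => scomp t s)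
    (fun _ _ _ t t' s s' b a => B_hcomp b a) B_hlaws
    (fun _ _ _ t s => B_hcomp_id t s).

(* F_n^*: the elements sigma * E with sigma a permutation and E an idempotent  *)
(* of the monoid of propagating partitions.                                    *)
Definition factorizable P : bool :=
  [exists s : 'S_n, [exists E : sets,
    [&& isPP E, pmul E E == E & P == pmul (pperm s) E]]].
Definition Fstar : finType := {P : sets | factorizable P}.

Lemma const_idem E f g : isPP E -> pmul E E = E -> const E f g -> f = g.
Proof.
move=> hE ee h; have := h; rewrite -ee => /(const_mul _ _ _ hE)[u h1 h2].
by move: h2; rewrite -(const_fun hE h h1) => h2; exact: const_cofun hE h h2.
Qed.

(* Factorizable elements are those lying above a permutation.                 *)
Lemma factorizableP P : reflect
  (isPP P /\ exists s : 'S_n, forall f g, const P f g -> const (pperm s) f g)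
  (factorizable P).
Proof.
apply: (iffP existsP) => [[s /existsP[E /and3P[hE /eqP ee /eqP ->]]]|[hP [s hs]]].
  split; first exact: isPP_mul (pperm_isPP s) hE.
  by exists s => f g /(const_mul _ _ _ hE)[h /(const_idem hE ee) ->].
have hE : isPP (pmul (pperm s^-1%g) P) by apply: isPP_mul => //; exact: pperm_isPP.
have cE f g : const (pmul (pperm s^-1%g) P) f g <-> f = g /\ const P f [ffun x => g (s^-1%g x)].
  rewrite const_mul //; split=> [[h h1 /const_perm h2]|[_ h]].
    have -> : [ffun x => g (s^-1%g x)] = h by apply/ffunP => x; rewrite ffunE h2.
    by split=> //; apply/ffunP => x; have /const_perm-> := hs _ _ h1; rewrite h2 permK.
  by exists [ffun x => g (s^-1%g x)] => //; apply/const_perm => x; rewrite ffunE.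
exists s; apply/existsP; exists (pmul (pperm s^-1%g) P); rewrite hE /=.
apply/andP; split; apply/eqP.
  apply: const_inj; [exact: pmul_partition|exact: pmul_partition|] => f g.
  rewrite const_mul //; split=> [[h /cE[-> _] //]|h]; exists g => //.
  by have [e _] := (cE _ _).1 h; rewrite e in h.
rewrite pmulA ?pperm_isPP // pmul_perm.
have -> : scomp s s^-1%g = 1%g by rewrite /scomp mulVg.
by rewrite pmul1l.
Qed.

Fact F_one_subproof : factorizable (pperm 1%g).
Proof. by apply/factorizableP; split; [exact: pperm_isPP|exists 1%g]. Qed.
Definition F_one : Fstar := exist _ (pperm 1%g) F_one_subproof.

Fact F_mul_subproof (t s : Fstar) : factorizable (pmul (val t) (val s)).
Proof.
have /factorizableP[t1 [p tp]] := valP t; have /factorizableP[s1 [q sq]] := valP s.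
apply/factorizableP; split; first exact: isPP_mul.
exists (scomp p q) => f g /(const_mul _ _ _ s1)[h /sq k1 /tp k2].
by rewrite -pmul_perm; apply/(const_mul _ _ _ (pperm_isPP q)); exists h.
Qed.
Definition F_mul (t s : Fstar) : Fstar := exist _ (pmul (val t) (val s)) (F_mul_subproof t s).

Let KF (s : Fstar) := const (val s).
Let FPP (s : Fstar) : isPP (val s). Proof. by have /factorizableP[] := valP s. Qed.

Lemma KF_inj (s t : Fstar) : (forall f g, KF s f g <-> KF t f g) -> s = t.
Proof. by move=> h; apply: val_inj; apply: const_inj => //; exact: isPP_partition. Qed.
Lemma KF_one f g : KF F_one f g <-> f = g. Proof. exact: const_one. Qed.
Lemma KF_mul (t s : Fstar) f h : KF (F_mul t s) f h <-> exists2 g, KF s f g & KF t g h.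
Proof. exact: const_mul. Qed.
Lemma KF_fun (s : Fstar) f g g' : KF s f g -> KF s f g' -> g = g'.
Proof. exact: const_fun. Qed.
Lemma KF_cofun (s : Fstar) f f' g : KF s f g -> KF s f' g -> f = f'.
Proof. exact: const_cofun. Qed.
Lemma KF_inv (s : Fstar) : exists s' : Fstar, forall f g, KF s' f g <-> KF s g f.
Proof.
have /factorizableP[h1 [p hp]] := valP s.
have hi : factorizable (pperm p^-1%g).
  by apply/factorizableP; split; [exact: pperm_isPP|exists p^-1%g].
pose i : Fstar := exist (fun P : sets => factorizable P) _ hi.
have Ki f g : KF i f g <-> forall x, f (p x) = g x.
  rewrite /KF const_perm; split=> h x; first by rewrite h permK.
  by rewrite -h permKV.
exists (F_mul i (F_mul s i)) => f g; rewrite !KF_mul; split.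
  move=> [h' /KF_mul[h /Ki k1 k2] /Ki k3].
  have /const_perm k4 := hp _ _ k2.
  have -> : g = h by apply/ffunP => x; rewrite -k3 -k4.
  by have <- : h' = f by apply/ffunP => x; rewrite -(permKV p x) -k4 -k1.
move=> k; have /const_perm k4 := hp _ _ k.
exists f; last by apply/Ki => x; rewrite k4.
by apply/KF_mul; exists g => //; apply/Ki => x; rewrite k4.
Qed.

Definition F_ordMonoid : ordMonoid :=
  natural_ordMonoid KF_inj KF_one KF_mul KF_fun KF_cofun KF_inv.
End PartitionMonoid.

(* Main.v *)
From HB Require Import structures.
From mathcomp Require Import all_boot all_fingroup all_algebra.
From mathcomp Require Import boolp.
Require Import Defs.

(** Finitarity. A k-linear category is finitary as soon as it is additive,
    its idempotents split, its morphism spaces are finite dimensional, and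
    every object is a summand of a sum of finitely many given ones
    ([finitary_criterion]). Indeed, by Fitting's lemma an object with only
    trivial idempotents has a local endomorphism ring; decomposing an
    identity into as many orthogonal idempotents as possible gives a
    Krull-Schmidt decomposition; and an indecomposable object is a summand
    of one of the given ones. Additive closure provides sums, idempotent
    completion splits idempotents, and the other two properties hold for
    linearizations and are inherited by additive closures, idempotent
    completions and the bar construction. The bar construction has finitely
    many objects since the endomorphisms of an identity 1-morphism commute
    (Eckmann-Hilton), so that distinct primitive idempotents are orthogonal;
    and the identity 1-morphism of (i, eps) is the image of eps, which is
    indecomposable since eps is primitive.

    Fiatness. In A_n and B_n the 1-morphisms are permutations, so each is
    adjoint to its inverse, with identities as unit and counit. The mate of
    a 2-morphism alpha : pi -> sigma is the composite of sigma^-1, alpha and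
    pi^-1, and because alpha acts as a partial bijection (on points,
    respectively on labellings of points by booleans) this is just its
    converse (for partitions: the partition with x and x' exchanged). Taking
    converses is strictly involutive, and it fixes every 2-endomorphism of
    the identity: a subset of the diagonal, or a partition above the
    diagonal one, is symmetric ([A_duality], [B_duality]). These data extend
    to matrices by transposition ([additive_duality]) and restrict to images
    of idempotents ([karoubi_duality]). They restrict to the bar
    construction because the idempotents eps are fixed ([bar_duality]). The
    structure [duality] is what all these steps preserve, and together with
    finitarity it gives a fiat 2-category ([fiat_of_duality]).

    Failure of fiatness. The unit of an adjunction for F is a nonzero
    2-morphism from the identity to some G F. If F is an element s of an
    ordered monoid, this forces 1 <= t s for some t ([ord_hull_not_fiat]).
    It is impossible for the empty partial bijection, and for the partition
    with a single part when n > 1: no product t s relates a point,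
    respectively a nonconstant labelling, to itself. *)

Set Implicit Arguments.
Unset Strict Implicit.
Unset Printing Implicit Defensive.
Import GRing.Theory.
Local Open Scope ring_scope.
Local Open Scope twocat_scope.

(** * Finite-dimensional spaces *)

Section FiniteDimension.
Variable k : fieldType.

(** A finite spanning family suffices to bound the number of orthogonal
    idempotents and to make every endomorphism algebraic. *)
Definition finite_dim (V : lmodType k) : Prop :=
  exists (n : nat) (b : 'I_n -> V), forall a, exists c : 'I_n -> k, a = \sum_i c i *: b i.

Lemma finite_dim_fin (I : finType) (V : lmodType k) (b : I -> V) :
  (forall a, exists c : I -> k, a = \sum_i c i *: b i) -> finite_dim V.
Proof.
move=> h; exists #|I|, (fun i => b (enum_val i)) => a; have [c ->] := h a.
exists (fun i => c (enum_val i)); rewrite (reindex (@enum_val I I)) //=.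
by apply: onW_bij; exact: enum_val_bij.
Qed.

Lemma finite_dim_fcomb (A : finType) : finite_dim (fcomb k A).
Proof.
apply: (finite_dim_fin (b := @delta k A)) => a.
by exists (a : {ffun A -> k^o}); exact: fcombE.
Qed.

Lemma finite_dim_image (V W : lmodType k) (f : V -> W) :
  linear f -> (forall w, exists v, w = f v) -> finite_dim V -> finite_dim W.
Proof.
move=> lf sf [n [b hb]]; exists n, (fun i => f (b i)) => w.
have [v ->] := sf w; have [c ->] := hb v; exists c; exact: linear_sumE.
Qed.

Lemma finite_dim_dprod (I : finType) (V : I -> lmodType k) :
  (forall i, finite_dim (V i)) -> finite_dim (dprod V).
Proof.
move=> h; pose n i := projT1 (cid (h i)).
pose b i : 'I_(n i) -> V i := projT1 (cid (projT2 (cid (h i)))).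
have hb i : forall a, exists c : 'I_(n i) -> k, a = \sum_j c j *: b i j.
  exact: projT2 (cid (projT2 (cid (h i)))).
pose single i (v : V i) : dprod V :=
  fun j => if i =P j is ReflectT e then ecast z (V z) e v else 0.
apply: (@finite_dim_fin {i : I & 'I_(n i)} _ (fun u => single _ (b (tag u) (tagged u)))).
move=> a; pose c i := projT1 (cid (hb i (a i))).
exists (fun u : {i : I & 'I_(n i)} => c (tag u) (tagged u)).
rewrite -(sig_big_dep xpredT (fun _ _ => true)
  (fun i j => c i j *: single i (b i j))) /=.
have single_lin i : linear (single i).
  move=> x u v; apply: dprod_ext => j; rewrite dprodE /single.
  by case: eqP => [e|_]; [case: _ / e|rewrite scaler0 addr0].
have -> : a = \sum_i single i (a i).
  apply: dprod_ext => j.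
  have ev : linear (fun u : dprod V => u j) by [].
  rewrite (linear_fsum ev) (bigD1 j) //= big1 => [|i ne]; last first.
    by rewrite /single; case: eqP ne => // ->; rewrite eqxx.
  rewrite addr0 /single; case: eqP => // e.
  by rewrite (Prop_irrelevance e erefl).
apply: eq_bigr => i _; rewrite -(linear_sumE (single_lin i)); congr single.
exact: projT2 (cid (hb i (a i))).
Qed.

Lemma linear_relation (V : lmodType k) (n : nat) (b : 'I_n -> V) (v : 'I_n.+1 -> V) :
  (forall a, exists c : 'I_n -> k, a = \sum_i c i *: b i) ->
  exists2 x : 'I_n.+1 -> k, \sum_i x i *: v i = 0 & exists i, x i != 0.
Proof.
move=> hb; (* The matrix of coordinates has more rows than columns, hence a kernel. *)
have [c hc] := choice (fun i => hb (v i)).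
pose M : 'M[k]_(n.+1, n) := \matrix_(i, j) c i j.
have : kermx M != 0.
  by rewrite kermx_eq0 /row_free neq_ltn (leq_trans _ (ltnSn n)) // ltnS rank_leq_col.
move=> /rowV0Pn[x /sub_kermxP xM nz]; exists (fun i => x 0 i); last first.
  by apply/rV0Pn.
under eq_bigr => i _ do rewrite hc scaler_sumr.
rewrite exchange_big big1 // => j _.
under eq_bigr => i _ do rewrite scalerA.
rewrite -scaler_suml; move/rowP: xM => /(_ j); rewrite !mxE.
under eq_bigr => i _ do rewrite mxE.
by move=> ->; rewrite scale0r.
Qed.
End FiniteDimension.

Lemma bounded_max (P : nat -> Prop) (m : nat) :
  (exists n, P n) -> (forall n, P n -> (n <= m)%N) ->
  exists n, P n /\ ~ P n.+1.
Proof.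
move=> [n0 h0] hm; have ex : exists n, `[< P n >] by exists n0; apply/asboolP.
have bd n : `[< P n >] -> (n <= m)%N by move=> /asboolP/hm.
case: (ex_maxnP ex bd) => n /asboolP hn mx; exists n; split=> // /asboolP/mx.
by rewrite ltnn.
Qed.

(** * Fitting's lemma *)

Section EndomorphismRing.
Variables (k : fieldType) (D : linCat k) (X : D).

(** The nonvanishing of the identity is a parameter because the rings under
    consideration are nontrivial. *)
Definition endo (nz : lid X <> 0) : Type := lhom X X.
Variable nz : lid X <> 0.
HB.instance Definition _ := GRing.Lmodule.copy (endo nz) (lhom X X).

Definition endo_mul (b a : endo nz) : endo nz := b \v a.
Definition endo_one : endo nz := lid X.

Fact endo_mulA : associative endo_mul.
Proof. by move=> c b a; exact: cat_assoc (llaws D) _ _ _ _ _ _ _. Qed.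
Fact endo_mul1l : left_id endo_one endo_mul.
Proof. by move=> a; exact: cat_idl (llaws D) _ _ _. Qed.
Fact endo_mul1r : right_id endo_one endo_mul.
Proof. by move=> a; exact: cat_idr (llaws D) _ _ _. Qed.
Fact endo_mulDl : left_distributive endo_mul +%R.
Proof.
move=> b b' a; have := lcomp_linl (X := X) (Z := X) (a : lhom X X) 1 b b'.
by rewrite !scale1r.
Qed.
Fact endo_mulDr : right_distributive endo_mul +%R.
Proof.
move=> b a a'; have := lcomp_linr (X := X) (b : lhom X X) 1 a a'.
by rewrite !scale1r.
Qed.
Fact endo_nz : endo_one != 0. Proof. exact/eqP. Qed.
HB.instance Definition _ := GRing.Zmodule_isNzRing.Build (endo nz)
  endo_mulA endo_mul1l endo_mul1r endo_mulDl endo_mulDr endo_nz.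

Fact endo_scaleAl (c : k) (b a : endo nz) : c *: (b * a) = c *: b * a.
Proof.
have := lcomp_linl (X := X) (Z := X) (a : lhom X X) c b 0.
by rewrite !addr0 lcomp0l addr0.
Qed.
HB.instance Definition _ := GRing.Lmodule_isLalgebra.Build k (endo nz) endo_scaleAl.
Fact endo_scaleAr (c : k) (b a : endo nz) : c *: (b * a) = b * (c *: a).
Proof.
have := lcomp_linr (X := X) (b : lhom X X) c a 0.
by rewrite !addr0 lcomp0r addr0.
Qed.
HB.instance Definition _ := GRing.Lalgebra_isAlgebra.Build k (endo nz) endo_scaleAr.
End EndomorphismRing.

Section Fitting.
Variables (k : fieldType) (A : algType k).

Lemma annihilating_poly (a : A) : finite_dim A -> exists2 p : {poly k},
  p != 0 & horner_alg a p = 0.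
Proof.
move=> [n [b hb]].
have [x e [i nz]] := linear_relation (fun i : 'I_n.+1 => a ^+ i) hb.
exists (\poly_(i < n.+1) x (inord i)); last first.
  rewrite poly_def linear_sum -[RHS]e; apply: eq_bigr => j _.
  rewrite linearZ /= inord_val mulr_algl; congr (_ *: _).
  by rewrite rmorphXn; congr (_ ^+ _); exact: horner_algX.
apply: contra_neqN nz => /eqP /polyP /(_ i).
by rewrite coef_poly ltn_ord coef0 inord_val.
Qed.

(** Write an annihilating polynomial of [a] as X^r q with q coprime to X;
    a Bezout relation between the two factors then evaluates at [a] to an
    idempotent, whose two trivial values are the two alternatives. *)
Lemma fitting (a : A) : finite_dim A ->
  (forall e : A, e * e = e -> e = 0 \/ e = 1) ->
  (exists r, a ^+ r = 0) \/ exists2 b, a * b = 1 & b * a = 1.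
Proof.
move=> /(annihilating_poly a)[p nz pa] idem.
have [r [q [q0 ep]]] : exists r, exists q : {poly k}, ~~ root q 0 /\ p = 'X^r * q.
  have [r [q [q0 ->]]] := multiplicity_XsubC p 0.
  by exists r, q; move: q0; rewrite nz implyTb subr0 mulrC.
have cop : coprimep ('X^(r.+1)) q.
  by apply: coprimep_expl; rewrite coprimep_sym coprimepX.
have [[u v] /= uv] := Bezout_eq1_coprimepP _ _ cop.
have [ev [evM evD ev1 evX evp]] : exists ev : {poly k} -> A,
    [/\ {morph ev : x y / x * y}, {morph ev : x y / x + y}, ev 1 = 1, ev 'X = a & ev p = 0].
  exists (horner_alg a); split=> //.
  - exact: rmorphM.
  - exact: rmorphD.
  - exact: rmorph1.
  - exact: horner_algX.
have evXn m : ev ('X^m) = a ^+ m.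
  by elim: m => [|m IH]; rewrite ?expr0 // !exprS evM IH evX.
have pa' w : ev (w * ('X^(r.+1) * q)) = 0.
  by rewrite exprS -mulrA -ep !evM evp !mulr0.
have sum1 : ev (u * 'X^(r.+1)) + ev (v * q) = 1 by rewrite -evD uv ev1.
have orth : ev (u * 'X^(r.+1)) * ev (v * q) = 0.
  by rewrite -evM mulrACA pa'.
have ee : ev (u * 'X^(r.+1)) * ev (u * 'X^(r.+1)) = ev (u * 'X^(r.+1)).
  by rewrite -[RHS]mulr1 -sum1 mulrDr orth addr0.
case: (idem _ ee) => h; rewrite h in sum1.
  left; exists r.+1; rewrite add0r in sum1.
  by rewrite -[LHS]mulr1 -sum1 -evXn -evM mulrCA pa'.
right; exists (ev (u * 'X^r)).
  by rewrite -{1}evX -evM mulrCA -exprS.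
by rewrite -{1}evX -evM -mulrA -exprSr.
Qed.
End Fitting.

(** * Krull-Schmidt decompositions *)

Section LinCatTheory.
Variables (k : fieldType) (D : linCat k).

Lemma vcompA (X Y Z W : D) (c : lhom Z W) (b : lhom Y Z) (a : lhom X Y) :
  c \v (b \v a) = c \v b \v a.
Proof. exact: cat_assoc (llaws D) _ _ _ _ _ _ _. Qed.
Lemma vcomp1l (X Y : D) (a : lhom X Y) : lid Y \v a = a.
Proof. exact: cat_idl (llaws D) _ _ _. Qed.
Lemma vcomp1r (X Y : D) (a : lhom X Y) : a \v lid X = a.
Proof. exact: cat_idr (llaws D) _ _ _. Qed.
Lemma vcompDl (X Y Z : D) (b b' : lhom Y Z) (a : lhom X Y) :
  (b + b') \v a = b \v a + b' \v a.
Proof. by have := lcomp_linl (Z := Z) a 1 b b'; rewrite !scale1r. Qed.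
Lemma vcompDr (X Y Z : D) (b : lhom Y Z) (a a' : lhom X Y) :
  b \v (a + a') = b \v a + b \v a'.
Proof. by have := lcomp_linr (X := X) b 1 a a'; rewrite !scale1r. Qed.
Lemma vcompZl (X Y Z : D) c (b : lhom Y Z) (a : lhom X Y) :
  (c *: b) \v a = c *: (b \v a).
Proof. by have := lcomp_linl (Z := Z) a c b 0; rewrite !addr0 lcomp0l addr0. Qed.
Lemma vcompZr (X Y Z : D) c (b : lhom Y Z) (a : lhom X Y) :
  b \v (c *: a) = c *: (b \v a).
Proof. by have := lcomp_linr (X := X) b c a 0; rewrite !addr0 lcomp0r addr0. Qed.
Lemma vcompNl (X Y Z : D) (b : lhom Y Z) (a : lhom X Y) : (- b) \v a = - (b \v a).
Proof. by rewrite -scaleN1r vcompZl scaleN1r. Qed.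
Lemma vcompNr (X Y Z : D) (b : lhom Y Z) (a : lhom X Y) : b \v (- a) = - (b \v a).
Proof. by rewrite -scaleN1r vcompZr scaleN1r. Qed.

Lemma iso_comp (X Y Z : D) (b : lhom Y Z) (a : lhom X Y) :
  is_iso b -> is_iso a -> is_iso (b \v a).
Proof.
move=> [b' [h1 h2]] [a' [h3 h4]]; exists (a' \v b'); split.
  by rewrite -vcompA (vcompA b') h1 vcomp1l.
by rewrite -vcompA (vcompA a) h4 vcomp1l.
Qed.

Definition trivial_idempotents (X : D) : Prop :=
  lid X <> 0 /\ forall e : lhom X X, e \v e = e -> e = 0 \/ e = lid X.

(** By Fitting, [x] and [1 - x] are each invertible or nilpotent, and the
    geometric series inverts [1 - x] when [x] is nilpotent. *)
Lemma trivial_idempotents_local (X : D) :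
  finite_dim (lhom X X) -> trivial_idempotents X -> local_endomorphism_ring X.
Proof.
move=> fd [nz triv]; split=> // a b na nb [g [ga ag]].
have iso_g : is_iso g by exists (a + b).
have iso_ab : is_iso (a + b) by exists g.
have lift_iso (x : lhom X X) : is_iso (g \v x) -> is_iso x.
  by move=> h; rewrite -(vcomp1l x) -ag -vcompA; exact: iso_comp.
have dich (x : endo nz) : (exists r, x ^+ r = 0) \/ is_iso (x : lhom X X).
  have [|[y h1 h2]] := @fitting k (endo nz) x fd triv; first by left.
  by right; exists (y : lhom X X).
have [[r xr]|/lift_iso //] := dich (g \v a).
pose x : endo nz := g \v a; pose y : endo nz := g \v b.
have exy : 1 - x = y.
  by apply/eqP; rewrite subr_eq addrC; apply/eqP; rewrite -[LHS]ga vcompDr.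
have [[s ys]|/lift_iso //] := dich y.
have inv : y * (\sum_(i < r) x ^+ i) = 1.
  have := subrX1 x r; rewrite xr -exy => e.
  by rewrite -opprB mulNr -e sub0r opprK.
have : (1 : endo nz) = 0.
  elim: s ys => [|s IH] // ys; apply: IH.
  by rewrite -[LHS]mulr1 -inv mulrA -exprSr ys mul0r.
exact: nz.
Qed.

Lemma retract_idem (X Y : D) (r : lhom X Y) (s : lhom Y X) :
  r \v s = lid Y -> (s \v r) \v (s \v r) = s \v r.
Proof. by move=> rs; rewrite -vcompA (vcompA r) rs vcomp1l. Qed.

(** A nontrivial idempotent and its complement would split off two nonzero
    summands. *)
Lemma indecomposable_trivial (X : D) :
  idempotent_split D -> indecomposable X -> trivial_idempotents X.
Proof.
move=> sp [nz ind]; split=> // e ee.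
have ee' : (lid X - e) \v (lid X - e) = lid X - e.
  by rewrite vcompDl vcomp1l vcompNl vcompDr vcomp1r vcompNr ee subrr subr0.
have [Y [r [s [rs sr]]]] := sp _ _ ee.
have [Y' [r' [s' [rs' sr']]]] := sp _ _ ee'.
pose Z (i : 'I_2) := if val i is 0%N then Y else Y'.
pose pr i : lhom X (Z i) :=
  match val i as m return lhom X (if m is 0%N then Y else Y') with 0%N => r | _ => r' end.
pose inj i : lhom (Z i) X :=
  match val i as m return lhom (if m is 0%N then Y else Y') X with 0%N => s | _ => s' end.
have re : r = r \v e by rewrite -sr vcompA rs vcomp1l.
have es : s = e \v s by rewrite -sr -vcompA rs vcomp1r.
have re' : r' = r' \v (lid X - e) by rewrite -sr' vcompA rs' vcomp1l.
have es' : s' = (lid X - e) \v s' by rewrite -sr' -vcompA rs' vcomp1r.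
have h1 : r \v s' = 0.
  by rewrite re es' -vcompA (vcompA e) vcompDr vcompNr vcomp1r ee subrr lcomp0l lcomp0r.
have h2 : r' \v s = 0.
  rewrite re' -vcompA; have -> : (lid X - e) \v s = 0; last by rewrite lcomp0r.
  by rewrite vcompDl vcomp1l vcompNl -sr -vcompA rs vcomp1r subrr.
have [|i] := ind Z.
  exists inj, pr; split.
  - by case=> -[|[|//]] hi.
  - by case=> -[|[|//]] hi [[|[|//]] hj].
  - by rewrite big_ord_recl big_ord1 /= sr sr' addrC subrK.
case: i => -[|[|//]] hi z.
  have {}z : lid Y = 0 := z.
  by left; rewrite -sr -(vcomp1l r) z lcomp0l lcomp0r.
have {}z : lid Y' = 0 := z.
right; apply/esym/eqP; rewrite -subr_eq0 -sr' -(vcomp1l r') z lcomp0l lcomp0r; exact/eqP.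
Qed.

Lemma iso_sum (X : D) (I : finType) (a : I -> lhom X X) :
  local_endomorphism_ring X -> is_iso (\sum_i a i) -> exists i, is_iso (a i).
Proof.
move=> [nz loc] h; apply: contrapT => no.
have z : ~ is_iso (0 : lhom X X).
  by move=> [g [e _]]; apply: nz; rewrite /is_zero -e lcomp0r.
suff : ~ is_iso (\sum_i a i) by [].
elim/big_rec: _ => // i x _ nx; apply: loc => // ai; apply: no; by exists i.
Qed.

(** In a local ring, some term of a sum equal to 1 is invertible. *)
Lemma local_retract (X : D) (I : finType) (Y : I -> D)
    (r : forall i, lhom X (Y i)) (s : forall i, lhom (Y i) X) :
  local_endomorphism_ring X -> \sum_i s i \v r i = lid X ->
  exists i (r' : lhom X (Y i)) (s' : lhom (Y i) X), s' \v r' = lid X.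
Proof.
move=> loc e; have [|i [g [h _]]] := @iso_sum X I (fun i => s i \v r i) loc.
  by rewrite e; exists (lid X); rewrite vcomp1l.
by exists i, (r i), (g \v s i); rewrite -vcompA.
Qed.

Definition orthogonal_idempotents (X : D) (n : nat) (e : 'I_n -> lhom X X) : Prop :=
  [/\ forall i, e i \v e i = e i, forall i, e i <> 0 &
      forall i j, i != j -> e i \v e j = 0].

Lemma orthogonal_idempotents_bound (X : D) :
  finite_dim (lhom X X) ->
  exists m, forall n (e : 'I_n -> lhom X X), orthogonal_idempotents e -> (n <= m)%N.
Proof.
move=> [m [b hb]]; exists m => n e [ee nz orth]; rewrite leqNgt; apply/negP => lt.
have [x rel [i /eqP xi]] := linear_relation (fun i : 'I_m.+1 => e (widen_ord lt i)) hb.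
apply: (nz (widen_ord lt i)).
have : e (widen_ord lt i) \v (\sum_j x j *: e (widen_ord lt j)) = 0 by rewrite rel lcomp0r.
rewrite lcomp_sumr (bigD1 i) //= big1 => [|j ne].
  rewrite vcompZr ee addr0 => /eqP; rewrite scaler_eq0 => /orP[/eqP//|/eqP//].
rewrite vcompZr orth ?scaler0 //; apply: contra_neq ne => /(congr1 val) /= h.
exact: val_inj.
Qed.

(** A decomposition of the identity into a maximal number of orthogonal
    idempotents splits the object into summands with only trivial idempotents:
    a nontrivial idempotent of a summand would refine the decomposition. *)
Lemma krull_schmidt_of_finite_dim :
  idempotent_split D -> finite_dimensional_homs D -> krull_schmidt D.
Proof.
move=> sp fd X; have [z|nz] := pselect (lid X = 0).
  exists 0, (fun _ => X); split; last by case.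
  exists (fun _ => lid X), (fun _ => lid X); split=> [[]|[]|] //.
  by rewrite big_ord0 z.
pose P n := exists e : 'I_n -> lhom X X, orthogonal_idempotents e /\ \sum_i e i = lid X.
have [m hm] := orthogonal_idempotents_bound (fd X X).
have [||n [[e [[ee enz orth] esum]] mx]] := @bounded_max P m.
- exists 1%N, (fun _ => lid X); rewrite big_ord1; split=> //.
  by split=> [_|_|i j]; rewrite ?vcomp1l // !ord1.
- by move=> n [e [he _]]; exact: hm he.
pose Y i := projT1 (cid (sp _ _ (ee i))).
pose r i : lhom X (Y i) := projT1 (cid (projT2 (cid (sp _ _ (ee i))))).
pose s i : lhom (Y i) X := projT1 (cid (projT2 (cid (projT2 (cid (sp _ _ (ee i))))))).
have rs i : r i \v s i = lid (Y i).
  exact: (projT2 (cid (projT2 (cid (projT2 (cid (sp _ _ (ee i)))))))).1.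
have sr i : s i \v r i = e i.
  exact: (projT2 (cid (projT2 (cid (projT2 (cid (sp _ _ (ee i)))))))).2.
have re i : r i \v e i = r i by rewrite -sr vcompA rs vcomp1l.
have es i : e i \v s i = s i by rewrite -sr -vcompA rs vcomp1r.
have rs0 i j : i != j -> r i \v s j = 0.
  by move=> ne; rewrite -re -es -vcompA (vcompA (e i)) orth // lcomp0l lcomp0r.
exists n, Y; split.
  exists s, r; split=> //; rewrite -esum; exact: eq_bigr.
move=> i; apply: trivial_idempotents_local; first exact: fd.
split=> [z|f ff]; first by apply: (enz i); rewrite -sr -(vcomp1l (r i)) z lcomp0l lcomp0r.
apply: contrapT => /not_orP[f0 f1]; apply: mx.
pose f' := lid (Y i) - f.
have ff' : f' \v f' = f'.
  by rewrite /f' vcompDl vcomp1l vcompNl vcompDr vcomp1r vcompNr ff subrr subr0.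
have fof' : f \v f' = 0 by rewrite /f' vcompDr vcompNr vcomp1r ff subrr.
have f'of : f' \v f = 0 by rewrite /f' vcompDl vcompNl vcomp1l ff subrr.
have f'0 : f' <> 0 by move=> /eqP; rewrite subr_eq0 => /eqP h; apply: f1.
(* Conjugation by the splitting embeds the endomorphisms of Y i in those of X
   supported on e i; there f and its complement f' replace e i. *)
pose c g := s i \v g \v r i.
have cc g h : c g \v c h = c (g \v h).
  by rewrite /c -!vcompA (vcompA (r i)) rs vcomp1l.
have c0 : c 0 = 0 by rewrite /c lcomp0r lcomp0l.
have c_inj g : c g = 0 -> g = 0.
  have {2}-> : g = r i \v c g \v s i by rewrite /c -!vcompA rs vcomp1r vcompA rs vcomp1l.
  by move=> ->; rewrite lcomp0r lcomp0l.
have ce g j : j != i -> c g \v e j = 0.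
  by move=> ne; rewrite /c -(re i) -!vcompA orth 1?eq_sym // !lcomp0r.
have ec g j : j != i -> e j \v c g = 0.
  by move=> ne; rewrite /c -(es i) !vcompA orth // !lcomp0l.
pose e' (j : 'I_n.+1) := if unlift ord0 j is Some j' then
  if j' == i then c f' else e j' else c f.
exists e'; split; last first.
  rewrite big_ord_recl /e' unlift_none; under eq_bigr => j _ do rewrite liftK.
  rewrite (bigD1 i) //= eqxx -esum [in RHS](bigD1 i) //= addrA; congr (_ + _).
    rewrite -sr /c -vcompDl -vcompDr /f' addrC subrK vcomp1r //.
  by apply: eq_bigr => j /negbTE->.
split=> [j|j|j l].
- rewrite /e'; case: unliftP => [j' _|_]; last by rewrite cc ff.
  by case: eqP => // _; rewrite cc ff'.
- rewrite /e'; case: unliftP => [j' _|_]; last by move=> /c_inj.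
  by case: eqP => // _ /c_inj.
- rewrite /e'; case: unliftP => [j' ->|->]; case: unliftP => [l' ->|->] //.
  + rewrite (inj_eq lift_inj) => ne.
    case: eqP => [ej|/eqP nj]; case: eqP => [el|/eqP nl]; [|exact: ce|exact: ec|exact: orth].
    by rewrite ej el eqxx in ne.
  + by move=> _; case: eqP => [_|/eqP]; [rewrite cc f'of|exact: ec].
  + by move=> _; case: eqP => [_|/eqP]; [rewrite cc fof'|exact: ce].
Qed.
End LinCatTheory.

(** * Finitary linear categories *)

Section FinitaryCriterion.
Variables (k : fieldType) (D : linCat k).

(** Every object is a retract of a finite sum of the objects [G i], expressed
    without mentioning the sum: its identity factors through the summands. *)
Definition finitely_generated : Prop :=
  exists (I : finType) (G : I -> D), forall X : D,
    exists (J : finType) (c : J -> I) (r : forall l, lhom X (G (c l)))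
      (s : forall l, lhom (G (c l)) X), \sum_l s l \v r l = lid X.

(** One of [e] and [1 - e] is invertible, and an invertible idempotent is an
    identity. *)
Lemma local_idempotent (X : D) (e : lhom X X) :
  local_endomorphism_ring X -> e \v e = e -> e = 0 \/ e = lid X.
Proof.
move=> [nz loc] ee.
have ee' : (lid X - e) \v (lid X - e) = lid X - e.
  by rewrite vcompDl vcomp1l vcompNl vcompDr vcomp1r vcompNr ee subrr subr0.
have iso1 (f : lhom X X) : f \v f = f -> is_iso f -> f = lid X.
  by move=> ff [g [gf _]]; rewrite -[LHS]vcomp1l -gf -vcompA ff.
apply: contrapT => /not_orP[e0 e1]; apply: (loc e (lid X - e)).
- by move=> /(iso1 _ ee).
- by move=> /(iso1 _ ee') /eqP; rewrite subr_eq addrC -subr_eq subrr => /eqP/esym.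
- by exists (lid X); rewrite addrC subrK vcomp1l.
Qed.

Lemma retract_local_iso (X Y : D) (r : lhom X Y) (s : lhom Y X) :
  lid X <> 0 -> local_endomorphism_ring Y -> s \v r = lid X -> isomorphic X Y.
Proof.
move=> nz loc sr; exists r, s; split=> //.
have [z|//] := local_idempotent loc (retract_idem sr).
by case: nz; rewrite -(vcomp1l (lid X)) -sr -vcompA (vcompA r) z lcomp0l lcomp0r.
Qed.

(** An indecomposable object has local endomorphism ring, hence is a retract of
    a single generator, and then of a single indecomposable summand of that
    generator. *)
Lemma finitely_many_indecomposables_of_generators :
  idempotent_split D -> finite_dimensional_homs D -> finitely_generated ->
  finitely_many_indecomposables D.
Proof.
move=> sp fd [I [G gen]]; have ks := krull_schmidt_of_finite_dim sp fd.
pose n i := projT1 (cid (ks (G i))).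
pose Y i : 'I_(n i) -> D := projT1 (cid (projT2 (cid (ks (G i))))).
have YP i : is_biproduct (@Y i) (G i) /\ forall j, local_endomorphism_ring (@Y i j).
  exact: projT2 (cid (projT2 (cid (ks (G i))))).
exists #|{: {i : I & 'I_(n i)}}|, (fun t => Y (tag (enum_val t)) (tagged (enum_val t))).
move=> X indX; have triv := indecomposable_trivial sp indX.
have loc := trivial_idempotents_local (fd X X) triv.
have [J [c [r [s e]]]] := gen X.
have [l [r1 [s1 e1]]] := local_retract loc e.
have [[inj [prj [_ _ ip]]] locY] := YP (c l).
have [|j [r2 [s2 e2]]] := @local_retract _ _ X _ (@Y (c l))
    (fun j => prj j \v r1) (fun j => s1 \v inj j) loc.
  rewrite -e1 -[in RHS](vcomp1l r1) -ip lcomp_suml lcomp_sumr; apply: eq_bigr => j _.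
  by rewrite !vcompA.
exists (enum_rank (Tagged (fun i => 'I_(n i)) j)); rewrite enum_rankK /=.
by apply: (retract_local_iso (r := r2) (s := s2)) => //; case: triv.
Qed.

Theorem finitary_criterion :
  is_additive D -> idempotent_split D -> finite_dimensional_homs D ->
  finitely_generated -> finitary_category D.
Proof.
move=> ad sp fd gen; split=> //.
  exact: krull_schmidt_of_finite_dim.
exact: finitely_many_indecomposables_of_generators.
Qed.
End FinitaryCriterion.

Section KaroubiFinitary.
Variables (k : fieldType) (D : linCat k).

Definition kar_in (X Y : kobj D) (a : lhom (kob X) (kob Y)) : kar_hom X Y :=
  in_im _ (ex_intro _ a erefl).

Lemma karoubi_split : idempotent_split (karoubi D).
Proof.
move=> X e ee.
have ee' : imval e \v imval e = imval e by move/(congr1 (@imval _ _ _ _)): ee.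
pose Y := KObj ee'.
exists Y, (@kar_in X Y (imval e)), (@kar_in Y X (imval e)).
split; apply: imval_inj; rewrite /= /kproj /= ?kfixr ?kfixl ?ee' ?kfixl //.
Qed.

Lemma karoubi_finite_dim : finite_dimensional_homs D -> finite_dimensional_homs (karoubi D).
Proof.
move=> fd X Y; apply: (finite_dim_image (f := @kar_in X Y)); last exact: fd.
- move=> c a b; apply: imval_inj; exact: kproj_lin.
- by move=> a; exists (imval a); apply: imval_inj; rewrite /= kfix.
Qed.

Lemma imval_sum (V : lmodType k) (p : V -> V) (lp : linear p) I (r : seq I) (P : pred I)
    (F : I -> image lp) :
  imval (\sum_(i <- r | P i) F i) = \sum_(i <- r | P i) imval (F i).
Proof. exact: (linear_fsum (@imval_lin _ _ _ lp)). Qed.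

(** The summand idempotents add up to an idempotent of the direct sum of the
    underlying objects. *)
Lemma karoubi_additive : is_additive D -> is_additive (karoubi D).
Proof.
move=> ad n X; have [S [inj [prj [h1 h2 h3]]]] := ad n (fun i => kob (X i)).
pose e := \sum_i inj i \v kidem (X i) \v prj i.
have pe i : prj i \v e = kidem (X i) \v prj i.
  rewrite /e lcomp_sumr (bigD1 i) //= big1 => [|j ne].
    by rewrite addr0 !vcompA h1 vcomp1l.
  by rewrite !vcompA h2 1?eq_sym // !lcomp0l.
have ej i : e \v inj i = inj i \v kidem (X i).
  rewrite /e lcomp_suml (bigD1 i) //= big1 => [|j ne].
    by rewrite addr0 -!vcompA h1 vcomp1r.
  by rewrite -!vcompA h2 // !lcomp0r.
have ee : e \v e = e.
  rewrite {1}/e lcomp_suml; apply: eq_bigr => i _.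
  by rewrite -!vcompA pe (vcompA (kidem _)) kidemP.
exists (KObj ee), (fun i => @kar_in (X i) (KObj ee) (inj i)),
  (fun i => @kar_in (KObj ee) (X i) (prj i)); split.
- move=> i; apply: imval_inj; rewrite /= /kproj /= pe (vcompA e) ej.
  by rewrite !vcompA kidemP -(vcompA _ (prj i)) h1 vcomp1r !kidemP.
- move=> i j ne; apply: imval_inj; rewrite /= /kproj /= pe (vcompA e) ej.
  by rewrite -!vcompA (vcompA (prj i)) h2 // !(lcomp0l, lcomp0r).
- apply: imval_inj; rewrite imval_sum /= /kproj /=; apply: eq_bigr => i _.
  by rewrite pe (vcompA e) ej -!vcompA !(vcompA (kidem _) (kidem _)) !kidemP (vcompA (kidem _)) kidemP.
Qed.

Lemma karoubi_generated : finitely_generated D -> finitely_generated (karoubi D).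
Proof.
move=> [I [G gen]].
have idP i : lid (G i) \v lid (G i) = lid (G i) by exact: vcomp1l.
exists I, (fun i => KObj (idP i)) => X; have [J [c [r [s e]]]] := gen (kob X).
exists J, c, (fun l => @kar_in X (KObj (idP (c l))) (r l)),
  (fun l => @kar_in (KObj (idP (c l))) X (s l)).
apply: imval_inj; rewrite imval_sum /= /kproj /=.
apply: (@etrans _ _ (kidem X \v lid (kob X) \v kidem X)); last by rewrite vcomp1r kidemP.
rewrite -e lcomp_sumr lcomp_suml; apply: eq_bigr => l _.
by rewrite vcomp1l vcomp1r !vcompA.
Qed.

Theorem karoubi_finitary :
  is_additive D -> finite_dimensional_homs D -> finitely_generated D ->
  finitary_category (karoubi D).
Proof.
move=> ad fd gen; apply: finitary_criterion.
- exact: karoubi_additive.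
- exact: karoubi_split.
- exact: karoubi_finite_dim.
- exact: karoubi_generated.
Qed.
End KaroubiFinitary.

(** * Linearization and additive closure *)

Section Linearize.
Variables (k : fieldType) (D : finCat).

Lemma linearize_finite_dim : finite_dimensional_homs (linearize k D).
Proof. by move=> X Y; exact: finite_dim_fcomb. Qed.

Lemma linearize_generated : finitely_generated (linearize k D).
Proof.
exists D, (fun X => X : linearize k D) => X; exists unit, (fun _ => X).
exists (fun _ => lid (X : linearize k D)), (fun _ => lid (X : linearize k D)).
by rewrite (big_pred1 tt) ?vcomp1l //; case.
Qed.
End Linearize.

Section Canonical.
Variables (k : fieldType) (D : linCat k).

(** The identity of [X], read as a morphism to [Y] when the two objects are
    equal. Being total, it makes coherence maps between propositionally equal
    objects into ordinary matrix entries, free of transports. *)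
Definition canon (X Y : D) : lhom X Y :=
  if pselect (X = Y) is left e then castH (fun x y : D => lhom x y) erefl e (lid X) else 0.

Lemma canon_id (X : D) : canon X X = lid X.
Proof. by rewrite /canon; case: pselect => // e; rewrite castH_id. Qed.

Lemma canon_comp (X Y Z : D) : X = Y \/ Y = Z -> canon Y Z \v canon X Y = canon X Z.
Proof. by case=> e; [rewrite e|rewrite -e]; rewrite canon_id ?vcomp1l ?vcomp1r. Qed.

Lemma tot_canonl (X Y Z : D) (a : lhom X Y) : Y = Z ->
  tot (H := fun x y : D => lhom x y) (canon Y Z \v a) = tot (H := fun x y : D => lhom x y) a.
Proof. by move=> <-; rewrite canon_id vcomp1l. Qed.
Lemma tot_canonr (X Y Z : D) (a : lhom Y Z) : X = Y ->
  tot (H := fun x y : D => lhom x y) (a \v canon X Y) = tot (H := fun x y : D => lhom x y) a.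
Proof. by move=> ->; rewrite canon_id vcomp1r. Qed.

(** A matrix of scalars, acting through the canonical morphisms. All structure
    maps on direct sums are of this form, and identities between them become
    identities between scalar matrices. *)
Definition cmat (X Y : fsum D) (c : 'I_(fsn Y) -> 'I_(fsn X) -> k) : add_hom X Y :=
  mat (fun i j => c i j *: canon (X j) (Y i)).

(** Nonzero coefficients occur only between equal objects; without this,
    products of scalar matrices are not respected. *)
Definition supported (X Y : fsum D) (c : 'I_(fsn Y) -> 'I_(fsn X) -> k) : Prop :=
  forall i j, c i j <> 0 -> X j = Y i.

Lemma cmat_id (X : fsum D) : cmat (fun i j => (i == j)%:R) = add_id X.
Proof.
apply: mat_ext => i j; rewrite {1}/entry /cmat /mat /=; have [->|ne] := eqVneq i j.
  by rewrite canon_id scale1r add_id_diag.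
by rewrite scale0r add_id_off // eq_sym.
Qed.

Lemma cmat_ext (X Y : fsum D) (c d : 'I_(fsn Y) -> 'I_(fsn X) -> k) :
  (forall i j, c i j = d i j) -> cmat c = cmat d.
Proof. by move=> e; apply: mat_ext => i j; rewrite /cmat /entry /mat e. Qed.

Lemma cmat_comp (X Y Z : fsum D) (c : 'I_(fsn Z) -> 'I_(fsn Y) -> k)
    (d : 'I_(fsn Y) -> 'I_(fsn X) -> k) :
  supported c \/ supported d ->
  add_comp (cmat c) (cmat d) = cmat (fun i j => \sum_l c i l * d l j).
Proof.
move=> sup; apply: mat_ext => i j; rewrite {1}/entry /add_comp /mat /=.
rewrite /entry /cmat /mat /= scaler_suml; apply: eq_bigr => l _.
rewrite vcompZl vcompZr scalerA; have [->|/eqP cn] := eqVneq (c i l) 0.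
  by rewrite mul0r !scale0r.
have [->|/eqP dn] := eqVneq (d l j) 0; first by rewrite mulr0 !scale0r.
by rewrite canon_comp //; case: sup => h; [right|left]; apply: h.
Qed.

Lemma cmat_sum (X Y : fsum D) (I : finType) (c : I -> 'I_(fsn Y) -> 'I_(fsn X) -> k) :
  \sum_l cmat (c l) = cmat (fun i j => \sum_l c l i j).
Proof.
apply: mat_ext => i j; rewrite {2}/entry /cmat /mat /= scaler_suml.
have ev : linear (fun a : add_hom X Y => entry a i j) by [].
by rewrite (linear_fsum ev).
Qed.
End Canonical.

Lemma sum_delta (k : pzRingType) (I : finType) (f : I -> k) (m : I) :
  \sum_l f l * (l == m)%:R = f m.
Proof.
rewrite (bigD1 m) //= eqxx mulr1 big1 ?addr0 // => l /negbTE->.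
by rewrite mulr0.
Qed.
Lemma sum_delta' (k : pzRingType) (I : finType) (f : I -> k) (m : I) :
  \sum_l f l * (m == l)%:R = f m.
Proof. by under eq_bigr => l _ do rewrite eq_sym; exact: sum_delta. Qed.

Section AdditiveClosure.
Variables (k : fieldType) (D : linCat k).
Let E := additive_closure D.

Lemma additive_closure_finite_dim :
  finite_dimensional_homs D -> finite_dimensional_homs E.
Proof. by move=> fd X Y; apply: finite_dim_dprod => ij; exact: fd. Qed.

(** The direct sum of the [X i] is indexed by an enumeration of the disjoint
    union of their index sets; injections and projections are 0-1 matrices. *)
Lemma additive_closure_additive : is_additive E.
Proof.
move=> n X; pose T : finType := {i : 'I_n & 'I_(fsn (X i))}.
pose rk i (j : 'I_(fsn (X i))) : 'I_#|T| := enum_rank (Tagged (fun i => 'I_(fsn (X i))) j).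
pose S : fsum D := FSum (fun p : 'I_#|T| => X (tag (enum_val p)) (tagged (enum_val p))).
have Srk i j : S (@rk i j) = X i j by rewrite /= enum_rankK.
pose ci i (p : 'I_(fsn S)) j : k := (p == @rk i j)%:R.
have sup i : @supported k D (X i) S (ci i).
  by move=> p j; rewrite /ci; case: eqP => // -> _; rewrite Srk.
have sup' i : @supported k D S (X i) (fun j p => ci i p j).
  by move=> j p /sup ->.
exists S, (fun i => @cmat k D (X i) S (ci i)), (fun i => @cmat k D S (X i) (fun j p => ci i p j)).
have PI i i' : add_comp (@cmat k D S (X i) (fun j p => ci i p j)) (@cmat k D (X i') S (ci i'))
    = cmat (fun j j' => (@rk i j == @rk i' j')%:R).
  rewrite cmat_comp; last by left; exact: sup'.
  apply: cmat_ext => j j'; rewrite /ci.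
  under eq_bigr => l _ do rewrite mulrC eq_sym.
  by rewrite (sum_delta (fun l => (@rk i' j' == l)%:R)) eq_sym.
split.
- move=> i; rewrite [LHS]PI -[RHS]cmat_id; apply: cmat_ext => j j'.
  by rewrite /rk (inj_eq enum_rank_inj) -tag_eqE /tag_eq /= eqxx tagged_asE.
- move=> i i' ne; rewrite [LHS]PI; apply: mat_ext => j j'; rewrite /cmat /entry /mat /=.
  rewrite /rk (inj_eq enum_rank_inj) -tag_eqE /tag_eq /= (negbTE ne).
  by rewrite scale0r.
- rewrite -[RHS]cmat_id.
  rewrite (eq_bigr (fun i => @cmat k D S S (fun p q => \sum_l ci i p l * ci i q l))); last first.
    by move=> i _; apply: cmat_comp; left; exact: sup.
  rewrite cmat_sum; apply: cmat_ext => p q; rewrite /ci.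
  rewrite (sig_big_dep xpredT (fun _ _ => true) (fun i j => (p == @rk i j)%:R * (q == @rk i j)%:R)) /=.
  rewrite -(sum_delta' (fun l => (p == l)%:R) q) [RHS](reindex (@enum_rank T)) /=.
    by apply: eq_bigr => -[i j].
  exact: onW_bij (@enum_rank_bij T).
Qed.

Definition single (X : D) : fsum D := FSum (fun _ : 'I_1 => X).

Lemma additive_closure_generated : finitely_generated D -> finitely_generated E.
Proof.
move=> [I [G gen]].
(* A direct sum is generated through each of its summands, included by inj and
   prj; morphisms between single objects are the 1 x 1 matrices one. *)
pose J (X : D) := projT1 (cid (gen X)).
pose c X : J X -> I := projT1 (cid (projT2 (cid (gen X)))).
pose r X : forall l, lhom X (G (c X l)) := projT1 (cid (projT2 (cid (projT2 (cid (gen X)))))).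
pose s X : forall l, lhom (G (c X l)) X :=
  projT1 (cid (projT2 (cid (projT2 (cid (projT2 (cid (gen X)))))))).
have e X : \sum_l s X l \v r X l = lid X.
  exact: (projT2 (cid (projT2 (cid (projT2 (cid (projT2 (cid (gen X))))))))).
exists I, (fun i => single (G i) : E) => X.
exists {i : 'I_(fsn X) & J (X i)}, (fun u => c (X (tag u)) (tagged u)).
pose inj i : @lhom k E (single (X i)) X := @cmat k D (single (X i)) X (fun i' _ => (i' == i)%:R).
pose prj i : @lhom k E X (single (X i)) := @cmat k D X (single (X i)) (fun _ i' => (i' == i)%:R).
pose one (Y Z : D) (a : lhom Y Z) : @lhom k E (single Y) (single Z) :=
  @mat k D (single Y) (single Z) (fun _ _ => a).
exists (fun u => one _ _ (r (X (tag u)) (tagged u)) \v prj (tag u)).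
exists (fun u => inj (tag u) \v one _ _ (s (X (tag u)) (tagged u))).
rewrite -(sig_big_dep xpredT (fun _ _ => true) (fun i l =>
  (inj i \v one _ _ (s (X i) l)) \v (one _ _ (r (X i) l) \v prj i))) /=.
transitivity (\sum_i inj i \v prj i); last first.
  rewrite -[RHS]cmat_id.
  rewrite (eq_bigr (fun i => @cmat k D X X (fun p q => \sum_(l < 1) (p == i)%:R * (q == i)%:R))); last first.
    by move=> i _; apply: cmat_comp; left=> i' j'; case: eqP => // ->.
  rewrite cmat_sum; apply: cmat_ext => i j.
  under eq_bigr => l _ do rewrite big_ord1.
  by rewrite (sum_delta' (fun l => (i == l)%:R)) eq_sym.
apply: eq_bigr => i _.
transitivity (inj i \v (\sum_l (one _ _ (s (X i) l) \v one _ _ (r (X i) l))) \v prj i).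
  rewrite lcomp_sumr lcomp_suml; apply: eq_bigr => l _.
  by rewrite (vcompA (inj i)); exact: (@vcompA k E).
suff -> : \sum_l (one _ _ (s (X i) l) \v one _ _ (r (X i) l)) = lid (single (X i) : E).
  by rewrite vcomp1r.
apply: mat_ext => p q; rewrite !ord1 [RHS](@add_id_diag k D (single (X i)) 0) -e.
have ev : linear (fun a : add_hom (single (X i)) (single (X i)) => entry a 0 0) by [].
rewrite (linear_fsum ev); apply: eq_bigr => l _.
by rewrite /= /add_comp {1}/entry /mat /= big_ord1.
Qed.
End AdditiveClosure.

(** * Finitarity of linear hulls and of the bar construction *)

Section LinearHull.
Variables (k : fieldType) (C : fin2Cat).

Lemma linear_hull_homs (i j : linear_hull k C) : finitary_category (hcat i j).
Proof.
apply: karoubi_finitary.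
- exact: additive_closure_additive.
- exact: (additive_closure_finite_dim (@linearize_finite_dim k (fhcat i j))).
- exact: (additive_closure_generated (@linearize_generated k (fhcat i j))).
Qed.

Lemma linear_hull_prefinitary : prefinitary (linear_hull k C).
Proof.
split; last exact: linear_hull_homs.
by exists #|fob C|, (fun i => enum_val i) => i; exists (enum_rank i); exact: enum_rankK.
Qed.
End LinearHull.

Section BarHoms.
Variables (k : fieldType) (C : lin2Cat k) (s t : bar_ob C).
Notation H := (hcat (bob s) (bob t)).

(** The 1-morphisms of [bar C] are those of [C], and projecting 2-morphisms to
    the eps-components is a functor. All structure on [bar C] is transported
    along it. *)
Definition bar_in (F G : H) (a : lhom F G) : bar_hom F G :=
  in_im _ (ex_intro _ a erefl).

Lemma bar_in_imval (F G : H) (a : bar_hom F G) : bar_in (imval a) = a.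
Proof.
apply: imval_inj; apply: imval_fix => u; apply: tot2_inj; rewrite tot_bproj.
exact: etrans (tot2_h erefl (bprojr (bar_in u))) (bprojl (bar_in u)).
Qed.
Lemma bar_in_linear (F G : H) : linear (@bar_in F G).
Proof. by move=> c a b; apply: imval_inj; exact: bproj_lin. Qed.
Lemma bar_in_id (F : H) : bar_in (lid F) = lid (F : bar_hcat s t).
Proof. exact: imval_inj. Qed.
Lemma bar_in_comp (F G K : H) (b : lhom G K) (a : lhom F G) :
  (bar_in b : @lhom k (bar_hcat s t) _ _) \v bar_in a = bar_in (b \v a).
Proof. by apply: imval_inj; exact: bproj_comp. Qed.

Lemma bar_homs_finitary :
  is_additive H -> finite_dimensional_homs H -> finitely_generated H ->
  finitary_category (karoubi (bar_hcat s t)).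
Proof.
move=> ad fd [I [Y gen]].
have bar0 (F G : H) : bar_in (0 : lhom F G) = 0.
  exact: (linear_f0 (@bar_in_linear F G)).
have barS (F G : H) (T : finType) (a : T -> lhom F G) : bar_in (\sum_i a i) = \sum_i bar_in (a i).
  exact: (linear_fsum (@bar_in_linear F G)).
apply: karoubi_finitary.
- move=> m X; have [S [inj [prj [h1 h2 h3]]]] := ad m X.
  exists S, (fun i => bar_in (inj i)), (fun i => bar_in (prj i)); split.
  + by move=> i; rewrite bar_in_comp h1 bar_in_id.
  + by move=> i j ne; rewrite bar_in_comp h2 // bar0.
  + by rewrite -bar_in_id -h3 barS; apply: eq_bigr => i _; rewrite bar_in_comp.
- move=> F F'; apply: (finite_dim_image (@bar_in_linear F F')); last exact: fd.
  by move=> a; exists (imval a); rewrite bar_in_imval.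
- exists I, Y => X; have [J [c [r [q e]]]] := gen X.
  exists J, c, (fun l => bar_in (r l)), (fun l => bar_in (q l)).
  by rewrite -bar_in_id -e barS; apply: eq_bigr => l _; rewrite bar_in_comp.
Qed.
End BarHoms.

Section IdentityEndomorphisms.
Variables (k : fieldType) (C : lin2Cat k).
Let L := hlaws C.

(** Eckmann-Hilton. *)
Lemma one_comm (i : C) (a b : lhom (one1 i) (one1 i)) : a \v b = b \v a.
Proof.
apply: tot2_inj; transitivity (tot2 (a \h b)).
  have -> : a \h b = (a \h lid _) \v (lid _ \h b).
    by rewrite (hcomp_interchange L) vcomp1l vcomp1r.
  by apply: tot2_v; apply/esym; [exact: tot2_r|exact: tot2_l].
have -> : a \h b = (lid _ \h b) \v (a \h lid _).
  by rewrite (hcomp_interchange L) vcomp1l vcomp1r.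
by apply: tot2_v; [exact: tot2_l|exact: tot2_r].
Qed.

(** Multiplying by an idempotent splits a primitive [a] into two orthogonal
    parts, one of which vanishes; applied to [e] and to [f] this shows that
    [e \v f] is zero or equal to both. *)
Lemma primitive_orthogonal (i : C) (e f : lhom (one1 i) (one1 i)) :
  primitive_idempotent e -> primitive_idempotent f -> e <> f -> e \v f = 0.
Proof.
have key (a b : lhom (one1 i) (one1 i)) : primitive_idempotent a -> b \v b = b ->
    a \v b = 0 \/ a \v b = a.
  move=> [aa _ pa] bb; pose b' := lid (one1 i) - b.
  have bb' : b' \v b' = b'.
    by rewrite /b' vcompDl vcomp1l vcompNl vcompDr vcomp1r vcompNr bb subrr subr0.
  have bob' : b \v b' = 0 by rewrite /b' vcompDr vcompNr vcomp1r bb subrr.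
  have sq c : c \v c = c -> (a \v c) \v (a \v c) = a \v c.
    by move=> cc; rewrite -vcompA (vcompA c) (one_comm c) -vcompA cc vcompA aa.
  have o (c d : lhom (one1 i) (one1 i)) : c \v d = 0 -> (a \v c) \v (a \v d) = 0.
    by move=> cd; rewrite -vcompA (vcompA c) (one_comm c) -vcompA cd !lcomp0r.
  have sum : a = a \v b + a \v b' by rewrite -vcompDr /b' addrC subrK vcomp1r.
  have [h|h] := pa _ _ (sq _ bb) (sq _ bb') (o _ _ bob') (o _ _ (etrans (one_comm _ _) bob')) sum.
    by left.
  by right; rewrite [RHS]sum h addr0.
move=> pe pf ne; have [ee _ _] := pe; have [ff _ _] := pf.
have [//|h] := key _ _ pe ff; have [h'|h'] := key _ _ pf ee.
  by rewrite one_comm.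
by case: ne; rewrite -h one_comm h'.
Qed.

Lemma bar_ob_ext (s t : bar_ob C) (e : bob s = bob t) :
  ecast i (lhom (one1 i) (one1 i)) e (beps s) = beps t -> s = t.
Proof.
case: s t e => [i a pa] [j b pb] /= e; destruct e => /= eab; destruct eab.
by rewrite (Prop_irrelevance pa pb).
Qed.

(** Distinct primitive idempotents of the commutative algebra of endomorphisms
    of an identity 1-morphism are orthogonal, hence linearly independent. *)
Lemma finitely_many_primitive (i : C) : finite_dim (lhom (one1 i) (one1 i)) ->
  exists (n : nat) (e : 'I_n -> lhom (one1 i) (one1 i)),
    (forall j, primitive_idempotent (e j)) /\
    forall a, primitive_idempotent a -> exists j, e j = a.
Proof.
move=> fd; have [m hm] := orthogonal_idempotents_bound fd.
pose P n := exists e : 'I_n -> lhom (one1 i) (one1 i),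
  (forall j, primitive_idempotent (e j)) /\ injective e.
have [||n [[e [pe ie]] mx]] := @bounded_max P m.
- by exists 0%N, (fun _ => lid _); split; [case|case].
- move=> n [e [pe ie]]; apply: (hm _ e); split=> [j|j|j l ne].
  + by have [] := pe j.
  + by have [] := pe j.
  + by apply: primitive_orthogonal => // /ie/eqP; rewrite (negbTE ne).
exists n, e; split=> // a pa; apply: contrapT => /forallNP no; apply: mx.
exists (fun j : 'I_n.+1 => if unlift ord0 j is Some j' then e j' else a); split=> [j|j l].
  by case: unliftP.
case: unliftP => [j' ->|->]; case: unliftP => [l' ->|->] //.
- by move=> /ie->.
- by move=> h; case: (no j').
- by move=> h; case: (no l').
Qed.

Lemma finitely_many_bar_ob :
  prefinitary C -> exists (n : nat) (f : 'I_n -> bar_ob C), forall s, exists x, f x = s.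
Proof.
move=> [[m [g hg]] fin].
have fp i : exists (n : nat) (e : 'I_n -> lhom (one1 (g i)) (one1 (g i))),
    (forall j, primitive_idempotent (e j)) /\ forall a, primitive_idempotent a -> exists j, e j = a.
  by apply: finitely_many_primitive; have [_ _ _ _ fd] := fin (g i) (g i); exact: fd.
pose n i := projT1 (cid (fp i)).
pose e i : 'I_(n i) -> lhom (one1 (g i)) (one1 (g i)) := projT1 (cid (projT2 (cid (fp i)))).
have he i := projT2 (cid (projT2 (cid (fp i)))).
pose T : finType := {i : 'I_m & 'I_(n i)}.
pose f (u : T) : bar_ob C := BarOb ((he (tag u)).1 (tagged u)).
exists #|T|, (fun p => f (enum_val p)) => s; have [i ei] := hg (bob s).
case: s ei => [o a pa] /= ei; destruct ei; have [j ej] := (he i).2 a pa.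
exists (enum_rank (Tagged (fun i => 'I_(n i)) j)); rewrite enum_rankK.
exact: (@bar_ob_ext (f (Tagged (fun i => 'I_(n i)) j)) (BarOb pa) erefl ej).
Qed.
End IdentityEndomorphisms.

Section OverlineFinitary.
Variables (k : fieldType) (C : lin2Cat k).

(** The identity of (i, eps) is the image of eps, so that its decompositions
    are decompositions of eps into orthogonal idempotents. *)
Lemma overline_one_indecomposable (s : overline C) : indecomposable (one1 s).
Proof.
have [ee nz prim] := bepsP s.
have eid : imval (imval (lid (one1 s))) = beps s.
  apply: tot2_inj; exact: (tot_bar_one s).
split.
  by move=> /(congr1 (fun a => imval (imval a))) h; apply: nz; rewrite -eid h.
move=> Y [inj [prj [h1 h2 h3]]].
pose p i : lhom (one1 (bob s)) (one1 (bob s)) := imval (imval (inj i \v prj i)).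
have pp i : p i \v p i = p i.
  exact: (congr1 (fun a => imval (imval a)) (retract_idem (h1 i))).
have po i j : i != j -> p i \v p j = 0.
  move=> ne; have : (inj i \v prj i) \v (inj j \v prj j) = 0.
    by rewrite -vcompA (vcompA (prj i)) h2 // lcomp0l lcomp0r.
  by move/(congr1 (fun a => imval (imval a))).
have ps : beps s = p 0 + p 1.
  rewrite -eid -h3 big_ord_recl big_ord1.
  have -> : lift ord0 ord0 = 1 :> 'I_2 by apply: val_inj.
  by [].
have z i : p i = 0 -> is_zero (Y i).
  move=> pi; rewrite /is_zero -h1 -(vcomp1r (inj i)) -h1 !vcompA -(vcompA (prj i)).
  have -> : inj i \v prj i = 0 by do 2 apply: imval_inj.
  by rewrite lcomp0r lcomp0l.
by have [] := prim _ _ (pp 0) (pp 1) (po 0 1 isT) (po 1 0 isT) ps => /z; [exists 0|exists 1].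
Qed.

Theorem overline_finitary :
  prefinitary C -> (forall i j : C, finitely_generated (hcat i j)) ->
  finitary (overline C).
Proof.
move=> pre gen; split; last exact: overline_one_indecomposable.
split; first exact: finitely_many_bar_ob.
move=> s t; have [ad _ _ _ fd] := pre.2 (bob s) (bob t).
exact: bar_homs_finitary.
Qed.
End OverlineFinitary.

Lemma linear_hull_generated (k : fieldType) (C : fin2Cat) (i j : linear_hull k C) :
  finitely_generated (hcat i j).
Proof.
exact: (karoubi_generated (additive_closure_generated (@linearize_generated k (fhcat i j)))).
Qed.

(** * Linear hulls of ordered monoids *)

Section NotFiat.
Variable k : fieldType.

Lemma scalar_indecomposable (D : linCat k) (X : D) :
  lid X <> 0 -> (forall a : lhom X X, exists c, a = c *: lid X) -> indecomposable X.
Proof.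
move=> nz sc; split=> // Y [inj [prj [h1 h2 h3]]].
have z i : inj i \v prj i = 0 -> is_zero (Y i).
  move=> pi; rewrite /is_zero -h1 -(vcomp1r (inj i)) -h1 !vcompA -(vcompA (prj i)).
  by rewrite pi lcomp0r lcomp0l.
have [c hc] := sc (inj 0 \v prj 0); have [d hd] := sc (inj 1 \v prj 1).
have : (inj 0 \v prj 0) \v (inj 1 \v prj 1) = 0.
  by rewrite -vcompA (vcompA (prj 0)) h2 // lcomp0l lcomp0r.
rewrite {1}hc {1}hd vcompZl vcompZr vcomp1l scalerA => /eqP.
rewrite scaler_eq0 => /orP[|/eqP//]; rewrite mulf_eq0 => /orP[] /eqP e.
  by exists 0; apply: z; rewrite hc e scale0r.
by exists 1; apply: z; rewrite hd e scale0r.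
Qed.

Lemma delta_neq0 (A : finType) (a : A) : delta k a <> 0.
Proof.
move=> /(congr1 (fun u : {ffun A -> k^o} => u a)); rewrite !ffunE eqxx => /eqP.
by rewrite oner_eq0.
Qed.

Section Hull.
Variable C : fin2Cat.
Let H := linear_hull k C.

Definition hull_in (i j : C) (F : fhcat i j) : @hcat k H i j :=
  @KObj k (additive_closure (linearize k (fhcat i j))) (@single k (linearize k (fhcat i j)) F)
    (@lid k (additive_closure (linearize k (fhcat i j))) (@single k (linearize k (fhcat i j)) F)) (vcomp1l _).

(** A 2-morphism between two elements of [C] in the hull is a 1 x 1 matrix;
    this is its entry. *)
Definition hull_coef (i j : C) (F G : fhcat i j) (a : lhom (hull_in F) (hull_in G)) :
  fcomb k (fhom F G) :=
  @entry k (linearize k (fhcat i j)) (@single k (linearize k (fhcat i j)) F)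
    (@single k (linearize k (fhcat i j)) G) (imval a) 0 0.

Lemma hull_coef_inj (i j : C) (F G : fhcat i j) : injective (@hull_coef i j F G).
Proof.
move=> a b e; apply: imval_inj; apply: mat_ext => p q.
rewrite (ord1 (p : 'I_1)) (ord1 (q : 'I_1)); exact: e.
Qed.

Lemma hull_coef_id (i j : C) (F : fhcat i j) : hull_coef (lid (hull_in F)) = delta k (fid F).
Proof.
have e := @add_id_diag k (linearize k (fhcat i j)) (@single k (linearize k (fhcat i j)) F) 0.
exact: etrans e _.
Qed.

Lemma hull_in_nz (i j : C) (F : fhcat i j) : lid (hull_in F) <> 0.
Proof. by move=> /(congr1 (@hull_coef i j F F)); rewrite hull_coef_id; exact: delta_neq0. Qed.

(** The endomorphisms of the identity 1-morphism are then the scalars. *)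
Lemma hull_finitary :
  (forall (i : C) (a : fhom (fone i) (fone i)), a = fid (fone i)) -> finitary H.
Proof.
move=> triv; split; first exact: linear_hull_prefinitary.
move=> i; rewrite -/(hull_in (fone i)).
have -> : one1 i = hull_in (fone i) by apply: kobj_ext.
apply: scalar_indecomposable; first exact: hull_in_nz.
move=> a; exists ((hull_coef a : {ffun _ -> k^o}) (fid (fone i))).
apply: hull_coef_inj; transitivity (((hull_coef a : {ffun _ -> k^o}) (fid (fone i)) : k) *: delta k (fid (fone i))).
  rewrite {1}[hull_coef a]fcombE (bigD1 (fid (fone i))) //= big1 ?addr0 //.
  by move=> b; rewrite (triv _ b) eqxx.
by rewrite -hull_coef_id.
Qed.

(** A left adjoint F admits a nonzero unit into G F for some G, which is a
    matrix of combinations of 2-morphisms from the identity to composites of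
    F. *)
Lemma hull_not_fiat (i : C) (F : fhcat i i) :
  (forall G : fhcat i i, fhom (fone i) (fcomp1 G F) -> False) -> ~ fiat H.
Proof.
move=> no [_ [S h]]; have [eta [eps [h1 _]]] := h i i (hull_in F).
have e0 : eta = 0.
  apply: imval_inj; apply: mat_ext => p q; rewrite [LHS](@fcombE k).
  rewrite big1 //= => a; case: (no _ a).
apply: (@hull_in_nz i i F); rewrite -h1 e0 hcomp0r /cast2.
rewrite (linear_f0 (castH_linear (H := fun x y : @hcat k H i i => lhom x y) _ _)).
exact: lcomp0r.
Qed.
End Hull.
End NotFiat.

Section OrderedMonoidHulls.
Variable k : fieldType.

Lemma ord_hull_finitary (S : ordMonoid) : finitary (linear_hull k (ord_2cat S)).
Proof. by apply: hull_finitary => i a; exact: ord_hom_eq. Qed.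

Lemma ord_hull_not_fiat (S : ordMonoid) (s : S) :
  (forall t : S, ~~ om_le (om_one S) (om_mul t s)) -> ~ fiat (linear_hull k (ord_2cat S)).
Proof.
move=> h; apply: (@hull_not_fiat k (ord_2cat S) tt s) => t a.
by have := valP a; rewrite /= (negbTE (h t)).
Qed.

Lemma IS_not_fiat (n : nat) : (0 < n)%N -> ~ fiat (linear_hull k (ord_2cat (IS_ordMonoid n))).
Proof.
move=> n0; have h0 : partial_bijection (set0 : brel n).
  by apply/pbijP => z x z' x'; rewrite inE.
apply: (@ord_hull_not_fiat (IS_ordMonoid n) (exist (fun a : brel n => partial_bijection a) _ h0)) => t.
apply/negP => /(natural_leP (@KIS_inj n) (@KIS_mul n) (@KIS_fun n) (@KIS_cofun n) (@KIS_inv n)) h.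
have x : 'I_n := Ordinal n0.
have /KIS_mul[y hy _] := h x x (iffRL (KIS_one x x) erefl).
by rewrite inE in hy.
Qed.

(** A labelling that is constant on the parts of the one-part partition is
    constant, whereas the identity relates every labelling to itself. *)
Lemma Fstar_not_fiat (n : nat) : (1 < n)%N -> ~ fiat (linear_hull k (ord_2cat (F_ordMonoid n))).
Proof.
move=> n1; pose P : {set {set 'I_n + 'I_n}} := [set setT].
have P_same z w : same_part P z w by apply/same_partP; exists setT; rewrite !inE.
have x0 : 'I_n := Ordinal (ltnW n1).
have partP : partition P setT.
  apply/and3P; split; first by rewrite /cover big_set1.
    by apply/trivIsetP => A B /set1P-> /set1P->; rewrite eqxx.
  by rewrite inE; apply/eqP/setP => /(_ (inl x0)); rewrite !inE.
have PP : isPP P.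
  rewrite /isPP partP; apply/(propagatingP partP).
  by split=> x; exists x; exact: P_same.
have fP : factorizable P.
  apply/factorizableP; split=> //; exists 1%g => f g c.
  by apply/const_perm => x; exact: (c (inl x) (inr _)).
apply: (@ord_hull_not_fiat (F_ordMonoid n) (exist (fun P => factorizable P) _ fP)) => t.
apply/negP => /(natural_leP (@KF_inj n) (@KF_mul n) (@KF_fun n) (@KF_cofun n) (@KF_inv n)) h.
pose f : {ffun 'I_n -> bool} := [ffun x => val x == 0%N].
have /KF_mul[g hg _] := h f f (iffRL (KF_one f f) erefl).
have := hg (inl (Ordinal (ltnW n1))) (inl (Ordinal n1)) (P_same _ _).
by rewrite /= !ffunE.
Qed.
End OrderedMonoidHulls.

(** * Dualities and fiat 2-categories *)

Section Duality.
Variables (k : fieldType) (C : linSemi2Cat k).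

(** The data making a 2-category fiat, in a form that survives all
    constructions below. It differs from a weak anti-involution with adjunctions
    in three respects. Equations between 2-morphisms with propositionally equal
    ends compare total pairs, so that no transport appears. Since horizontal
    composition in [bar C] does not preserve identities, [adj_mul] is invertible
    only up to the 2-morphisms [lid G \h lid F]. Finally, [adj2] is required to
    be the identity on 2-endomorphisms of identity 1-morphisms
    ([adj_one_nat]), so that it fixes the idempotents defining [bar C], and to
    send a 2-morphism to its mate ([counit_nat], [coev_nat]), so that adjunctions
    restrict to images of idempotents. *)
Record duality := Duality {
  adj : forall i j : C, hcat i j -> hcat j i;
  adj2 : forall (i j : C) (F G : hcat i j), lhom F G -> lhom (adj G) (adj F);
  adj2_linear : forall (i j : C) (F G : hcat i j), linear (@adj2 i j F G);
  adj2_id : forall (i j : C) (F : hcat i j), adj2 (lid F) = lid (adj F);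
  adj2_comp : forall (i j : C) (F G H : hcat i j) (b : lhom G H) (a : lhom F G),
    adj2 (b \v a) = adj2 a \v adj2 b;
  adj_mul : forall (i j l : C) (G : hcat j l) (F : hcat i j),
    lhom (adj F \c adj G) (adj (G \c F));
  adj_mulV : forall (i j l : C) (G : hcat j l) (F : hcat i j),
    lhom (adj (G \c F)) (adj F \c adj G);
  adj_mulK : forall (i j l : C) (G : hcat j l) (F : hcat i j),
    adj_mulV G F \v adj_mul G F = lid (adj F) \h lid (adj G);
  adj_mulVK : forall (i j l : C) (G : hcat j l) (F : hcat i j),
    adj_mul G F \v adj_mulV G F = adj2 (lid G \h lid F);
  adj_mul_absorb : forall (i j l : C) (G : hcat j l) (F : hcat i j),
    adj_mul G F \v (lid (adj F) \h lid (adj G)) = adj_mul G F;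
  adj_mul_nat : forall (i j l : C) (G G' : hcat j l) (F F' : hcat i j)
    (b : lhom G G') (a : lhom F F'),
    adj2 (b \h a) \v adj_mul G' F' = adj_mul G F \v (adj2 a \h adj2 b);
  adj_one : forall i : C, lhom (one1 i) (adj (one1 i));
  adj_oneV : forall i : C, lhom (adj (one1 i)) (one1 i);
  adj_oneK : forall i : C, adj_oneV i \v adj_one i = lid (one1 i);
  adj_oneVK : forall i : C, adj_one i \v adj_oneV i = lid (adj (one1 i));
  adj_one_nat : forall (i : C) (a : lhom (one1 i) (one1 i)),
    adj2 a \v adj_one i = adj_one i \v a;
  adj_mulA : forall (i j l m : C) (H : hcat l m) (G : hcat j l) (F : hcat i j),
    tot2 (adj_mul H (G \c F) \v (adj_mul G F \h lid (adj H))) =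
    tot2 (adj_mul (H \c G) F \v (lid (adj F) \h adj_mul H G));
  adj_mul1l : forall (i j : C) (F : hcat i j),
    tot2 (adj_mul (one1 j) F \v (lid (adj F) \h adj_one j)) = tot2 (lid (adj F));
  adj_mul1r : forall (i j : C) (F : hcat i j),
    tot2 (adj_mul F (one1 i) \v (adj_one i \h lid (adj F))) = tot2 (lid (adj F));
  bidual : forall (i j : C) (F : hcat i j), lhom F (adj (adj F));
  bidualV : forall (i j : C) (F : hcat i j), lhom (adj (adj F)) F;
  bidualK : forall (i j : C) (F : hcat i j), bidualV F \v bidual F = lid F;
  bidualVK : forall (i j : C) (F : hcat i j), bidual F \v bidualV F = lid (adj (adj F));
  bidual_nat : forall (i j : C) (F G : hcat i j) (a : lhom F G),
    adj2 (adj2 a) \v bidual F = bidual G \v a;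
  bidual_mul : forall (i j l : C) (G : hcat j l) (F : hcat i j),
    adj2 (adj_mul G F) \v bidual (G \c F) =
    adj_mul (adj F) (adj G) \v (bidual G \h bidual F);
  bidual_one : forall i : C, adj2 (adj_one i) \v bidual (one1 i) = adj_one i;
  counit : forall (i j : C) (F : hcat i j), lhom (F \c adj F) (one1 j);
  coev : forall (i j : C) (F : hcat i j), lhom (one1 i) (adj F \c F);
  counit_absorb : forall (i j : C) (F : hcat i j),
    counit F \v (lid F \h lid (adj F)) = counit F;
  coev_absorb : forall (i j : C) (F : hcat i j),
    (lid (adj F) \h lid F) \v coev F = coev F;
  counit_nat : forall (i j : C) (F G : hcat i j) (a : lhom F G),
    counit G \v (a \h lid (adj G)) = counit F \v (lid F \h adj2 a);
  coev_nat : forall (i j : C) (F G : hcat i j) (a : lhom F G),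
    (adj2 a \h lid G) \v coev G = (lid (adj F) \h a) \v coev F;
  triangle_l : forall (i j : C) (F M : hcat i j) (E : lhom M F) (H : lhom F M),
    tot2 E = tot2 (counit F \h lid F) -> tot2 H = tot2 (lid F \h coev F) ->
    E \v H = lid F;
  triangle_r : forall (i j : C) (F : hcat i j) (M : hcat j i)
    (E : lhom M (adj F)) (H : lhom (adj F) M),
    tot2 E = tot2 (lid (adj F) \h counit F) -> tot2 H = tot2 (coev F \h lid (adj F)) ->
    E \v H = lid (adj F) }.
End Duality.

Section FiatOfDuality.
Variables (k : fieldType) (C : lin2Cat k) (S : duality C).

Lemma adj_weak_anti_involution : exists W : weak_anti_involution C,
  forall (i j : C) (F : hcat i j), star W F = adj S F.
Proof.
unshelve eexists; first unshelve econstructor.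
- exact: (adj S).
- exact: (adj2 S).
- exact: (@adj_mul _ _ S).
- exact: (adj_one S).
- exact: (@bidual _ _ S).
- exact: adj2_linear.
- exact: adj2_id.
- exact: adj2_comp.
- move=> i j l G F; exists (adj_mulV S G F).
  by rewrite adj_mulK adj_mulVK !hcomp_id adj2_id.
- exact: adj_mul_nat.
- by move=> i; exists (adj_oneV S i); rewrite adj_oneK adj_oneVK.
- by move=> i j l m H G F; apply: tot2_inj; rewrite !tot2_cast adj_mulA.
- by move=> i j F; apply: tot2_inj; rewrite tot2_cast adj_mul1l.
- by move=> i j F; apply: tot2_inj; rewrite tot2_cast adj_mul1r.
- by move=> i j F; exists (bidualV S F); rewrite bidualK bidualVK.
- exact: bidual_nat.
- exact: bidual_mul.
- exact: bidual_one.
- by [].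
Qed.

(** When identities are preserved, the relaxed laws of a duality are the laws of
    a weak anti-involution with adjunctions. *)
Theorem fiat_of_duality : finitary C -> fiat C.
Proof.
split=> //; have [W e] := adj_weak_anti_involution.
exists W => i j F; rewrite e; exists (coev S F), (counit S F); split.
  by apply: (triangle_l (d := S)); rewrite tot2_cast.
by apply: (triangle_r (d := S)); rewrite tot2_cast.
Qed.
End FiatOfDuality.

(** * Duality on idempotent completions *)

Section SemiTheory.
Variables (k : fieldType) (C : linSemi2Cat k).
Let L := hlaws C.

Lemma interchange (i j l : C) (G G' G'' : hcat j l) (F F' F'' : hcat i j)
    (b' : lhom G' G'') (b : lhom G G') (a' : lhom F' F'') (a : lhom F F') :
  (b' \h a') \v (b \h a) = (b' \v b) \h (a' \v a).
Proof. exact: hcomp_interchange L _ _ _ _ _ _ _ _ _ _ _ _ _. Qed.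

(** A 2-morphism can be given prescribed ends equal to its own. The triangle
    identities compose 2-morphisms whose ends agree only up to associativity and
    unit laws; copies with matching ends replace explicit transports. *)
Lemma tot2_copy (i j : C) (F G F' G' : hcat i j) (a : lhom F G) :
  F = F' -> G = G' -> exists b : lhom F' G', tot2 b = tot2 a.
Proof. by move=> <- <-; exists a. Qed.

Lemma tot2_tgt (i j : C) (F G F' G' : hcat i j) (a : lhom F G) (b : lhom F' G') :
  tot2 a = tot2 b -> G = G'.
Proof. exact: (@tot_tgt _ (fun x y : hcat i j => lhom x y)). Qed.
Lemma tot2_src (i j : C) (F G F' G' : hcat i j) (a : lhom F G) (b : lhom F' G') :
  tot2 a = tot2 b -> F = F'.
Proof. exact: (@tot_src _ (fun x y : hcat i j => lhom x y)). Qed.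
End SemiTheory.

Section KaroubiDuality.
Variables (k : fieldType) (C : linSemi2Cat k) (S : duality C).
Let L := hlaws C.
Let K := kar2_semi C.

Definition kar_of (i j : C) (X Y : @hcat k K i j) (a : lhom (kob X) (kob Y))
  (h : kproj a = a) : @lhom k (@hcat k K i j) X Y := in_im _ (ex_intro _ a (esym h)).

Lemma kprojP (i j : C) (X Y : @hcat k K i j) (a : lhom (kob X) (kob Y)) :
  kidem Y \v a = a -> a \v kidem X = a -> kproj a = a.
Proof. by rewrite /kproj => h1 ->. Qed.

Lemma tot2_imval (i j : C) (X Y X' Y' : @hcat k K i j) (a : lhom X Y) (b : lhom X' Y') :
  tot2 a = tot2 b -> tot2 (imval a) = tot2 (imval b).
Proof. by case/(@tot_castE _ (fun X Y : @hcat k K i j => lhom X Y)) => eX [eY <-]; destruct eX, eY. Qed.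

Lemma tot2_kar (i j : C) (X Y X' Y' : @hcat k K i j) (a : lhom X Y) (b : lhom X' Y') :
  X = X' -> Y = Y' -> tot2 (imval a) = tot2 (imval b) -> tot2 a = tot2 b.
Proof. by move=> eX eY; destruct eX, eY => /tot2_inj/imval_inj->. Qed.

Lemma kadj_subproof (i j : C) (X : @hcat k K i j) :
  adj2 S (kidem X) \v adj2 S (kidem X) = adj2 S (kidem X).
Proof. by rewrite -adj2_comp kidemP. Qed.
(** The dual of the image of [e] is the image of the dual idempotent. *)
Definition kadj (i j : C) (X : @hcat k K i j) : @hcat k K j i := KObj (kadj_subproof X).

Fact kadj2_subproof (i j : C) (X Y : @hcat k K i j) (a : lhom X Y) :
  @kproj _ _ (kadj Y) (kadj X) (adj2 S (imval a)) = adj2 S (imval a).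
Proof. by apply: kprojP; rewrite /= -adj2_comp ?kfixr ?kfixl. Qed.
Definition kadj2 (i j : C) (X Y : @hcat k K i j) (a : lhom X Y) : lhom (kadj Y) (kadj X) :=
  kar_of (kadj2_subproof a).

Let nat (i j l : C) (G : @hcat k K j l) (F : @hcat k K i j) :
  adj2 S (kidem G \h kidem F) \v adj_mul S (kob G) (kob F) =
  adj_mul S (kob G) (kob F) \v (adj2 S (kidem F) \h adj2 S (kidem G)).
Proof. exact: adj_mul_nat. Qed.

Fact kmul_subproof (i j l : C) (G : @hcat k K j l) (F : @hcat k K i j) :
  @kproj _ _ (kar2_comp1 (kadj F) (kadj G)) (kadj (kar2_comp1 G F))
    (adj_mul S (kob G) (kob F) \v (adj2 S (kidem F) \h adj2 S (kidem G))) =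
  adj_mul S (kob G) (kob F) \v (adj2 S (kidem F) \h adj2 S (kidem G)).
Proof.
apply: kprojP; rewrite /= ?vcompA ?nat -?vcompA interchange -!adj2_comp ?kidemP //.
Qed.
(** Composing [adj_mul] with the idempotents on its source gives a morphism
    which, by naturality, is also fixed by the idempotent on its target. *)
Definition kmul (i j l : C) (G : @hcat k K j l) (F : @hcat k K i j) := kar_of (kmul_subproof G F).

Fact kmulV_subproof (i j l : C) (G : @hcat k K j l) (F : @hcat k K i j) :
  @kproj _ _ (kadj (kar2_comp1 G F)) (kar2_comp1 (kadj F) (kadj G))
    ((adj2 S (kidem F) \h adj2 S (kidem G)) \v adj_mulV S (kob G) (kob F)
       \v adj2 S (kidem G \h kidem F)) =
  (adj2 S (kidem F) \h adj2 S (kidem G)) \v adj_mulV S (kob G) (kob F)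
       \v adj2 S (kidem G \h kidem F).
Proof.
apply: kprojP; rewrite /=.
  by rewrite !vcompA interchange -!adj2_comp !kidemP.
by rewrite -!vcompA -!adj2_comp interchange !kidemP.
Qed.
Definition kmulV (i j l : C) (G : @hcat k K j l) (F : @hcat k K i j) := kar_of (kmulV_subproof G F).

Lemma kmulK (i j l : C) (G : @hcat k K j l) (F : @hcat k K i j) :
  kmulV G F \v kmul G F = lid (kadj F) \h lid (kadj G).
Proof.
apply: imval_inj; rewrite /= -!vcompA (vcompA (adj2 S _)) nat.
rewrite (vcompA (adj_mulV S _ _)) (vcompA (adj_mulV S _ _)) adj_mulK.
by rewrite !interchange !vcomp1l -!adj2_comp !kidemP.
Qed.

Lemma kmulVK (i j l : C) (G : @hcat k K j l) (F : @hcat k K i j) :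
  kmul G F \v kmulV G F = kadj2 (lid G \h lid F).
Proof.
apply: imval_inj; rewrite /= -!vcompA (vcompA (_ \h _) (_ \h _)) interchange -!adj2_comp !kidemP.
rewrite vcompA -nat -vcompA (vcompA (adj_mul S _ _)) adj_mulVK.
by rewrite -!adj2_comp !interchange !vcomp1r !kidemP.
Qed.

Lemma kmul_absorb (i j l : C) (G : @hcat k K j l) (F : @hcat k K i j) :
  kmul G F \v (lid (kadj F) \h lid (kadj G)) = kmul G F.
Proof. by apply: imval_inj; rewrite /= -vcompA interchange -!adj2_comp !kidemP. Qed.

Lemma kmul_nat (i j l : C) (G G' : @hcat k K j l) (F F' : @hcat k K i j)
    (b : lhom G G') (a : lhom F F') :
  kadj2 (b \h a) \v kmul G' F' = kmul G F \v (kadj2 a \h kadj2 b).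
Proof.
apply: imval_inj; rewrite /= vcompA adj_mul_nat -!vcompA !interchange -!adj2_comp.
by rewrite !kfixl !kfixr.
Qed.

Fact kone_subproof (i : C) :
  @kproj _ _ (kar2_one i) (kadj (kar2_one i)) (adj_one S i) = adj_one S i.
Proof. by apply: kprojP; rewrite /= ?adj2_id ?vcomp1l ?vcomp1r. Qed.
Definition kone (i : C) := kar_of (kone_subproof i).
Fact koneV_subproof (i : C) :
  @kproj _ _ (kadj (kar2_one i)) (kar2_one i) (adj_oneV S i) = adj_oneV S i.
Proof. by apply: kprojP; rewrite /= ?adj2_id ?vcomp1l ?vcomp1r. Qed.
Definition koneV (i : C) := kar_of (koneV_subproof i).

Lemma koneVK (i : C) : kone i \v koneV i = lid (kadj (kar2_one i)).
Proof. by apply: imval_inj; rewrite /= adj_oneVK adj2_id. Qed.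

Lemma kmulA (i j l m : C) (H : @hcat k K l m) (G : @hcat k K j l) (F : @hcat k K i j) :
  tot2 (kmul H (kar2_comp1 G F) \v (kmul G F \h lid (kadj H))) =
  tot2 (kmul (kar2_comp1 H G) F \v (lid (kadj F) \h kmul H G)).
Proof.
apply: tot2_kar.
- exact/esym/(@kar2_A k C).
- by congr kadj; exact: (@kar2_A k C).
have -> : imval (kmul H (kar2_comp1 G F) \v (kmul G F \h lid (kadj H))) =
    (adj_mul S (kob H) (kob G \c kob F) \v (adj_mul S (kob G) (kob F) \h lid (adj S (kob H))))
    \v ((adj2 S (kidem F) \h adj2 S (kidem G)) \h adj2 S (kidem H)).
  rewrite /= -!vcompA !interchange vcompA nat -!vcompA !interchange -!adj2_comp !kidemP vcomp1l //.
have -> : imval (kmul (kar2_comp1 H G) F \v (lid (kadj F) \h kmul H G)) =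
    (adj_mul S (kob H \c kob G) (kob F) \v (lid (adj S (kob F)) \h adj_mul S (kob H) (kob G)))
    \v (adj2 S (kidem F) \h (adj2 S (kidem G) \h adj2 S (kidem H))).
  rewrite /= -!vcompA !interchange vcompA nat -!vcompA !interchange -!adj2_comp !kidemP vcomp1l //.
by apply: tot2_v; [exact: adj_mulA|apply/esym; exact: tot2_A].
Qed.

Lemma kmul1l (i j : C) (F : @hcat k K i j) :
  tot2 (kmul (kar2_one j) F \v (lid (kadj F) \h kone j)) = tot2 (lid (kadj F)).
Proof.
apply: tot2_kar.
- exact: (@kar2_r k C).
- by congr kadj; exact: (@kar2_l k C).
have -> : imval (kmul (kar2_one j) F \v (lid (kadj F) \h kone j)) =
    (adj_mul S (one1 j) (kob F) \v (lid _ \h adj_one S j)) \v (adj2 S (kidem F) \h lid (one1 j)).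
  by rewrite /= -!vcompA !interchange -!adj2_comp !kidemP adj2_id !vcomp1l vcomp1r.
rewrite [RHS](_ : _ = tot2 (lid (adj S (kob F)) \v adj2 S (kidem F))); last by rewrite vcomp1l.
by apply: tot2_v; [exact: adj_mul1l|exact: tot2_r].
Qed.

Lemma kmul1r (i j : C) (F : @hcat k K i j) :
  tot2 (kmul F (kar2_one i) \v (kone i \h lid (kadj F))) = tot2 (lid (kadj F)).
Proof.
apply: tot2_kar.
- exact: (@kar2_l k C).
- by congr kadj; exact: (@kar2_r k C).
have -> : imval (kmul F (kar2_one i) \v (kone i \h lid (kadj F))) =
    (adj_mul S (kob F) (one1 i) \v (adj_one S i \h lid _)) \v (lid (one1 i) \h adj2 S (kidem F)).
  by rewrite /= -!vcompA !interchange -!adj2_comp !kidemP adj2_id !vcomp1l vcomp1r.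
rewrite [RHS](_ : _ = tot2 (lid (adj S (kob F)) \v adj2 S (kidem F))); last by rewrite vcomp1l.
by apply: tot2_v; [exact: adj_mul1r|exact: tot2_l].
Qed.

Fact kbid_subproof (i j : C) (F : @hcat k K i j) :
  @kproj _ _ F (kadj (kadj F)) (bidual S (kob F) \v kidem F) = bidual S (kob F) \v kidem F.
Proof. by apply: kprojP; rewrite /= ?vcompA ?bidual_nat -?vcompA ?kidemP. Qed.
Definition kbid (i j : C) (F : @hcat k K i j) := kar_of (kbid_subproof F).
Fact kbidV_subproof (i j : C) (F : @hcat k K i j) :
  @kproj _ _ (kadj (kadj F)) F (kidem F \v bidualV S (kob F) \v adj2 S (adj2 S (kidem F))) =
  kidem F \v bidualV S (kob F) \v adj2 S (adj2 S (kidem F)).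
Proof. by apply: kprojP; rewrite /= ?vcompA ?kidemP // -!vcompA -!adj2_comp !kidemP. Qed.
Definition kbidV (i j : C) (F : @hcat k K i j) := kar_of (kbidV_subproof F).

Lemma kbidK (i j : C) (F : @hcat k K i j) : kbidV F \v kbid F = lid F.
Proof.
apply: imval_inj; rewrite /= -!vcompA (vcompA (adj2 S _)) bidual_nat.
by rewrite -(vcompA (bidual S _)) kidemP (vcompA (bidualV S _)) bidualK vcomp1l kidemP.
Qed.
Lemma kbidVK (i j : C) (F : @hcat k K i j) : kbid F \v kbidV F = lid (kadj (kadj F)).
Proof.
apply: imval_inj; rewrite /= !vcompA -(vcompA _ (kidem F) (kidem F)) kidemP -bidual_nat.
by rewrite -(vcompA _ (bidual S _)) bidualVK vcomp1r -!adj2_comp !kidemP.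
Qed.

Lemma kbid_mul (i j l : C) (G : @hcat k K j l) (F : @hcat k K i j) :
  kadj2 (kmul G F) \v kbid (kar2_comp1 G F) =
  kmul (kadj F) (kadj G) \v (kbid G \h kbid F).
Proof.
apply: imval_inj; rewrite /= vcompA adj2_comp -(vcompA (adj2 S (_ \h _))) bidual_mul.
rewrite -!vcompA !interchange !(vcompA (adj2 S _) (adj_mul S _ _)) adj_mul_nat -!vcompA !interchange.
by [].
Qed.

Fact kcounit_subproof (i j : C) (F : @hcat k K i j) :
  @kproj _ _ (kar2_comp1 F (kadj F)) (kar2_one j)
    (counit S (kob F) \v (kidem F \h adj2 S (kidem F))) =
  counit S (kob F) \v (kidem F \h adj2 S (kidem F)).
Proof. by apply: kprojP; rewrite /= ?vcomp1l // -vcompA interchange -adj2_comp !kidemP. Qed.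
Definition kcounit (i j : C) (F : @hcat k K i j) := kar_of (kcounit_subproof F).
Fact kcoev_subproof (i j : C) (F : @hcat k K i j) :
  @kproj _ _ (kar2_one i) (kar2_comp1 (kadj F) F)
    ((adj2 S (kidem F) \h kidem F) \v coev S (kob F)) =
  (adj2 S (kidem F) \h kidem F) \v coev S (kob F).
Proof. by apply: kprojP; rewrite /= ?vcomp1r // vcompA interchange -adj2_comp !kidemP. Qed.
Definition kcoev (i j : C) (F : @hcat k K i j) := kar_of (kcoev_subproof F).

(** By naturality the idempotent acts on only one factor. *)
Lemma kcounitE (i j : C) (F : @hcat k K i j) :
  counit S (kob F) \v (kidem F \h adj2 S (kidem F)) =
  counit S (kob F) \v (kidem F \h lid (adj S (kob F))).
Proof.
have -> : kidem F \h adj2 S (kidem F) = (lid _ \h adj2 S (kidem F)) \v (kidem F \h lid _).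
  by rewrite interchange vcomp1l vcomp1r.
by rewrite vcompA -counit_nat -vcompA interchange kidemP vcomp1l.
Qed.
Lemma kcounitE' (i j : C) (F : @hcat k K i j) :
  counit S (kob F) \v (kidem F \h adj2 S (kidem F)) =
  counit S (kob F) \v (lid (kob F) \h adj2 S (kidem F)).
Proof. by rewrite kcounitE counit_nat. Qed.
Lemma kcoevE (i j : C) (F : @hcat k K i j) :
  (adj2 S (kidem F) \h kidem F) \v coev S (kob F) =
  (lid (adj S (kob F)) \h kidem F) \v coev S (kob F).
Proof.
have -> : adj2 S (kidem F) \h kidem F = (lid _ \h kidem F) \v (adj2 S (kidem F) \h lid _).
  by rewrite interchange vcomp1l vcomp1r.
by rewrite -vcompA coev_nat vcompA interchange kidemP vcomp1l.
Qed.
Lemma kcoevE' (i j : C) (F : @hcat k K i j) :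
  (adj2 S (kidem F) \h kidem F) \v coev S (kob F) =
  (adj2 S (kidem F) \h lid (kob F)) \v coev S (kob F).
Proof. by rewrite kcoevE coev_nat. Qed.

Lemma kcounit_nat (i j : C) (F G : @hcat k K i j) (a : lhom F G) :
  kcounit G \v (a \h lid (kadj G)) = kcounit F \v (lid F \h kadj2 a).
Proof.
apply: imval_inj; rewrite /= -!vcompA !interchange -!adj2_comp !kidemP kfixl kfixr.
have -> : imval a \h adj2 S (kidem G) = (imval a \h lid _) \v (lid _ \h adj2 S (kidem G)).
  by rewrite interchange vcomp1l vcomp1r.
have -> : kidem F \h adj2 S (imval a) = (kidem F \h lid _) \v (lid _ \h adj2 S (imval a)).
  by rewrite interchange vcomp1l vcomp1r.
by rewrite !vcompA !counit_nat -!vcompA !interchange -!adj2_comp kfixl kfixr.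
Qed.

Lemma kcoev_nat (i j : C) (F G : @hcat k K i j) (a : lhom F G) :
  (kadj2 a \h lid G) \v kcoev G = (lid (kadj F) \h a) \v kcoev F.
Proof.
apply: imval_inj; rewrite /= !vcompA !interchange -!adj2_comp !kidemP kfixl kfixr.
have -> : adj2 S (imval a) \h kidem G = (lid _ \h kidem G) \v (adj2 S (imval a) \h lid _).
  by rewrite interchange vcomp1l vcomp1r.
have -> : adj2 S (kidem F) \h imval a = (lid _ \h imval a) \v (adj2 S (kidem F) \h lid _).
  by rewrite interchange vcomp1l vcomp1r.
by rewrite -!vcompA !coev_nat !vcompA !interchange kfixl kfixr vcomp1l.
Qed.

(** The idempotents in the unit and counit are moved outwards past the triangle
    of [C]: those on the first and last factors come out directly, and those on
    the middle factor are first exchanged for them by naturality. *)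
Lemma ktriangle_l (i j : C) (F M : @hcat k K i j) (E : lhom M F) (H : lhom F M) :
  tot2 E = tot2 (kcounit F \h lid F) -> tot2 H = tot2 (lid F \h kcoev F) ->
  E \v H = lid F.
Proof.
move=> /tot2_imval hE /tot2_imval hH; apply: imval_inj.
set f := kidem F; set c := counit S (kob F); set d := coev S (kob F).
(* E0 and H0 are the two sides of the triangle of C; U and V apply f to the
   first and to the last factor of F F' F. *)
have eM : kob F \c adj S (kob F) \c kob F = kob M := esym (tot2_src hE).
have eA : kob F \c (adj S (kob F) \c kob F) = kob M by rewrite (comp1A L).
have [E0 hE0] := tot2_copy (c \h lid (kob F)) eM (comp1l L (kob F)).
have [H0 hH0] := tot2_copy (lid (kob F) \h d) (comp1r L (kob F)) eA.
have [U hU] := tot2_copy ((f \h lid (adj S (kob F))) \h lid (kob F)) eM eM.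
have [V hV] := tot2_copy (lid (kob F) \h (lid (adj S (kob F)) \h f)) eA eA.
have eE : imval E = f \v (E0 \v U).
  apply: tot2_inj; rewrite [LHS]hE /= kcounitE -/f -/c.
  have -> : (c \v (f \h lid (adj S (kob F)))) \h kidem F =
      (lid (one1 j) \h f) \v ((c \h lid _) \v ((f \h lid (adj S (kob F))) \h lid _)).
    by rewrite !interchange vcomp1l !vcomp1r.
  by apply: tot2_v; [exact: tot2_l|apply: tot2_v].
have eH : imval H = V \v (H0 \v f).
  apply: tot2_inj; rewrite [LHS]hH /= kcoevE -/f -/d.
  have -> : kidem F \h ((lid (adj S (kob F)) \h f) \v d) =
      (lid _ \h (lid (adj S (kob F)) \h f)) \v ((lid _ \h d) \v (f \h lid (one1 i))).
    by rewrite !interchange !vcomp1l vcomp1r.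
  by apply: tot2_v; [|apply: tot2_v; last exact: tot2_r].
have UV : U \v V = V \v U.
  apply: tot2_inj.
  have hU' : tot2 U = tot2 (f \h (lid (adj S (kob F)) \h lid (kob F))) by rewrite hU tot2_A.
  have hV' : tot2 V = tot2 ((lid (kob F) \h lid (adj S (kob F))) \h f) by rewrite hV tot2_A.
  transitivity (tot2 ((f \h lid (adj S (kob F))) \h f)).
    rewrite (tot2_v hU hV') interchange vcomp1l; congr tot2; congr (_ \h _).
    by rewrite interchange vcomp1l vcomp1r.
  rewrite -tot2_A (tot2_v hV hU') interchange vcomp1l; congr tot2; congr (_ \h _).
  by rewrite interchange vcomp1l vcomp1r.
have EV : E0 \v V = f \v E0.
  apply: tot2_inj.
  have hV' : tot2 V = tot2 ((lid (kob F) \h lid (adj S (kob F))) \h f) by rewrite hV tot2_A.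
  rewrite (tot2_v hE0 hV') interchange vcomp1l counit_absorb.
  have -> : c \h f = (lid (one1 j) \h f) \v (c \h lid _) by rewrite interchange vcomp1l vcomp1r.
  by apply: tot2_v; [exact: tot2_l|].
have UH : U \v H0 = H0 \v f.
  apply: tot2_inj.
  have hU' : tot2 U = tot2 (f \h (lid (adj S (kob F)) \h lid (kob F))) by rewrite hU tot2_A.
  rewrite (tot2_v hU' hH0) interchange vcomp1r coev_absorb.
  have -> : f \h d = (lid _ \h d) \v (f \h lid (one1 i)) by rewrite interchange vcomp1l vcomp1r.
  by apply: tot2_v; [|exact: tot2_r].
have tri : E0 \v H0 = lid (kob F) by exact: (triangle_l hE0 hH0).
rewrite [LHS](_ : _ = imval E \v imval H) // eE eH.
rewrite -!vcompA (vcompA U) UV -!vcompA (vcompA U) UH (vcompA E0) EV -!vcompA.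
by rewrite (vcompA E0) tri vcomp1l !kidemP.
Qed.

Lemma ktriangle_r (i j : C) (F : @hcat k K i j) (M : @hcat k K j i)
    (E : lhom M (kadj F)) (H : lhom (kadj F) M) :
  tot2 E = tot2 (lid (kadj F) \h kcounit F) -> tot2 H = tot2 (kcoev F \h lid (kadj F)) ->
  E \v H = lid (kadj F).
Proof.
move=> /tot2_imval hE /tot2_imval hH; apply: imval_inj.
set f := adj2 S (kidem F); set c := counit S (kob F); set d := coev S (kob F).
set G := adj S (kob F).
have ff : f \v f = f by rewrite -adj2_comp kidemP.
have eM : G \c (kob F \c G) = kob M := esym (tot2_src hE).
have eA : (G \c kob F) \c G = kob M by rewrite -(comp1A L).
have [E0 hE0] := tot2_copy (lid G \h c) eM (comp1r L G).
have [H0 hH0] := tot2_copy (d \h lid G) (comp1l L G) eA.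
have [U hU] := tot2_copy (lid G \h (lid (kob F) \h f)) eM eM.
have [V hV] := tot2_copy ((f \h lid (kob F)) \h lid G) eA eA.
have eE : imval E = f \v (E0 \v U).
  apply: tot2_inj; rewrite [LHS]hE /= kcounitE' -/f -/c.
  have -> : f \h (c \v (lid (kob F) \h f)) =
      (f \h lid (one1 j)) \v ((lid G \h c) \v (lid G \h (lid (kob F) \h f))).
    by rewrite !interchange !vcomp1l vcomp1r.
  by apply: tot2_v; [exact: tot2_r|apply: tot2_v].
have eH : imval H = V \v (H0 \v f).
  apply: tot2_inj; rewrite [LHS]hH /= kcoevE' -/f -/d.
  have -> : ((f \h lid (kob F)) \v d) \h f =
      ((f \h lid (kob F)) \h lid G) \v ((d \h lid G) \v (lid (one1 i) \h f)).
    by rewrite !interchange !vcomp1l vcomp1r.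
  by apply: tot2_v; [|apply: tot2_v; last exact: tot2_l].
have hU' : tot2 U = tot2 ((lid G \h lid (kob F)) \h f) by rewrite hU tot2_A.
have hV' : tot2 V = tot2 (f \h (lid (kob F) \h lid G)) by rewrite hV tot2_A.
have UV : U \v V = V \v U.
  apply: tot2_inj; transitivity (tot2 (f \h (lid (kob F) \h f))).
    rewrite (tot2_v hU hV') interchange vcomp1l; congr tot2; congr (_ \h _).
    by rewrite interchange vcomp1l vcomp1r.
  rewrite tot2_A (tot2_v hV hU') interchange vcomp1l; congr tot2; congr (_ \h _).
  by rewrite interchange vcomp1l vcomp1r.
have EV : E0 \v V = f \v E0.
  apply: tot2_inj; rewrite (tot2_v hE0 hV') interchange vcomp1l counit_absorb.
  have -> : f \h c = (f \h lid (one1 j)) \v (lid G \h c) by rewrite interchange vcomp1l vcomp1r.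
  by apply: tot2_v; [exact: tot2_r|].
have UH : U \v H0 = H0 \v f.
  apply: tot2_inj; rewrite (tot2_v hU' hH0) interchange vcomp1r coev_absorb.
  have -> : d \h f = (d \h lid G) \v (lid (one1 i) \h f) by rewrite interchange vcomp1l vcomp1r.
  by apply: tot2_v; [|exact: tot2_l].
have tri : E0 \v H0 = lid G by exact: (triangle_r hE0 hH0).
rewrite [LHS](_ : _ = imval E \v imval H) // eE eH.
rewrite -!vcompA (vcompA U) UV -!vcompA (vcompA U) UH (vcompA E0) EV -!vcompA.
by rewrite (vcompA E0) tri vcomp1l !ff.
Qed.

Definition karoubi_duality : duality K.
Proof.
apply: (@Duality k K kadj kadj2 _ _ _ kmul kmulV kmulK kmulVK kmul_absorb kmul_nat
  kone koneV _ koneVK _ kmulA kmul1l kmul1r kbid kbidV kbidK kbidVK _ kbid_mul _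
  kcounit kcoev _ _ kcounit_nat kcoev_nat ktriangle_l ktriangle_r).
- by move=> i j F G c a b; apply: imval_inj; exact: adj2_linear.
- by move=> i j F; apply: imval_inj.
- by move=> i j F G H b a; apply: imval_inj; exact: adj2_comp.
- by move=> i; apply: imval_inj; exact: adj_oneK.
- by move=> i a; apply: imval_inj; exact: adj_one_nat.
- by move=> i j F G a; apply: imval_inj; rewrite /= vcompA bidual_nat -!vcompA kfixl kfixr.
- by move=> i; apply: imval_inj; rewrite /= vcomp1r; exact: bidual_one.
- by move=> i j F; apply: imval_inj; rewrite /= -vcompA interchange -adj2_comp !kidemP.
- by move=> i j F; apply: imval_inj; rewrite /= vcompA interchange -adj2_comp !kidemP.
Defined.
End KaroubiDuality.

(** * Duality on the bar construction *)

Section IdentityAction.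
Variables (k : fieldType) (C : lin2Cat k).
Let L := hlaws C.

Lemma tot2_lid (i j : C) (F F' : hcat i j) : F = F' -> tot2 (lid F) = tot2 (lid F').
Proof. by move=> ->. Qed.
Lemma tot2_vr (i j : C) (W X Y Z : hcat i j) (b : lhom Y Z) (m : lhom W Y) :
  tot2 m = tot2 (lid X) -> tot2 (b \v m) = tot2 b.
Proof.
move=> h; have eY := tot2_tgt h; have eW := tot2_src h; destruct eY, eW.
by rewrite (tot2_inj h) vcomp1r.
Qed.
Lemma tot2_vl (i j : C) (W X Y Z : hcat i j) (b : lhom Y Z) (m : lhom Z W) :
  tot2 m = tot2 (lid X) -> tot2 (m \v b) = tot2 b.
Proof.
move=> h; have eY := tot2_tgt h; have eW := tot2_src h; destruct eY, eW.
by rewrite (tot2_inj h) vcomp1l.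
Qed.

(** The action of a 2-endomorphism of the identity on a 1-morphism from the
    left; [actr] is the action from the right. On a composite G F, acting on G
    from the right or on F from the left is the same ([act_middle]). *)
Definition actl (i j : C) (e : lhom (one1 j) (one1 j)) (F : hcat i j) : lhom F F :=
  castH (fun x y : hcat i j => lhom x y) (comp1l L F) (comp1l L F) (e \h lid F).
Definition actr (i j : C) (e : lhom (one1 i) (one1 i)) (F : hcat i j) : lhom F F :=
  castH (fun x y : hcat i j => lhom x y) (comp1r L F) (comp1r L F) (lid F \h e).

Lemma tot_actl (i j : C) (e : lhom (one1 j) (one1 j)) (F : hcat i j) :
  tot2 (actl e F) = tot2 (e \h lid F).
Proof. exact: tot2_cast. Qed.
Lemma tot_actr (i j : C) (e : lhom (one1 i) (one1 i)) (F : hcat i j) :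
  tot2 (actr e F) = tot2 (lid F \h e).
Proof. exact: tot2_cast. Qed.

Lemma actl_nat (i j : C) (e : lhom (one1 j) (one1 j)) (F G : hcat i j) (a : lhom F G) :
  a \v actl e F = actl e G \v a.
Proof.
apply: tot2_inj; transitivity (tot2 (e \h a)).
  have -> : e \h a = (lid _ \h a) \v (e \h lid F) by rewrite interchange vcomp1l vcomp1r.
  by apply: tot2_v; [exact/esym/tot2_l|exact: tot_actl].
have -> : e \h a = (e \h lid G) \v (lid _ \h a) by rewrite interchange vcomp1l vcomp1r.
by apply: tot2_v; [exact/esym/tot_actl|exact: tot2_l].
Qed.

Lemma actl_comp (i j : C) (e f : lhom (one1 j) (one1 j)) (F : hcat i j) :
  actl e F \v actl f F = actl (e \v f) F.
Proof.
apply: tot2_inj; rewrite (tot2_v (tot_actl e F) (tot_actl f F)) interchange vcomp1l.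
exact/esym/tot_actl.
Qed.

Lemma actl_comp1 (i j l : C) (e : lhom (one1 l) (one1 l)) (G : hcat j l) (F : hcat i j) :
  actl e (G \c F) = actl e G \h lid F.
Proof.
apply: tot2_inj; rewrite tot_actl -hcomp_id tot2_A; apply: tot2_h => //.
exact/esym/tot_actl.
Qed.
Lemma actr_comp1 (i j l : C) (e : lhom (one1 i) (one1 i)) (G : hcat j l) (F : hcat i j) :
  actr e (G \c F) = lid G \h actr e F.
Proof.
apply: tot2_inj; rewrite tot_actr -hcomp_id -tot2_A; apply: tot2_h => //.
exact/esym/tot_actr.
Qed.
Lemma act_middle (i j l : C) (e : lhom (one1 j) (one1 j)) (G : hcat j l) (F : hcat i j) :
  lid G \h actl e F = actr e G \h lid F.
Proof.
apply: tot2_inj; transitivity (tot2 (lid G \h (e \h lid F))).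
  by apply: tot2_h => //; exact: tot_actl.
by rewrite tot2_A; apply: tot2_h => //; exact/esym/tot_actr.
Qed.

Section Adj.
Variable S : duality C.

Lemma tot2_adj2 (i j : C) (F G F' G' : hcat i j) (a : lhom F G) (b : lhom F' G') :
  tot2 a = tot2 b -> tot2 (adj2 S a) = tot2 (adj2 S b).
Proof. by move=> h; have e1 := tot2_src h; have e2 := tot2_tgt h; destruct e1, e2; rewrite (tot2_inj h). Qed.

(** As [adj2] is the identity on 2-endomorphisms of identity 1-morphisms,
    duality exchanges the two actions. *)
Lemma adj2_actl (i j : C) (e : lhom (one1 j) (one1 j)) (F : hcat i j) :
  adj2 S (actl e F) = actr e (adj S F).
Proof.
apply: tot2_inj; rewrite (tot2_adj2 (tot_actl e F)) tot_actr.
(* By the unit law m is an identity up to transport, so composing with it is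
   harmless, while naturality of adj_mul applies to the composite. *)
pose m := adj_mul S (one1 j) F \v (lid (adj S F) \h adj_one S j).
have hm : tot2 m = tot2 (lid (adj S F)) by exact: adj_mul1l.
rewrite -(tot2_vr (adj2 S (e \h lid F)) hm) vcompA adj_mul_nat adj2_id.
rewrite -vcompA interchange adj_one_nat vcomp1l -[lid (adj S F) in X in X \h _]vcomp1l -interchange vcompA.
exact: tot2_vl hm.
Qed.
Lemma adj2_actr (i j : C) (e : lhom (one1 i) (one1 i)) (F : hcat i j) :
  adj2 S (actr e F) = actl e (adj S F).
Proof.
apply: tot2_inj; rewrite (tot2_adj2 (tot_actr e F)) tot_actl.
pose m := adj_mul S F (one1 i) \v (adj_one S i \h lid (adj S F)).
have hm : tot2 m = tot2 (lid (adj S F)) by exact: adj_mul1r.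
rewrite -(tot2_vr (adj2 S (lid F \h e)) hm) vcompA adj_mul_nat adj2_id.
rewrite -vcompA interchange adj_one_nat vcomp1l -[lid (adj S F) in X in _ \h X]vcomp1l -interchange vcompA.
exact: tot2_vl hm.
Qed.
End Adj.
End IdentityAction.

Section BarCalculus.
Variables (k : fieldType) (C : lin2Cat k).
Let L := hlaws C.
Let B := bar C.

(** The functor [bar_in], with values typed in the 2-category [bar C]. *)
Definition to_bar (s t : B) (F G : @hcat k B s t)
  (a : @lhom k (@hcat k C (bob s) (bob t)) F G) : @lhom k (@hcat k B s t) F G := bar_in a.

(** Projection to an eps-component is composition with the actions of the two
    idempotents. *)
Lemma bproj_act (s t : B) (F G : @hcat k C (bob s) (bob t)) (a : lhom F G) :
  @bproj k C s t F G a = actl (beps t) G \v a \v actr (beps s) F.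
Proof.
apply: tot2_inj; rewrite tot_bproj -vcompA.
have -> : beps t \h (a \h beps s) = (beps t \h (lid G \h lid _)) \v (lid _ \h (a \h beps s)).
  by rewrite !interchange !vcomp1l !vcomp1r.
apply: tot2_v.
  by rewrite hcomp_id (tot2_h erefl (tot2_lid (comp1r L G))); exact/esym/tot_actl.
rewrite tot2_l; have -> : a \h beps s = (a \h lid _) \v (lid _ \h beps s).
  by rewrite interchange vcomp1l vcomp1r.
by apply: tot2_v; [exact: tot2_r|exact/esym/tot_actr].
Qed.

Lemma to_barK (s t : B) (F G : @hcat k B s t) (a : lhom F G) : to_bar (imval a) = a.
Proof. exact: bar_in_imval. Qed.
Lemma to_bar_id (s t : B) (F : @hcat k B s t) : to_bar (lid (F : @hcat k C (bob s) (bob t))) = lid F.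
Proof. exact: bar_in_id. Qed.
Lemma to_bar_comp (s t : B) (F G K : @hcat k B s t)
    (b : @lhom k (@hcat k C (bob s) (bob t)) G K) (a : @lhom k (@hcat k C (bob s) (bob t)) F G) :
  to_bar b \v to_bar a = to_bar (b \v a).
Proof. exact: bar_in_comp. Qed.

Lemma beps_idem (s : B) : beps s \v beps s = beps s. Proof. by have [] := bepsP s. Qed.

Lemma actr_comp (i j : C) (e f : lhom (one1 i) (one1 i)) (F : hcat i j) :
  actr e F \v actr f F = actr (e \v f) F.
Proof.
apply: tot2_inj; rewrite (tot2_v (tot_actr e F) (tot_actr f F)) interchange vcomp1l.
exact/esym/tot_actr.
Qed.

Lemma to_bar_actl (s t : B) (F : @hcat k B s t) :
  to_bar (actl (beps t) (F : @hcat k C (bob s) (bob t))) = lid F.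
Proof.
rewrite -to_bar_id; apply: imval_inj; rewrite /= !bproj_act vcomp1r.
by rewrite actl_comp beps_idem.
Qed.
Lemma to_bar_actr (s t : B) (F : @hcat k B s t) :
  to_bar (actr (beps s) (F : @hcat k C (bob s) (bob t))) = lid F.
Proof.
rewrite -to_bar_id; apply: imval_inj; rewrite /= !bproj_act vcomp1r -vcompA.
by rewrite actr_comp beps_idem.
Qed.

Lemma tot2_to_bar (s t : B) (F G F' G' : @hcat k B s t)
    (a : @lhom k (@hcat k C (bob s) (bob t)) F G) (b : @lhom k (@hcat k C (bob s) (bob t)) F' G') :
  tot2 a = tot2 b -> tot2 (to_bar a) = tot2 (to_bar b).
Proof. by move=> h; have e1 := tot2_src h; have e2 := tot2_tgt h; destruct e1, e2; rewrite (tot2_inj h). Qed.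

(** Horizontal composition in bar C differs from that of C by the idempotent of
    the middle object. *)
Definition middle (s t u : B) (G : @hcat k C (bob t) (bob u)) (F : @hcat k C (bob s) (bob t)) :
  lhom (G \c F) (G \c F) := lid G \h actl (beps t) F.

Lemma to_bar_hcomp (s t u : B) (G G' : @hcat k B t u) (F F' : @hcat k B s t)
    (b : @lhom k (@hcat k C (bob t) (bob u)) G G') (a : @lhom k (@hcat k C (bob s) (bob t)) F F') :
  to_bar b \h to_bar a = @to_bar s u (G \c F) (G' \c F') ((b \h a) \v @middle s t u G F).
Proof.
apply: imval_inj; rewrite /= !bproj_act.
transitivity ((actl (beps u) G' \v b \v actr (beps t) G) \h (actl (beps t) F' \v a \v actr (beps s) F)).
  by [].
rewrite /middle actl_comp1 actr_comp1 -[in RHS]vcompA !interchange !vcomp1l !vcomp1r.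
have slide (X : @lhom k (@hcat k C (bob t) (bob u)) G G') (Y : @lhom k (@hcat k C (bob s) (bob t)) F F') :
    (X \v actr (beps t) G) \h Y = X \h (Y \v actl (beps t) F).
  rewrite -[Y in LHS]vcomp1r -[X in RHS]vcomp1r -!interchange; congr (_ \v _).
  exact/esym/act_middle.
rewrite slide -!vcompA; congr (_ \h _).
rewrite (actl_nat _ (actr _ _)) vcompA -[actl _ F' \v a]actl_nat -!vcompA.
by rewrite (vcompA (actl _ _)) actl_comp beps_idem.
Qed.

Lemma to_bar_middle (s t u : B) (G : @hcat k B t u) (F : @hcat k B s t) :
  lid G \h lid F = @to_bar s u (G \c F) (G \c F) (@middle s t u G F).
Proof. by rewrite -!to_bar_id to_bar_hcomp hcomp_id vcomp1l. Qed.

Lemma middle_nat (s t u : B) (G G' : @hcat k C (bob t) (bob u)) (F F' : @hcat k C (bob s) (bob t))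
    (b : lhom G G') (a : lhom F F') :
  (b \h a) \v @middle s t u G F = @middle s t u G' F' \v (b \h a).
Proof. by rewrite /middle !interchange vcomp1l vcomp1r actl_nat. Qed.

Lemma middle_idem (s t u : B) (G : @hcat k C (bob t) (bob u)) (F : @hcat k C (bob s) (bob t)) :
  @middle s t u G F \v @middle s t u G F = @middle s t u G F.
Proof. by rewrite /middle interchange vcomp1l actl_comp beps_idem. Qed.
End BarCalculus.

Section BarDuality.
Variables (k : fieldType) (C : lin2Cat k) (S : duality C).
Let L := hlaws C.
Let B := bar C.
Notation hC s t := (@hcat k C (bob s) (bob t)).
Notation mid s t u G F := (@middle k C s t u G F).

(** Duality exchanges the two idempotents of a component, so the dual of a
    1-morphism can be taken in [C]. *)
Definition badj (s t : B) (F : @hcat k B s t) : @hcat k B t s := adj S (F : hC s t).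
Definition badj2 (s t : B) (F G : @hcat k B s t) (a : lhom F G) : lhom (badj G) (badj F) :=
  @to_bar k C t s _ _ (adj2 S (imval a)).

Lemma badj2_bin (s t : B) (F G : hC s t) (a : lhom F G) :
  badj2 (@to_bar k C s t F G a) = @to_bar k C t s _ _ (adj2 S a).
Proof.
rewrite /badj2 /= bproj_act !adj2_comp adj2_actl adj2_actr -!to_bar_comp to_bar_actl to_bar_actr.
by rewrite vcomp1l vcomp1r.
Qed.

(** Duality moves the action on the middle object of G F to the middle object
    of the dual composite. *)
Lemma middle_adj2 (s t u : B) (G : hC t u) (F : hC s t) :
  adj2 S (mid s t u G F) \v adj_mul S G F = adj_mul S G F \v mid u t s (adj S F) (adj S G).
Proof. by rewrite /middle adj_mul_nat adj2_id adj2_actl act_middle. Qed.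

(** In [bar C] the composite of two 1-morphisms is not cut down by the
    idempotent of the middle object; this has to be done by [adj_mul]. *)
Definition bmul (s t u : B) (G : @hcat k B t u) (F : @hcat k B s t) :=
  @to_bar k C u s _ _ (adj_mul S (G : hC t u) (F : hC s t) \v mid u t s (adj S F) (adj S G)).
Definition bmulV (s t u : B) (G : @hcat k B t u) (F : @hcat k B s t) :=
  @to_bar k C u s _ _ (mid u t s (adj S F) (adj S G) \v adj_mulV S (G : hC t u) (F : hC s t)).

Lemma bmulK (s t u : B) (G : @hcat k B t u) (F : @hcat k B s t) :
  bmulV G F \v bmul G F = lid (badj F) \h lid (badj G).
Proof.
rewrite to_bar_comp -vcompA (vcompA (adj_mulV S _ _)) adj_mulK hcomp_id vcomp1l.
by rewrite middle_idem to_bar_middle.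
Qed.
Lemma bmulVK (s t u : B) (G : @hcat k B t u) (F : @hcat k B s t) :
  bmul G F \v bmulV G F = badj2 (lid G \h lid F).
Proof.
rewrite to_bar_middle badj2_bin to_bar_comp -vcompA (vcompA (mid _ _ _ _ _)) middle_idem.
by rewrite vcompA -middle_adj2 -vcompA adj_mulVK hcomp_id adj2_id vcomp1r.
Qed.
Lemma bmul_absorb (s t u : B) (G : @hcat k B t u) (F : @hcat k B s t) :
  bmul G F \v (lid (badj F) \h lid (badj G)) = bmul G F.
Proof. by rewrite to_bar_middle to_bar_comp -vcompA middle_idem. Qed.
Lemma bmul_nat (s t u : B) (G G' : @hcat k B t u) (F F' : @hcat k B s t)
    (b : lhom G G') (a : lhom F F') :
  badj2 (b \h a) \v bmul G' F' = bmul G F \v (badj2 a \h badj2 b).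
Proof.
rewrite -(to_barK a) -(to_barK b); set a' := imval a; set b' := imval b.
rewrite to_bar_hcomp !badj2_bin to_bar_hcomp !to_bar_comp adj2_comp.
congr to_bar; rewrite -!vcompA (vcompA (adj2 S (b' \h a'))) adj_mul_nat -!vcompA.
by rewrite (vcompA (adj2 S (mid _ _ _ _ _))) middle_adj2 -!vcompA.
Qed.

Definition bone (s : B) := @to_bar k C s s _ _ (adj_one S (bob s)).
Definition boneV (s : B) := @to_bar k C s s _ _ (adj_oneV S (bob s)).

Lemma bmulA (s t u v : B) (H : @hcat k B u v) (G : @hcat k B t u) (F : @hcat k B s t) :
  tot2 (bmul H (G \c F) \v (bmul G F \h lid (badj H))) =
  tot2 (bmul (H \c G) F \v (lid (badj F) \h bmul H G)).
Proof.
rewrite -!to_bar_id !to_bar_hcomp !to_bar_comp; apply: tot2_to_bar.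
set F' := adj S (F : hC s t); set G' := adj S (G : hC t u); set H' := adj S (H : hC u v).
rewrite -!vcompA !(vcompA (mid _ _ _ _ _)) -!middle_nat -!(vcompA (_ \h _)) !middle_idem.
rewrite /middle !interchange !vcomp1l !vcomp1r.
have -> : (adj_mul S (G : hC t u) (F : hC s t) \v (lid F' \h actl (beps t) G')) \h actl (beps u) H' =
    (adj_mul S (G : hC t u) (F : hC s t) \h lid H') \v ((lid F' \h actl (beps t) G') \h actl (beps u) H').
  by rewrite interchange vcomp1l.
have -> : lid F' \h (adj_mul S (H : hC u v) (G : hC t u) \v (lid G' \h actl (beps u) H')
      \v actl (beps t) (G' \c H')) =
    (lid F' \h adj_mul S (H : hC u v) (G : hC t u)) \v (lid F' \h (actl (beps t) G' \h actl (beps u) H')).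
  by rewrite interchange vcomp1l actl_comp1 -vcompA interchange vcomp1l vcomp1r.
rewrite !vcompA; apply: tot2_v; [exact: adj_mulA|by rewrite tot2_A].
Qed.

Lemma bmul1l (s t : B) (F : @hcat k B s t) :
  tot2 (bmul (one1 t) F \v (lid (badj F) \h bone t)) = tot2 (lid (badj F)).
Proof.
rewrite -to_bar_id to_bar_hcomp to_bar_comp to_bar_id -to_bar_actr; apply: tot2_to_bar.
set F' := adj S (F : hC s t).
rewrite -!vcompA (vcompA (mid _ _ _ _ _)) -middle_nat -(vcompA (_ \h _)) middle_idem vcompA.
transitivity (tot2 (lid F' \v actr (beps t) F')); last by rewrite vcomp1l.
apply: tot2_v; first exact: adj_mul1l.
rewrite /middle tot_actr; apply: tot2_h => //.
by rewrite tot_actl; exact: tot2_r.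
Qed.
Lemma bmul1r (s t : B) (F : @hcat k B s t) :
  tot2 (bmul F (one1 s) \v (bone s \h lid (badj F))) = tot2 (lid (badj F)).
Proof.
rewrite -to_bar_id to_bar_hcomp to_bar_comp to_bar_id -to_bar_actl; apply: tot2_to_bar.
set F' := adj S (F : hC s t).
rewrite -!vcompA (vcompA (mid _ _ _ _ _)) -middle_nat -(vcompA (_ \h _)) middle_idem vcompA.
transitivity (tot2 (lid F' \v actl (beps s) F')); last by rewrite vcomp1l.
apply: tot2_v; first exact: adj_mul1r.
rewrite /middle (tot2_l (actl _ _)) //.
Qed.

Definition bbid (s t : B) (F : @hcat k B s t) := @to_bar k C s t _ _ (bidual S (F : hC s t)).
Definition bbidV (s t : B) (F : @hcat k B s t) := @to_bar k C s t _ _ (bidualV S (F : hC s t)).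

Lemma bbid_mul (s t u : B) (G : @hcat k B t u) (F : @hcat k B s t) :
  badj2 (bmul G F) \v bbid (G \c F) = bmul (badj F) (badj G) \v (bbid G \h bbid F).
Proof.
rewrite badj2_bin to_bar_hcomp !to_bar_comp adj2_comp -(vcompA (adj2 S (mid _ _ _ _ _))).
rewrite bidual_mul (vcompA (adj2 S _)) middle_adj2; congr to_bar.
rewrite -!vcompA; congr (_ \v _).
by rewrite middle_nat (vcompA (mid _ _ _ _ _)) middle_idem.
Qed.

Definition bcounit (s t : B) (F : @hcat k B s t) :=
  @to_bar k C t t _ _ (counit S (F : hC s t) \v mid t s t F (adj S F)).
Definition bcoev (s t : B) (F : @hcat k B s t) :=
  @to_bar k C s s _ _ (mid s t s (adj S F) F \v coev S (F : hC s t)).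

Lemma bcounit_nat (s t : B) (F G : @hcat k B s t) (a : lhom F G) :
  bcounit G \v (a \h lid (badj G)) = bcounit F \v (lid F \h badj2 a).
Proof.
rewrite -(to_barK a) -!to_bar_id badj2_bin !to_bar_hcomp !to_bar_comp; congr to_bar.
rewrite -!vcompA !(vcompA (mid _ _ _ _ _)) -!middle_nat -!(vcompA (_ \h _)) !middle_idem.
by rewrite !vcompA counit_nat.
Qed.
Lemma bcoev_nat (s t : B) (F G : @hcat k B s t) (a : lhom F G) :
  (badj2 a \h lid G) \v bcoev G = (lid (badj F) \h a) \v bcoev F.
Proof.
rewrite -(to_barK a) -!to_bar_id badj2_bin !to_bar_hcomp !to_bar_comp; congr to_bar.
rewrite -!vcompA !(vcompA (mid _ _ _ _ _)) !middle_idem !vcompA !middle_nat -!vcompA.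
by rewrite coev_nat.
Qed.

(** The composite of unit and counit contains the idempotents of both middle
    objects. They slide outwards, where the idempotents of the source and target
    act as identities in [bar C], and leave the triangle of [C]. *)
Lemma btriangle_l (s t : B) (F M : @hcat k B s t) (E : lhom M F) (H : lhom F M) :
  tot2 E = tot2 (bcounit F \h lid F) -> tot2 H = tot2 (lid F \h bcoev F) ->
  E \v H = lid F.
Proof.
rewrite -!to_bar_id !to_bar_hcomp => hE hH.
pose F0 : hC s t := F; pose M0 : hC s t := M; pose F' := adj S F0.
(* E0 and H0 are the two sides of the triangle of C; T1 and T2 are the actions
   of beps s and beps t on the middle objects of F F' F. *)
set c := counit S F0 in hE; set d := coev S F0 in hH.
have eM : F0 \c F' \c F0 = M0 := esym (tot2_src hE).
have eA : F0 \c (F' \c F0) = M0 by rewrite (comp1A L).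
have [E0 hE0] := tot2_copy (c \h lid F0) eM (comp1l L F0).
have [H0 hH0] := tot2_copy (lid F0 \h d) (comp1r L F0) eA.
have [T1 hT1] := tot2_copy (mid t s t F0 F' \h lid F0) eM eM.
have [T2 hT2] := tot2_copy (mid s t t (F0 \c F') F0) eM eM.
have hT1' : tot2 T1 = tot2 (actr (beps s) F0 \h lid (F' \c F0)).
  by rewrite hT1 /middle act_middle -hcomp_id tot2_A.
have hT2' : tot2 T2 = tot2 (lid F0 \h mid s t s F' F0).
  by rewrite hT2 /middle -hcomp_id tot2_A.
have eE : E = @to_bar k C s t _ _ (E0 \v T1 \v T2).
  apply: tot2_inj; rewrite hE; apply: tot2_to_bar.
  have -> : (c \v mid t s t F0 F') \h lid F0 = (c \h lid F0) \v (mid t s t F0 F' \h lid F0).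
    by rewrite interchange vcomp1l.
  by apply: tot2_v => //; apply: tot2_v.
have eH : H = @to_bar k C s t _ _ (T2 \v (H0 \v actr (beps s) F0)).
  apply: tot2_inj; rewrite hH; apply: tot2_to_bar.
  have -> : lid F0 \h (mid s t s F' F0 \v d) = (lid F0 \h mid s t s F' F0) \v (lid F0 \h d).
    by rewrite interchange vcomp1l.
  rewrite -vcompA; apply: tot2_v => //; apply: tot2_v => //.
  rewrite /middle tot_actr; apply: tot2_h => //; rewrite tot_actl; exact: tot2_r.
have E2 : E0 \v T2 = actl (beps t) F0 \v E0.
  apply: tot2_inj; rewrite (tot2_v hE0 hT2) /middle interchange vcomp1r vcomp1l.
  have -> : c \h actl (beps t) F0 = (lid _ \h actl (beps t) F0) \v (c \h lid F0).
    by rewrite interchange vcomp1l vcomp1r.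
  by apply: tot2_v => //; exact: tot2_l.
have H1 : T1 \v H0 = H0 \v actr (beps s) F0.
  apply: tot2_inj; rewrite (tot2_v hT1' hH0) interchange vcomp1r vcomp1l.
  have -> : actr (beps s) F0 \h d = (lid F0 \h d) \v (actr (beps s) F0 \h lid _).
    by rewrite interchange vcomp1l vcomp1r.
  by apply: tot2_v => //; exact: tot2_r.
have T12 : T1 \v T2 = T2 \v T1.
  by apply: tot2_inj; rewrite (tot2_v hT1 hT2) (tot2_v hT2 hT1) /middle !interchange !vcomp1l !vcomp1r.
have tri : E0 \v H0 = lid F0 by exact: (triangle_l hE0 hH0).
have key : (E0 \v T1 \v T2) \v (T2 \v (H0 \v actr (beps s) F0)) =
    actl (beps t) F0 \v actl (beps t) F0 \v (actr (beps s) F0 \v actr (beps s) F0).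
  rewrite -(vcompA E0) T12 -!vcompA (vcompA T1) T12 -!vcompA (vcompA T1 H0) H1.
  rewrite (vcompA E0) E2 -!vcompA (vcompA E0) E2 -!vcompA (vcompA E0 H0) tri vcomp1l //.
rewrite eE eH to_bar_comp key -!to_bar_comp.
by rewrite to_bar_actl to_bar_actr !vcomp1l to_bar_id.
Qed.

Lemma btriangle_r (s t : B) (F : @hcat k B s t) (M : @hcat k B t s)
    (E : lhom M (badj F)) (H : lhom (badj F) M) :
  tot2 E = tot2 (lid (badj F) \h bcounit F) -> tot2 H = tot2 (bcoev F \h lid (badj F)) ->
  E \v H = lid (badj F).
Proof.
rewrite -!to_bar_id !to_bar_hcomp => hE hH.
pose F0 : hC s t := F; pose M0 : hC t s := M; pose F' : hC t s := adj S F0.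
set c := counit S F0 in hE; set d := coev S F0 in hH.
have eM : F' \c (F0 \c F') = M0 := esym (tot2_src hE).
have eA : (F' \c F0) \c F' = M0 by rewrite -(comp1A L).
have [E0 hE0] := tot2_copy (lid F' \h c) eM (comp1r L F').
have [H0 hH0] := tot2_copy (d \h lid F') (comp1l L F') eA.
have [T1 hT1] := tot2_copy (lid F' \h mid t s t F0 F') eM eM.
have [T2 hT2] := tot2_copy (mid t t s F' (F0 \c F')) eM eM.
have hT1' : tot2 T1 = tot2 (lid (F' \c F0) \h actl (beps s) F').
  by rewrite hT1 /middle -hcomp_id tot2_A.
have hT2' : tot2 T2 = tot2 (mid s t s F' F0 \h lid F').
  by rewrite hT2 /middle actl_comp1 tot2_A.
have hT2'' : tot2 T2 = tot2 (actr (beps t) F' \h lid (F0 \c F')).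
  by rewrite hT2 /middle act_middle.
have eE : E = @to_bar k C t s _ _ (E0 \v T1 \v T2).
  apply: tot2_inj; rewrite hE; apply: tot2_to_bar.
  have -> : lid F' \h (c \v mid t s t F0 F') = (lid F' \h c) \v (lid F' \h mid t s t F0 F').
    by rewrite interchange vcomp1l.
  by apply: tot2_v => //; apply: tot2_v.
have eH : H = @to_bar k C t s _ _ (T2 \v (H0 \v actl (beps s) F')).
  apply: tot2_inj; rewrite hH; apply: tot2_to_bar.
  have -> : (mid s t s F' F0 \v d) \h lid F' = (mid s t s F' F0 \h lid F') \v (d \h lid F').
    by rewrite interchange vcomp1l.
  rewrite -vcompA; apply: tot2_v => //; apply: tot2_v => //.
  exact: tot2_l.
have E2 : E0 \v T2 = actr (beps t) F' \v E0.
  apply: tot2_inj; rewrite (tot2_v hE0 hT2'') interchange vcomp1r vcomp1l.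
  have -> : actr (beps t) F' \h c = (actr (beps t) F' \h lid _) \v (lid F' \h c).
    by rewrite interchange vcomp1l vcomp1r.
  by apply: tot2_v => //; exact: tot2_r.
have H1 : T1 \v H0 = H0 \v actl (beps s) F'.
  apply: tot2_inj; rewrite (tot2_v hT1' hH0) interchange vcomp1r vcomp1l.
  have -> : d \h actl (beps s) F' = (d \h lid F') \v (lid _ \h actl (beps s) F').
    by rewrite interchange vcomp1l vcomp1r.
  by apply: tot2_v => //; exact: tot2_l.
have T12 : T1 \v T2 = T2 \v T1.
  by apply: tot2_inj; rewrite (tot2_v hT1 hT2'') (tot2_v hT2'' hT1) !interchange !vcomp1l !vcomp1r.
have tri : E0 \v H0 = lid F' by exact: (triangle_r hE0 hH0).
have key : (E0 \v T1 \v T2) \v (T2 \v (H0 \v actl (beps s) F')) =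
    actr (beps t) F' \v actr (beps t) F' \v (actl (beps s) F' \v actl (beps s) F').
  rewrite -(vcompA E0) T12 -!vcompA (vcompA T1) T12 -!vcompA (vcompA T1 H0) H1.
  by rewrite (vcompA E0) E2 -!vcompA (vcompA E0) E2 -!vcompA (vcompA E0 H0) tri vcomp1l.
rewrite eE eH to_bar_comp key -!to_bar_comp.
by rewrite to_bar_actl to_bar_actr !vcomp1l to_bar_id.
Qed.

Definition bar_duality : duality B.
Proof.
apply: (@Duality k B badj badj2 _ _ _ bmul bmulV bmulK bmulVK bmul_absorb bmul_nat
  bone boneV _ _ _ bmulA bmul1l bmul1r bbid bbidV _ _ _ bbid_mul _
  bcounit bcoev _ _ bcounit_nat bcoev_nat btriangle_l btriangle_r).
- move=> s t F G c a b; rewrite /badj2 (_ : imval (c *: a + b) = c *: imval a + imval b) //.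
  by rewrite adj2_linear; exact: bar_in_linear.
- by move=> s t F; rewrite -!to_bar_id badj2_bin adj2_id.
- move=> s t F G H b a; rewrite -(to_barK a) -(to_barK b) to_bar_comp !badj2_bin adj2_comp.
  by rewrite -to_bar_comp.
- by move=> s; rewrite to_bar_comp adj_oneK -to_bar_id.
- by move=> s; rewrite to_bar_comp adj_oneVK -to_bar_id.
- by move=> s a; rewrite -(to_barK a) badj2_bin !to_bar_comp adj_one_nat.
- by move=> s t F; rewrite to_bar_comp bidualK -to_bar_id.
- by move=> s t F; rewrite to_bar_comp bidualVK -to_bar_id.
- by move=> s t F G a; rewrite -(to_barK a) !badj2_bin !to_bar_comp bidual_nat.
- by move=> s; rewrite badj2_bin to_bar_comp bidual_one.
- by move=> s t F; rewrite to_bar_middle to_bar_comp -vcompA middle_idem.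
- by move=> s t F; rewrite to_bar_middle to_bar_comp vcompA middle_idem.
Defined.
End BarDuality.

(** * Duality on additive closures *)

Section StrictDuality.
Variables (k : fieldType) (C : lin2Cat k).

(** A duality for which every 1-morphism is strictly inverse to its dual; unit,
    counit and all coherence maps are identities. The laws [sadj2_l] and
    [sadj2_r] say that [sadj2] sends a 2-morphism to its mate. *)
Record strict_duality := StrictDuality {
  sadj : forall i j : C, hcat i j -> hcat j i;
  sadj2 : forall (i j : C) (F G : hcat i j), lhom F G -> lhom (sadj G) (sadj F);
  sadj2_linear : forall (i j : C) (F G : hcat i j), linear (@sadj2 i j F G);
  sadj2_id : forall (i j : C) (F : hcat i j), sadj2 (lid F) = lid (sadj F);
  sadj2_comp : forall (i j : C) (F G H : hcat i j) (b : lhom G H) (a : lhom F G),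
    sadj2 (b \v a) = sadj2 a \v sadj2 b;
  sadj_mul : forall (i j l : C) (G : hcat j l) (F : hcat i j),
    sadj (G \c F) = sadj F \c sadj G;
  sadj_one : forall i : C, sadj (one1 i) = one1 i;
  sadjK : forall (i j : C) (F : hcat i j), sadj (sadj F) = F;
  sadjVl : forall (i j : C) (F : hcat i j), sadj F \c F = one1 i;
  sadjVr : forall (i j : C) (F : hcat i j), F \c sadj F = one1 j;
  sadj2_h : forall (i j l : C) (G G' : hcat j l) (F F' : hcat i j)
    (b : lhom G G') (a : lhom F F'), tot2 (sadj2 (b \h a)) = tot2 (sadj2 a \h sadj2 b);
  sadj2K : forall (i j : C) (F G : hcat i j) (a : lhom F G),
    tot2 (sadj2 (sadj2 a)) = tot2 a;
  sadj2_one : forall (i : C) (a : lhom (one1 i) (one1 i)), tot2 (sadj2 a) = tot2 a;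
  sadj2_l : forall (i j : C) (F G : hcat i j) (a : lhom F G),
    tot2 (sadj2 a \h lid G) = tot2 (lid (sadj F) \h a);
  sadj2_r : forall (i j : C) (F G : hcat i j) (a : lhom F G),
    tot2 (a \h lid (sadj G)) = tot2 (lid F \h sadj2 a) }.
End StrictDuality.

Lemma big_only1 (V : nmodType) (I : finType) (f : I -> V) (m : I) :
  (forall l, l != m -> f l = 0) -> \sum_l f l = f m.
Proof. by move=> h; rewrite (bigD1 m) //= big1 ?addr0. Qed.

Lemma idx_eq (m n : nat) (p q : 'I_(m * n)) :
  (p == q) = (idx1 p == idx1 q) && (idx2 p == idx2 q).
Proof.
apply/eqP/andP => [->|[/eqP e1 /eqP e2]]; first by rewrite !eqxx.
by rewrite -(idxK p) e1 e2 idxK.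
Qed.

(** The dual of a composite of direct sums is indexed by pairs in the opposite
    lexicographic order, so duality on direct sums is not strict. *)
Definition swap (m n : nat) (p : 'I_(m * n)) : 'I_(n * m) := idx (idx2 p) (idx1 p).
Lemma swapK (m n : nat) : cancel (@swap m n) (@swap n m).
Proof. by move=> p; rewrite /swap idx1K idx2K idxK. Qed.
Lemma idx1_swap (m n : nat) (p : 'I_(m * n)) : idx1 (swap p) = idx2 p. Proof. exact: idx1K. Qed.
Lemma idx2_swap (m n : nat) (p : 'I_(m * n)) : idx2 (swap p) = idx1 p. Proof. exact: idx2K. Qed.

Section Assoc.
Variables (m n r : nat) (p : 'I_(m * (n * r))) (q : 'I_(m * n * r)).
Hypothesis pq : val p = val q.
Lemma idx_assoc : [/\ idx1 p = idx1 (idx1 q), idx1 (idx2 p) = idx2 (idx1 q) & idx2 (idx2 p) = idx2 q].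
Proof.
split; apply: val_inj; rewrite /= -[nat_of_ord p]/(val p) pq /=.
- by rewrite (mulnC n) divnMA.
- by rewrite modn_divl.
- by rewrite modn_dvdm // dvdn_mull.
Qed.
End Assoc.

Section AdditiveDuality.
Variables (k : fieldType) (C : lin2Cat k) (S : strict_duality C).
Let L := hlaws C.
Let A := add2_semi C.
Notation hA i j := (@hcat k A i j).
Notation oneA i := (@one1 k A i).

Lemma tot2_cmat (i j : C) (X Y X' Y' : hA i j) c c' :
  X = X' -> Y = Y' ->
  (forall p q p' q', val p = val p' -> val q = val q' -> c p q = c' p' q') ->
  tot2 (@cmat k (hcat i j) X Y c : @lhom k (hA i j) X Y) =
  tot2 (@cmat k (hcat i j) X' Y' c' : @lhom k (hA i j) X' Y').
Proof.
move=> eX eY; destruct eX, eY => h; congr tot2; apply: cmat_ext => p q; exact: h.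
Qed.

Lemma canon_hcomp (i j l : C) (G G' : @hcat k C j l) (F F' : @hcat k C i j) :
  G = G' -> F = F' -> canon G G' \h canon F F' = canon (G \c F) (G' \c F').
Proof. by move=> <- <-; rewrite !canon_id hcomp_id. Qed.

Lemma cmat_hcomp (i j l : C) (G G' : hA j l) (F F' : hA i j) c d :
  @supported k (hcat j l) G G' c -> @supported k (hcat i j) F F' d ->
  hcomp (@cmat k (hcat j l) G G' c : @lhom k (hA j l) G G')
        (@cmat k (hcat i j) F F' d : @lhom k (hA i j) F F') =
  @cmat k (hcat i l) (G \c F : hA i l) (G' \c F' : hA i l)
    (fun p q => c (idx1 p) (idx1 q) * d (idx2 p) (idx2 q)).
Proof.
move=> sc sd; apply: mat_ext => p q; rewrite /= /add2_hcomp /cmat /entry /mat /=.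
have ZD u v : (u *: canon (G (idx1 q)) (G' (idx1 p))) \h (v *: canon (F (idx2 q)) (F' (idx2 p)))
    = (u * v) *: (canon (G (idx1 q)) (G' (idx1 p)) \h canon (F (idx2 q)) (F' (idx2 p))).
  have := hcomp_linr (F := F (idx2 q)) (F' := F' (idx2 p))
    (u *: canon (G (idx1 q)) (G' (idx1 p))) v (canon _ _) 0.
  rewrite !addr0 hcomp0r addr0 => ->.
  have := hcomp_linl (G := G (idx1 q)) (G' := G' (idx1 p))
    (canon (F (idx2 q)) (F' (idx2 p))) u (canon _ _) 0.
  by rewrite !addr0 hcomp0l addr0 => ->; rewrite scalerA mulrC.
rewrite ZD; have [->|/eqP cn] := eqVneq (c (idx1 p) (idx1 q)) 0.
  by rewrite !mul0r !scale0r.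
have [->|/eqP dn] := eqVneq (d (idx2 p) (idx2 q)) 0; first by rewrite !mulr0 !scale0r.
by rewrite canon_hcomp //; [exact: sc|exact: sd].
Qed.

Lemma supported_fun (i j : C) (X Y : hA i j) (f : 'I_(fsn Y) -> 'I_(fsn X)) :
  (forall p, X (f p) = Y p) -> @supported k (hcat i j) X Y (fun p q => (q == f p)%:R).
Proof. by move=> h p q; case: eqP => // ->. Qed.

(** Left multiplication by a matrix whose rows are unit vectors selects rows. *)
Lemma entry_select_rows (i j : C) (X Y Z : hA i j) (f : 'I_(fsn Z) -> 'I_(fsn Y))
    (a : @lhom k (hA i j) X Y) p q :
  entry ((@cmat k (hcat i j) Y Z (fun p r => (r == f p)%:R) : @lhom k (hA i j) Y Z) \v a) p q =
  canon (Y (f p)) (Z p) \v entry a (f p) q.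
Proof.
rewrite /= /add_comp {1}/entry /mat /= (@big_only1 _ _ _ (f p)) => [|l ne].
  by rewrite /cmat /entry /mat /= eqxx scale1r.
by rewrite /cmat /entry /mat /= (negbTE ne) scale0r lcomp0l.
Qed.
Lemma entry_select_cols (i j : C) (X Y Z : hA i j) (f : 'I_(fsn X) -> 'I_(fsn Y))
    (a : @lhom k (hA i j) Y Z) p q :
  entry (a \v (@cmat k (hcat i j) X Y (fun r q => (r == f q)%:R) : @lhom k (hA i j) X Y)) p q =
  entry a p (f q) \v canon (X q) (Y (f q)).
Proof.
rewrite /= /add_comp {1}/entry /mat /= (@big_only1 _ _ _ (f q)) => [|l ne].
  by rewrite /cmat /entry /mat /= eqxx scale1r.
by rewrite /cmat /entry /mat /= (negbTE ne) scale0r lcomp0r.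
Qed.

Definition aadj (i j : C) (X : hA i j) : hA j i := FSum (fun p => sadj S (X p)).
Definition aadj2 (i j : C) (X Y : hA i j) (a : lhom X Y) : lhom (aadj Y) (aadj X) :=
  @mat k (hcat j i) (aadj Y) (aadj X) (fun p q => sadj2 S (entry a q p)).

Lemma sadj2_canon (i j : C) (F G : @hcat k C i j) :
  F = G -> sadj2 S (canon F G) = canon (sadj S G) (sadj S F).
Proof. by move=> <-; rewrite !canon_id sadj2_id. Qed.

Lemma aadj2_cmat (i j : C) (X Y : hA i j) c : @supported k (hcat i j) X Y c ->
  aadj2 (@cmat k (hcat i j) X Y c : @lhom k (hA i j) X Y) =
  @cmat k (hcat j i) (aadj Y) (aadj X) (fun p q => c q p).
Proof.
move=> sc; apply: mat_ext => p q; rewrite /aadj2 /cmat /entry /mat /=.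
have := @sadj2_linear k C S i j (X p) (Y q) (c q p) (canon _ _) 0.
rewrite (linear_f0 (@sadj2_linear k C S _ _ _ _)) !addr0 => ->.
have [->|/eqP cn] := eqVneq (c q p) 0; first by rewrite !scale0r.
by rewrite sadj2_canon //; exact: sc.
Qed.

Definition amul (i j l : C) (G : hA j l) (F : hA i j) :
    lhom (aadj F \c aadj G : hA l i) (aadj (G \c F)) :=
  @cmat k (hcat l i) (aadj F \c aadj G : hA l i) (aadj (G \c F)) (fun p q => (q == swap p)%:R).
Definition amulV (i j l : C) (G : hA j l) (F : hA i j) :
    lhom (aadj (G \c F)) (aadj F \c aadj G : hA l i) :=
  @cmat k (hcat l i) (aadj (G \c F)) (aadj F \c aadj G : hA l i) (fun p q => (q == swap p)%:R).

Arguments amul {i j l} G F.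
Arguments amulV {i j l} G F.

Lemma swap_sym (m n : nat) (p : 'I_(m * n)) (q : 'I_(n * m)) : (q == swap p) = (p == swap q).
Proof. by apply/eqP/eqP => ->; rewrite swapK. Qed.

Lemma amul_obj (i j l : C) (G : hA j l) (F : hA i j) (p : 'I_(fsn G * fsn F)) :
  (aadj F \c aadj G : hA l i) (swap p) = (aadj (G \c F) : hA l i) p.
Proof. by rewrite /= idx1_swap idx2_swap sadj_mul. Qed.
Lemma amulV_obj (i j l : C) (G : hA j l) (F : hA i j) (p : 'I_(fsn F * fsn G)) :
  (aadj (G \c F) : hA l i) (swap p) = (aadj F \c aadj G : hA l i) p.
Proof. by rewrite /= idx1_swap idx2_swap sadj_mul. Qed.

Lemma amul_supported (i j l : C) (G : hA j l) (F : hA i j) :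
  @supported k (hcat l i) (aadj F \c aadj G : hA l i) (aadj (G \c F)) (fun p q => (q == swap p)%:R).
Proof. apply: supported_fun; exact: amul_obj. Qed.
Lemma amulV_supported (i j l : C) (G : hA j l) (F : hA i j) :
  @supported k (hcat l i) (aadj (G \c F)) (aadj F \c aadj G : hA l i) (fun p q => (q == swap p)%:R).
Proof. apply: supported_fun => p; exact: (@amulV_obj _ _ _ G F p). Qed.

Lemma amulK (i j l : C) (G : hA j l) (F : hA i j) :
  amulV G F \v amul G F = lid (aadj F) \h lid (aadj G).
Proof.
rewrite (add2_id (aadj F) (aadj G)); apply: etrans (cmat_id _).
rewrite [LHS]cmat_comp; last by left; exact: amulV_supported.
apply: cmat_ext => p q; under eq_bigr => r _ do rewrite mulrC.
by rewrite (sum_delta (fun r => (q == swap r)%:R)) swapK eq_sym.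
Qed.
Lemma amulVK (i j l : C) (G : hA j l) (F : hA i j) :
  amul G F \v amulV G F = lid (aadj (G \c F)).
Proof.
apply: etrans (cmat_id _).
rewrite [LHS]cmat_comp; last by left; exact: amul_supported.
apply: cmat_ext => p q; under eq_bigr => r _ do rewrite mulrC.
by rewrite (sum_delta (fun r => (q == swap r)%:R)) swapK eq_sym.
Qed.

Lemma amul_nat (i j l : C) (G G' : hA j l) (F F' : hA i j)
    (b : lhom G G') (a : lhom F F') :
  aadj2 (b \h a) \v amul G' F' = amul G F \v (aadj2 a \h aadj2 b).
Proof.
apply: mat_ext => p q.
rewrite [RHS]entry_select_rows.
have -> : amul G' F' = @cmat k (hcat l i) (aadj F' \c aadj G' : hA l i) (aadj (G' \c F'))
    (fun p q => (p == swap q)%:R).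
  by apply: cmat_ext => r r'; rewrite swap_sym.
rewrite [LHS]entry_select_cols; apply: tot2_inj.
rewrite [LHS](@tot_canonr k (hcat l i)); last exact/esym/(@amulV_obj _ _ _ G' F').
rewrite [RHS](@tot_canonl k (hcat l i)); last exact: amul_obj.
rewrite /= /entry /aadj2 /add2_hcomp /mat /= /entry /=.
rewrite [LHS]sadj2_h !idx1_swap !idx2_swap //.
Qed.

Definition aone (i : C) : lhom (oneA i) (aadj (oneA i)) :=
  @cmat k (hcat i i) (oneA i) (aadj (oneA i)) (fun _ _ => 1).
Definition aoneV (i : C) : lhom (aadj (oneA i)) (oneA i) :=
  @cmat k (hcat i i) (aadj (oneA i)) (oneA i) (fun _ _ => 1).
Arguments aone i : clear implicits.
Arguments aoneV i : clear implicits.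

Lemma aone_supported (i : C) :
  @supported k (hcat i i) (oneA i) (aadj (oneA i)) (fun _ _ => 1).
Proof. by move=> p q _; rewrite /= sadj_one. Qed.
Lemma aoneV_supported (i : C) :
  @supported k (hcat i i) (aadj (oneA i)) (oneA i) (fun _ _ => 1).
Proof. by move=> p q _; rewrite /= sadj_one. Qed.

Lemma aoneK (i : C) : aoneV i \v aone i = lid (oneA i).
Proof.
apply: etrans (cmat_id _); rewrite [LHS]cmat_comp; last by left; exact: aoneV_supported.
by apply: cmat_ext => p q; rewrite big_ord1 mulr1 (ord1 (p : 'I_1)) (ord1 (q : 'I_1)).
Qed.
Lemma aoneVK (i : C) : aone i \v aoneV i = lid (aadj (oneA i)).
Proof.
apply: etrans (cmat_id _); rewrite [LHS]cmat_comp; last by left; exact: aone_supported.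
by apply: cmat_ext => p q; rewrite big_ord1 mulr1 (ord1 (p : 'I_1)) (ord1 (q : 'I_1)).
Qed.

Lemma aone_select (i : C) :
  aone i = @cmat k (hcat i i) (oneA i) (aadj (oneA i)) (fun p q => (q == p)%:R).
Proof. by apply: cmat_ext => p q; rewrite (ord1 (p : 'I_1)) (ord1 (q : 'I_1)). Qed.
Lemma aone_select' (i : C) :
  aone i = @cmat k (hcat i i) (oneA i) (aadj (oneA i)) (fun p q => (p == q)%:R).
Proof. by apply: cmat_ext => p q; rewrite (ord1 (p : 'I_1)) (ord1 (q : 'I_1)). Qed.

Lemma aone_nat (i : C) (a : lhom (oneA i) (oneA i)) :
  aadj2 a \v aone i = aone i \v a.
Proof.
apply: mat_ext => p q; rewrite (ord1 (p : 'I_1)) (ord1 (q : 'I_1)).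
rewrite {1}aone_select' aone_select.
refine (etrans (@entry_select_cols i i (oneA i) (aadj (oneA i)) _ (fun x => x) (aadj2 a) 0 0) _).
refine (etrans _ (esym (@entry_select_rows i i (oneA i) (oneA i) (aadj (oneA i)) (fun x => x) a 0 0))).
apply: tot2_inj; rewrite [LHS](@tot_canonr k (hcat i i)); last by rewrite /= sadj_one.
rewrite [RHS](@tot_canonl k (hcat i i)); last by rewrite /= sadj_one.
exact: sadj2_one.
Qed.

Definition abid (i j : C) (F : hA i j) : lhom F (aadj (aadj F)) :=
  @cmat k (hcat i j) F (aadj (aadj F)) (fun p q => (q == p)%:R).
Definition abidV (i j : C) (F : hA i j) : lhom (aadj (aadj F)) F :=
  @cmat k (hcat i j) (aadj (aadj F)) F (fun p q => (q == p)%:R).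
Arguments abid {i j} F.
Arguments abidV {i j} F.

Lemma abid_supported (i j : C) (F : hA i j) :
  @supported k (hcat i j) F (aadj (aadj F)) (fun p q => (q == p)%:R).
Proof. by apply: supported_fun => p; rewrite /= sadjK. Qed.
Lemma abidV_supported (i j : C) (F : hA i j) :
  @supported k (hcat i j) (aadj (aadj F)) F (fun p q => (q == p)%:R).
Proof. by apply: supported_fun => p; rewrite /= sadjK. Qed.

Lemma abidK (i j : C) (F : hA i j) : abidV F \v abid F = lid F.
Proof.
apply: etrans (cmat_id _); rewrite [LHS]cmat_comp; last by left; exact: abidV_supported.
apply: cmat_ext => p q; under eq_bigr => r _ do rewrite mulrC.
by rewrite (sum_delta (fun r => (q == r)%:R)) eq_sym.
Qed.
Lemma abidVK (i j : C) (F : hA i j) : abid F \v abidV F = lid (aadj (aadj F)).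
Proof.
apply: etrans (cmat_id _); rewrite [LHS]cmat_comp; last by left; exact: abid_supported.
apply: cmat_ext => p q; under eq_bigr => r _ do rewrite mulrC.
by rewrite (sum_delta (fun r => (q == r)%:R)) eq_sym.
Qed.

Lemma abid_nat (i j : C) (F G : hA i j) (a : lhom F G) :
  aadj2 (aadj2 a) \v abid F = abid G \v a.
Proof.
apply: mat_ext => p q.
have -> : abid F = @cmat k (hcat i j) F (aadj (aadj F)) (fun p q => (p == q)%:R).
  by apply: cmat_ext => r r'; rewrite eq_sym.
refine (etrans (@entry_select_cols i j F (aadj (aadj F)) _ (fun x => x) (aadj2 (aadj2 a)) p q) _).
refine (etrans _ (esym (@entry_select_rows i j F G (aadj (aadj G)) (fun x => x) a p q))).
apply: tot2_inj; rewrite [LHS](@tot_canonr k (hcat i j)); last by rewrite /= sadjK.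
rewrite [RHS](@tot_canonl k (hcat i j)); last by rewrite /= sadjK.
exact: sadj2K.
Qed.

Lemma abid_mul (i j l : C) (G : hA j l) (F : hA i j) :
  aadj2 (amul G F) \v abid (G \c F : hA i l) =
  amul (aadj F) (aadj G) \v (abid G \h abid F).
Proof.
rewrite (aadj2_cmat (@amul_supported _ _ _ G F)).
rewrite (cmat_hcomp (@abid_supported _ _ G) (@abid_supported _ _ F)).
rewrite [LHS]cmat_comp; last by right; exact: (@abid_supported _ _ (G \c F : hA i l)).
rewrite [RHS]cmat_comp; last by left; exact: (@amul_supported _ _ _ (aadj F) (aadj G)).
apply: cmat_ext => p q.
rewrite (sum_delta' (fun r => (p == swap r)%:R)).
under [RHS]eq_bigr => r _ do rewrite mulrC.
rewrite (sum_delta (fun r => (idx1 q == idx1 r)%:R * (idx2 q == idx2 r)%:R)).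
by rewrite -natrM mulnb -idx_eq -swap_sym.
Qed.

Lemma abid_one (i : C) : aadj2 (aone i) \v abid (oneA i) = aone i.
Proof.
rewrite (aadj2_cmat (@aone_supported i)).
rewrite [LHS]cmat_comp; last by right; exact: (@abid_supported i i (oneA i)).
by apply: cmat_ext => p q; rewrite big_ord1 mul1r (ord1 (q : 'I_1)).
Qed.

Lemma amulA (i j l m : C) (H : hA l m) (G : hA j l) (F : hA i j) :
  tot2 (amul H (G \c F : hA i l) \v (amul G F \h lid (aadj H))) =
  tot2 (amul (H \c G : hA j m) F \v (lid (aadj F) \h amul H G)).
Proof.
have idS (i' j' : C) (X : hA i' j') : @supported k (hcat i' j') X X (fun p q => (p == q)%:R).
  by move=> p q; case: eqP => // ->.
have -> : lid (aadj H) = @cmat k (hcat m l) (aadj H) (aadj H) (fun p q => (p == q)%:R).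
  exact/esym/cmat_id.
have -> : lid (aadj F) = @cmat k (hcat j i) (aadj F) (aadj F) (fun p q => (p == q)%:R).
  exact/esym/cmat_id.
rewrite (cmat_hcomp (@amul_supported _ _ _ G F) (@idS _ _ (aadj H))).
rewrite (cmat_hcomp (@idS _ _ (aadj F)) (@amul_supported _ _ _ H G)).
rewrite [X in tot2 X = _]cmat_comp; last by left; exact: (@amul_supported _ _ _ H (G \c F : hA i l)).
rewrite [X in _ = tot2 X]cmat_comp; last by left; exact: (@amul_supported _ _ _ (H \c G : hA j m) F).
apply: tot2_cmat.
- exact: (esym (add2_A (aadj F) (aadj G) (aadj H))).
- by congr aadj; exact: (add2_A H G F).
move=> p q p' q' ep eq.
under eq_bigr => r _ do rewrite mulrC.
under [RHS]eq_bigr => r _ do rewrite mulrC.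
rewrite (sum_delta (fun r => (idx1 q == swap (idx1 r))%:R * (idx2 r == idx2 q)%:R)).
rewrite (sum_delta (fun r => (idx1 r == idx1 q')%:R * (idx2 q' == swap (idx2 r))%:R)).
rewrite -!natrM !mulnb; congr ((nat_of_bool _)%:R).
rewrite !idx1_swap !idx2_swap !idx_eq !idx1_swap !idx2_swap.
have [e1 e2 e3] := idx_assoc ep; have [f1 f2 f3] := idx_assoc (esym eq).
rewrite e1 e2 e3 f1 f2 f3.
by rewrite [idx1 (idx1 q) == _]eq_sym [idx1 (idx1 p') == _]eq_sym andbA.
Qed.

Lemma idS (i j : C) (X : hA i j) : @supported k (hcat i j) X X (fun p q => (p == q)%:R).
Proof. by move=> p q; case: eqP => // ->. Qed.
Lemma lid_cmat (i j : C) (X : hA i j) :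
  lid X = @cmat k (hcat i j) X X (fun p q => (p == q)%:R).
Proof. exact/esym/cmat_id. Qed.

Lemma amul1l (i j : C) (F : hA i j) :
  tot2 (amul (oneA j) F \v (lid (aadj F) \h aone j)) = tot2 (lid (aadj F)).
Proof.
rewrite lid_cmat (cmat_hcomp (@idS _ _ (aadj F)) (@aone_supported j)).
rewrite [X in tot2 X = _]cmat_comp; last by left; exact: (@amul_supported _ _ _ (oneA j) F).
apply: tot2_cmat; first exact: (add2_r (aadj F)).
  by congr aadj; exact: (add2_l F).
move=> p q p' q' ep eq; under eq_bigr => r _ do rewrite mulrC.
rewrite (sum_delta (fun r => (idx1 r == idx1 q)%:R * 1)) mulr1 idx1_swap.
congr ((nat_of_bool _)%:R); rewrite -!(inj_eq val_inj) -ep -eq /=.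
have lp : (p < fsn F)%N by rewrite -[X in (_ < X)%N]mul1n.
by rewrite divn1 modn_small.
Qed.
Lemma amul1r (i j : C) (F : hA i j) :
  tot2 (amul F (oneA i) \v (aone i \h lid (aadj F))) = tot2 (lid (aadj F)).
Proof.
rewrite lid_cmat (cmat_hcomp (@aone_supported i) (@idS _ _ (aadj F))).
rewrite [X in tot2 X = _]cmat_comp; last by left; exact: (@amul_supported _ _ _ F (oneA i)).
apply: tot2_cmat; first exact: (add2_l (aadj F)).
  by congr aadj; exact: (add2_r F).
move=> p q p' q' ep eq; under eq_bigr => r _ do rewrite mulrC.
rewrite (sum_delta (fun r => 1 * (idx2 r == idx2 q)%:R)) mul1r idx2_swap.
congr ((nat_of_bool _)%:R); rewrite -!(inj_eq val_inj) -ep -eq /=.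
have lq : (q < fsn F)%N by rewrite -[X in (_ < X)%N]mul1n.
by rewrite divn1 modn_small.
Qed.

(** F i composed with the dual of F j equals the identity 1-morphism when i = j,
    so a 0-1 matrix pairs a direct sum with its dual. *)
Definition acounit (i j : C) (F : hA i j) : lhom (F \c aadj F : hA j j) (oneA j) :=
  @cmat k (hcat j j) (F \c aadj F : hA j j) (oneA j) (fun _ q => (idx1 q == idx2 q)%:R).
Definition acoev (i j : C) (F : hA i j) : lhom (oneA i) (aadj F \c F : hA i i) :=
  @cmat k (hcat i i) (oneA i) (aadj F \c F : hA i i) (fun p _ => (idx1 p == idx2 p)%:R).
Arguments acounit {i j} F.
Arguments acoev {i j} F.

Lemma acounit_supported (i j : C) (F : hA i j) :
  @supported k (hcat j j) (F \c aadj F : hA j j) (oneA j) (fun _ q => (idx1 q == idx2 q)%:R).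
Proof. by move=> p q; case: eqP => // e _; rewrite /= -e sadjVr. Qed.
Lemma acoev_supported (i j : C) (F : hA i j) :
  @supported k (hcat i i) (oneA i) (aadj F \c F : hA i i) (fun p _ => (idx1 p == idx2 p)%:R).
Proof. by move=> p q; case: eqP => // e _; rewrite /= -e sadjVl. Qed.

Lemma acounit_nat (i j : C) (F G : hA i j) (a : lhom F G) :
  acounit G \v (a \h lid (aadj G)) = acounit F \v (lid F \h aadj2 a).
Proof.
apply: mat_ext => p q; rewrite (ord1 (p : 'I_1)).
rewrite {1}/entry /= /add_comp {1}/mat (@big_only1 _ _ _ (idx (idx2 q) (idx2 q))); last first.
  move=> r; rewrite idx_eq idx1K idx2K negb_and => ne.
  rewrite /acounit /cmat /add2_hcomp /mat /entry /=.
  have [e|n2] := eqVneq (idx2 r) (idx2 q); last first.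
    have := @add_id_off k _ (aadj G) (idx2 r) (idx2 q); rewrite /entry => -> //; last by rewrite eq_sym.
    by rewrite hcomp0r lcomp0r.
  by move: ne; rewrite e eqxx orbF => /negbTE->; rewrite scale0r lcomp0l.
rewrite [RHS]/entry /= /add_comp {1}/mat (@big_only1 _ _ _ (idx (idx1 q) (idx1 q))); last first.
  move=> r; rewrite idx_eq idx1K idx2K negb_and => ne.
  rewrite /acounit /cmat /add2_hcomp /mat /entry /=.
  have [e|n1] := eqVneq (idx1 r) (idx1 q); last first.
    have := @add_id_off k _ F (idx1 r) (idx1 q); rewrite /entry => -> //; last by rewrite eq_sym.
    by rewrite hcomp0l lcomp0r.
  move: ne; rewrite e eqxx /= [_ == idx2 r]eq_sym => /negbTE->.
  by rewrite scale0r lcomp0l.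
apply: tot2_inj; rewrite /acounit /cmat /add2_hcomp /mat /entry /= !idx1K !idx2K !eqxx !scale1r.
rewrite [LHS](@tot_canonl k (hcat j j)); last by rewrite sadjVr.
rewrite [RHS](@tot_canonl k (hcat j j)); last by rewrite sadjVr.
have := @add_id_diag k _ (aadj G) (idx2 q); rewrite /entry => ->.
have := @add_id_diag k _ F (idx1 q); rewrite /entry => ->.
exact: sadj2_r.
Qed.

Lemma acoev_nat (i j : C) (F G : hA i j) (a : lhom F G) :
  (aadj2 a \h lid G) \v acoev G = (lid (aadj F) \h a) \v acoev F.
Proof.
apply: mat_ext => p q; rewrite (ord1 (q : 'I_1)).
rewrite {1}/entry /= /add_comp {1}/mat (@big_only1 _ _ _ (idx (idx2 p) (idx2 p))); last first.
  move=> r; rewrite idx_eq idx1K idx2K negb_and => ne.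
  rewrite /acoev /cmat /add2_hcomp /mat /entry /=.
  have [e|n2] := eqVneq (idx2 r) (idx2 p); last first.
    have := @add_id_off k _ G (idx2 p) (idx2 r); rewrite /entry => -> //.
    by rewrite hcomp0r lcomp0l.
  by move: ne; rewrite e eqxx orbF => /negbTE->; rewrite scale0r lcomp0r.
rewrite [RHS]/entry /= /add_comp {1}/mat (@big_only1 _ _ _ (idx (idx1 p) (idx1 p))); last first.
  move=> r; rewrite idx_eq idx1K idx2K negb_and => ne.
  rewrite /acoev /cmat /add2_hcomp /mat /entry /=.
  have [e|n1] := eqVneq (idx1 r) (idx1 p); last first.
    have := @add_id_off k _ (aadj F) (idx1 p) (idx1 r); rewrite /entry => -> //.
    by rewrite hcomp0l lcomp0l.
  move: ne; rewrite e eqxx /= [_ == idx2 r]eq_sym => /negbTE->.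
  by rewrite scale0r lcomp0r.
apply: tot2_inj; rewrite /acoev /cmat /add2_hcomp /mat /entry /= !idx1K !idx2K !eqxx !scale1r.
rewrite [LHS](@tot_canonr k (hcat i i)); last by rewrite sadjVl.
rewrite [RHS](@tot_canonr k (hcat i i)); last by rewrite sadjVl.
have := @add_id_diag k _ G (idx2 p); rewrite /entry => ->.
have := @add_id_diag k _ (aadj F) (idx1 p); rewrite /entry => ->.
exact: sadj2_l.
Qed.

(** The triangle identity of a matrix category over scalars. *)
Lemma sum_triangle (n : nat) (i j : 'I_n) :
  \sum_(a < n) \sum_(b < n) \sum_(c < n)
     (((a == b)%:R * (i == c)%:R) * ((a == j)%:R * (b == c)%:R) : k) = (i == j)%:R.
Proof.
rewrite (@big_only1 _ _ _ j) => [|a ne]; last first.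
  by apply: big1 => b _; apply: big1 => c _; rewrite (negbTE ne) mul0r mulr0.
rewrite (@big_only1 _ _ _ j) => [|b ne]; last first.
  by apply: big1 => c _; rewrite [j == b]eq_sym (negbTE ne) !mul0r.
rewrite (@big_only1 _ _ _ j) => [|c ne]; last first.
  by rewrite [j == c]eq_sym (negbTE ne) !mulr0.
by rewrite !eqxx !mulr1 !mul1r.
Qed.

(** All matrices involved are scalar, so that the triangle reduces to
    [sum_triangle]. *)
Lemma atriangle_l (i j : C) (F M : hA i j) (E : lhom M F) (H : lhom F M) :
  tot2 E = tot2 (acounit F \h lid F) -> tot2 H = tot2 (lid F \h acoev F) ->
  E \v H = lid F.
Proof.
rewrite lid_cmat => hE hH; have eM := tot2_src hE; destruct (esym eM).
move: hE hH; rewrite (cmat_hcomp (@acounit_supported _ _ F) (@idS _ _ F)).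
rewrite (cmat_hcomp (@idS _ _ F) (@acoev_supported _ _ F)) => hE hH.
have eE : E = @cmat k (hcat i j) (F \c aadj F \c F : hA i j) F
    (fun p q => (idx1 (idx1 q) == idx2 (idx1 q))%:R * (p == idx2 q)%:R).
  apply: tot2_inj; rewrite [LHS]hE; apply: tot2_cmat => //; first exact: (add2_l F).
  move=> p q p' q' ep /val_inj ->; congr (_ * (nat_of_bool _)%:R).
  by congr (_ == _); apply: val_inj; rewrite -ep /= modn_small // -[X in (_ < X)%N]mul1n.
have eH : H = @cmat k (hcat i j) F (F \c aadj F \c F : hA i j)
    (fun q p => (idx1 (idx1 q) == p)%:R * (idx2 (idx1 q) == idx2 q)%:R).
  apply: tot2_inj; rewrite [LHS]hH; apply: tot2_cmat.
  - exact: (add2_r F).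
  - exact: (add2_A F (aadj F) F).
  move=> p q p' q' ep eq; have [-> -> ->] := idx_assoc ep.
  congr ((nat_of_bool _)%:R * _).
  by congr (_ == _); apply: val_inj; rewrite -eq /= divn1.
rewrite eE eH [LHS]cmat_comp.
  apply: cmat_ext => p q; rewrite sum_idx.
  rewrite (@sum_idx (fsn F) (fsn F)) -[RHS]sum_triangle; apply: eq_bigr => a _.
  apply: eq_bigr => b _; apply: eq_bigr => c _.
  by rewrite !idx1K !idx2K.
left=> p q; rewrite -natrM mulnb; case: andP => // -[/eqP e1 /eqP e2] _.
by rewrite /= e1 e2 sadjVr (comp1l L).
Qed.

Lemma atriangle_r (i j : C) (F : hA i j) (M : hA j i)
    (E : lhom M (aadj F)) (H : lhom (aadj F) M) :
  tot2 E = tot2 (lid (aadj F) \h acounit F) -> tot2 H = tot2 (acoev F \h lid (aadj F)) ->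
  E \v H = lid (aadj F).
Proof.
rewrite lid_cmat => hE hH; have eM := tot2_tgt hH; destruct (esym eM).
move: hE hH; rewrite (cmat_hcomp (@acoev_supported _ _ F) (@idS _ _ (aadj F))).
rewrite (cmat_hcomp (@idS _ _ (aadj F)) (@acounit_supported _ _ F)) => hE hH.
have eH : H = @cmat k (hcat j i) (aadj F) (aadj F \c F \c aadj F : hA j i)
    (fun q p => (idx1 (idx1 q) == idx2 (idx1 q))%:R * (idx2 q == p)%:R).
  apply: tot2_inj; rewrite [LHS]hH; apply: tot2_cmat => //; first exact: (add2_l (aadj F)).
  move=> p q p' q' /val_inj -> eq; congr (_ * (nat_of_bool _)%:R).
  by congr (_ == _); apply: val_inj; rewrite -eq /= modn_small // -[X in (_ < X)%N]mul1n.
have eE : E = @cmat k (hcat j i) (aadj F \c F \c aadj F : hA j i) (aadj F)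
    (fun p q => (p == idx1 (idx1 q))%:R * (idx2 (idx1 q) == idx2 q)%:R).
  apply: tot2_inj; rewrite [LHS]hE; apply: tot2_cmat.
  - exact: (add2_A (aadj F) F (aadj F)).
  - exact: (add2_r (aadj F)).
  move=> p q p' q' ep eq; have [-> -> ->] := idx_assoc eq.
  congr ((nat_of_bool _)%:R * _).
  by congr (_ == _); apply: val_inj; rewrite -ep /= divn1.
rewrite eE eH [LHS]cmat_comp.
  apply: cmat_ext => p q; rewrite sum_idx.
  rewrite (@sum_idx (fsn F) (fsn F)) eq_sym -[RHS]sum_triangle; apply: eq_bigr => a _.
  apply: eq_bigr => b _; apply: eq_bigr => c _.
  by rewrite !idx1K !idx2K mulrC [q == c]eq_sym [a == p]eq_sym.
right=> q p; rewrite -natrM mulnb; case: andP => // -[/eqP e1 /eqP e2] _.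
by rewrite /= -e1 -e2 sadjVl (comp1l L).
Qed.

Definition additive_duality : duality A.
Proof.
have hid (i j l : C) (G : hA j l) (F : hA i j) : lid G \h lid F = lid (G \c F).
  exact: (@add2_id k C i j l G F).
have aadj2_id (i j : C) (F : hA i j) : aadj2 (lid F) = lid (aadj F).
  rewrite !lid_cmat (aadj2_cmat (@idS _ _ F)); apply: cmat_ext => p q.
  by rewrite eq_sym.
apply: (@Duality k A aadj aadj2 _ aadj2_id _ (@amul) (@amulV) (@amulK) _ _ (@amul_nat)
  aone aoneV aoneK aoneVK aone_nat (@amulA) (@amul1l) (@amul1r) (@abid) (@abidV)
  (@abidK) (@abidVK) (@abid_nat) (@abid_mul) abid_one
  (@acounit) (@acoev) _ _ (@acounit_nat) (@acoev_nat) (@atriangle_l) (@atriangle_r)).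
- by move=> i j F G c a b; apply: mat_ext => p q; exact: sadj2_linear.
- move=> i j F G H b a; apply: mat_ext => p q.
  rewrite /aadj2 {1}/entry /mat /= /add_comp {1}/entry /mat /=.
  rewrite (linear_fsum (@sadj2_linear k C S _ _ _ _)) /entry /=.
  by apply: eq_bigr => r _; rewrite sadj2_comp.
- by move=> i j l G F; rewrite amulVK hid aadj2_id.
- by move=> i j l G F; rewrite hid vcomp1r.
- by move=> i j F; rewrite hid vcomp1r.
- by move=> i j F; rewrite hid vcomp1l.
Defined.
End AdditiveDuality.

(** * Duality on linearizations *)

Section InvertibleDuality.
Variable C : fin2Cat.

Definition ftot (i j : C) (F G : fhcat i j) (a : fhom F G) :=
  tot (H := fun x y : fhcat i j => fhom x y) a.

(** The combinatorial source of a strict duality, before linearization. *)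
Record fin_duality := FinDuality {
  fadj : forall i j : C, fhcat i j -> fhcat j i;
  fadj2 : forall (i j : C) (F G : fhcat i j), fhom F G -> fhom (fadj G) (fadj F);
  fadj2_id : forall (i j : C) (F : fhcat i j), fadj2 (fid F) = fid (fadj F);
  fadj2_comp : forall (i j : C) (F G H : fhcat i j) (b : fhom G H) (a : fhom F G),
    fadj2 (fcomp b a) = fcomp (fadj2 a) (fadj2 b);
  fadj_mul : forall (i j l : C) (G : fhcat j l) (F : fhcat i j),
    fadj (fcomp1 G F) = fcomp1 (fadj F) (fadj G);
  fadj_one : forall i : C, fadj (fone i) = fone i;
  fadjK : forall (i j : C) (F : fhcat i j), fadj (fadj F) = F;
  fadjVl : forall (i j : C) (F : fhcat i j), fcomp1 (fadj F) F = fone i;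
  fadjVr : forall (i j : C) (F : fhcat i j), fcomp1 F (fadj F) = fone j;
  fadj2_h : forall (i j l : C) (G G' : fhcat j l) (F F' : fhcat i j)
    (b : fhom G G') (a : fhom F F'),
    ftot (fadj2 (fhcomp b a)) = ftot (fhcomp (fadj2 a) (fadj2 b));
  fadj2K : forall (i j : C) (F G : fhcat i j) (a : fhom F G),
    ftot (fadj2 (fadj2 a)) = ftot a;
  fadj2_one : forall (i : C) (a : fhom (fone i) (fone i)), ftot (fadj2 a) = ftot a;
  fadj2_l : forall (i j : C) (F G : fhcat i j) (a : fhom F G),
    ftot (fhcomp (fadj2 a) (fid G)) = ftot (fhcomp (fid (fadj F)) a);
  fadj2_r : forall (i j : C) (F G : fhcat i j) (a : fhom F G),
    ftot (fhcomp a (fid (fadj G))) = ftot (fhcomp (fid F) (fadj2 a)) }.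
End InvertibleDuality.

Section LinearizedDuality.
Variables (k : fieldType) (C : fin2Cat) (S : fin_duality C).
Let K := linearize2 k C.

Definition lift1 (A B : finType) (f : A -> B) (u : fcomb k A) : fcomb k B :=
  \sum_a ((u : {ffun A -> k^o}) a : k) *: delta k (f a).

Lemma lift1_linear (A B : finType) (f : A -> B) : linear (@lift1 A B f).
Proof.
move=> c u v; rewrite /lift1 scaler_sumr -big_split /=; apply: eq_bigr => a _.
by rewrite !ffunE scalerDl scalerA.
Qed.
Lemma lift1_delta (A B : finType) (f : A -> B) a : lift1 f (delta k a) = delta k (f a).
Proof.
rewrite /lift1 (bigD1 a) //= big1 => [|b ne]; rewrite !ffunE.
  by rewrite eqxx scale1r addr0.
by rewrite (negbTE ne) scale0r.
Qed.

Lemma tot2_lin (A : finType) (i j : C) (F G F' G' : @hcat k K i j)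
    (f : fcomb k A -> @lhom k (@hcat k K i j) F G) (g : fcomb k A -> @lhom k (@hcat k K i j) F' G')
    (f0 : A -> fhom F G) (g0 : A -> fhom F' G') :
  F = F' -> G = G' -> linear f -> linear g ->
  (forall a, f (delta k a) = delta k (f0 a)) -> (forall a, g (delta k a) = delta k (g0 a)) ->
  (forall a, ftot (f0 a) = ftot (g0 a)) -> forall u, tot2 (f u) = tot2 (g u).
Proof.
move=> eF eG; destruct eF, eG => lf lg ef eg h u; congr tot2.
apply: (fcomb_ext lf lg) => a; rewrite ef eg; congr delta.
exact: (@tot_inj _ (fun x y : fhcat i j => fhom x y) _ _ _ _ (h a)).
Qed.

Lemma tot2_lin2 (A A' : finType) (i j : C) (F G F' G' : @hcat k K i j)
    (f : fcomb k A -> fcomb k A' -> @lhom k (@hcat k K i j) F G)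
    (g : fcomb k A -> fcomb k A' -> @lhom k (@hcat k K i j) F' G')
    (f0 : A -> A' -> fhom F G) (g0 : A -> A' -> fhom F' G') :
  F = F' -> G = G' ->
  (forall v, linear (f^~ v)) -> (forall u, linear (f u)) ->
  (forall v, linear (g^~ v)) -> (forall u, linear (g u)) ->
  (forall a b, f (delta k a) (delta k b) = delta k (f0 a b)) ->
  (forall a b, g (delta k a) (delta k b) = delta k (g0 a b)) ->
  (forall a b, ftot (f0 a b) = ftot (g0 a b)) -> forall u v, tot2 (f u v) = tot2 (g u v).
Proof.
move=> eF eG; destruct eF, eG => f1 f2 g1 g2 ef eg h u v; congr tot2.
apply: (fcomb_ext2 f1 f2 g1 g2) => a b; rewrite ef eg; congr delta.
exact: (@tot_inj _ (fun x y : fhcat i j => fhom x y) _ _ _ _ (h a b)).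
Qed.

Definition linearize_duality : strict_duality K.
Proof.
have l1 := lift1_linear; have l2l := @lift2_linl k; have l2r := @lift2_linr k.
apply: (@StrictDuality k K (@fadj C S) (fun i j F G => lift1 (@fadj2 C S i j F G))
  _ _ _ (@fadj_mul C S) (@fadj_one C S) (@fadjK C S) (@fadjVl C S) (@fadjVr C S)).
- by move=> i j F G; exact: lift1_linear.
- by move=> i j F; rewrite [LHS]lift1_delta fadj2_id.
- move=> i j F G H b a.
  apply: (@fcomb_ext2 k _ _ _ (fun b a => lift1 (@fadj2 C S i j F H) (lift2 (@fcomp _ F G H) b a))
    (fun b a => lift2 (@fcomp _ _ _ _) (lift1 (@fadj2 C S i j F G) a) (lift1 (@fadj2 C S i j G H) b))).
  + by move=> v; exact: (linear_comp (l1 _ _ _) (l2l _ _ _ _ v)).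
  + by move=> u; exact: (linear_comp (l1 _ _ _) (l2r _ _ _ _ u)).
  + by move=> v; exact: (linear_comp (l2r _ _ _ _ _) (l1 _ _ _)).
  + by move=> u; exact: (linear_comp (l2l _ _ _ _ _) (l1 _ _ _)).
  + by move=> x y; rewrite lift2_delta !lift1_delta lift2_delta fadj2_comp.
- move=> i j l G G' F F' b a.
  apply: (@tot2_lin2 _ _ l i _ _ _ _
    (fun b a => lift1 (@fadj2 C S _ _ _ _) (lift2 (@fhcomp C i j l G G' F F') b a))
    (fun b a => lift2 (@fhcomp C _ _ _ _ _ _ _) (lift1 (@fadj2 C S _ _ F F') a) (lift1 (@fadj2 C S _ _ G G') b))
    (fun b a => fadj2 S (fhcomp b a)) (fun b a => fhcomp (fadj2 S a) (fadj2 S b))).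
  + exact: fadj_mul.
  + exact: fadj_mul.
  + by move=> v; exact: (linear_comp (l1 _ _ _) (l2l _ _ _ _ v)).
  + by move=> u; exact: (linear_comp (l1 _ _ _) (l2r _ _ _ _ u)).
  + by move=> v; exact: (linear_comp (l2r _ _ _ _ _) (l1 _ _ _)).
  + by move=> u; exact: (linear_comp (l2l _ _ _ _ _) (l1 _ _ _)).
  + by move=> x y; rewrite lift2_delta !lift1_delta.
  + by move=> x y; rewrite !lift1_delta lift2_delta.
  + by move=> x y; exact: fadj2_h.
- move=> i j F G a.
  apply: (@tot2_lin _ i j _ _ _ _ (fun a => lift1 (@fadj2 C S _ _ _ _) (lift1 (@fadj2 C S _ _ F G) a))
    (fun a => a) (fun a => fadj2 S (fadj2 S a)) (fun a => a)).
  + exact: fadjK.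
  + exact: fadjK.
  + exact: (linear_comp (l1 _ _ _) (l1 _ _ _)).
  + exact: linear_idfun.
  + by move=> x; rewrite !lift1_delta.
  + by [].
  + by move=> x; exact: fadj2K.
- move=> i a.
  apply: (@tot2_lin _ i i _ _ _ _ (fun a => lift1 (@fadj2 C S _ _ (fone i) (fone i)) a)
    (fun a => a) (fun a => fadj2 S a) (fun a => a)).
  + exact: fadj_one.
  + exact: fadj_one.
  + exact: l1.
  + exact: linear_idfun.
  + by move=> x; rewrite lift1_delta.
  + by [].
  + by move=> x; exact: fadj2_one.
- move=> i j F G a.
  apply: (@tot2_lin _ i i _ _ _ _
    (fun a => lift2 (@fhcomp C _ _ _ _ _ _ _) (lift1 (@fadj2 C S _ _ F G) a) (delta k (fid G)))
    (fun a => lift2 (@fhcomp C _ _ _ _ _ _ _) (delta k (fid (fadj S F))) a)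
    (fun a => fhcomp (fadj2 S a) (fid G)) (fun a => fhcomp (fid (fadj S F)) a)).
  + exact: etrans (fadjVl S G) (esym (fadjVl S F)).
  + by [].
  + exact: (linear_comp (l2l _ _ _ _ _) (l1 _ _ _)).
  + exact: l2r.
  + by move=> x; rewrite lift1_delta lift2_delta.
  + by move=> x; rewrite lift2_delta.
  + by move=> x; exact: fadj2_l.
- move=> i j F G a.
  apply: (@tot2_lin _ j j _ _ _ _
    (fun a => lift2 (@fhcomp C _ _ _ _ _ _ _) a (delta k (fid (fadj S G))))
    (fun a => lift2 (@fhcomp C _ _ _ _ _ _ _) (delta k (fid F)) (lift1 (@fadj2 C S _ _ F G) a))
    (fun a => fhcomp a (fid (fadj S G))) (fun a => fhcomp (fid F) (fadj2 S a))).
  + by [].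
  + exact: etrans (fadjVr S G) (esym (fadjVr S F)).
  + exact: l2l.
  + exact: (linear_comp (l2r _ _ _ _ _) (l1 _ _ _)).
  + by move=> x; rewrite lift2_delta.
  + by move=> x; rewrite lift1_delta lift2_delta.
  + by move=> x; exact: fadj2_r.
Defined.
End LinearizedDuality.

(** The duality is carried through linearization, additive closure, idempotent
    completion, the bar construction, and a second idempotent completion. *)
Theorem overline_hull_fiat (k : fieldType) (C : fin2Cat) :
  fin_duality C -> fiat (overline (linear_hull k C)).
Proof.
move=> S; apply: fiat_of_duality.
  apply: karoubi_duality; apply: bar_duality.
  apply: (@karoubi_duality k (additive_closure2 (linearize2 k C))).
  exact: additive_duality (linearize_duality k S).
apply: overline_finitary; first exact: linear_hull_prefinitary.
exact: linear_hull_generated.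
Qed.

(** * Dualities of the 2-categories of relations and partitions *)

Section RelationDuality.
Variable n : nat.

Lemma sinv_mul (t s : 'S_n) : (scomp t s)^-1%g = scomp s^-1%g t^-1%g.
Proof. exact: invMg. Qed.
Lemma sinvVl (s : 'S_n) : scomp s^-1%g s = 1%g. Proof. exact: mulgV. Qed.
Lemma sinvVr (s : 'S_n) : scomp s s^-1%g = 1%g. Proof. exact: mulVg. Qed.

Definition converse (a : brel n) : brel n := [set zx | (zx.2, zx.1) \in a].
Lemma converseE (a : brel n) z x : ((z, x) \in converse a) = ((x, z) \in a).
Proof. by rewrite inE. Qed.
Lemma converse_graph (s : 'S_n) : converse (graph s) = graph s^-1%g.
Proof.
apply/setP => -[z x]; rewrite converseE !graphE.
by apply/eqP/eqP => ->; rewrite ?permK ?permKV.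
Qed.
Lemma converseS (a b : brel n) : a \subset b -> converse a \subset converse b.
Proof. by move=> /subsetP h; apply/subsetP => -[z x]; rewrite !converseE; exact: h. Qed.
Lemma converse_rcomp (b a : brel n) : converse (rcomp b a) = rcomp (converse a) (converse b).
Proof.
apply/setP => -[z x]; rewrite converseE; apply/rcompP/rcompP => -[y h1 h2]; exists y => //.
all: by move: h1 h2; rewrite ?converseE.
Qed.

Fact A_adj2_subproof (s t : 'S_n) (a : homA s t) :
  converse (val a) \subset graph t^-1%g :&: graph s^-1%g.
Proof.
have := valP a; rewrite !subsetI => /andP[h1 h2].
by rewrite -!converse_graph !converseS.
Qed.
Definition A_adj2 (s t : 'S_n) (a : homA s t) : homA t^-1%g s^-1%g :=
  exist _ (converse (val a)) (A_adj2_subproof a).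

Lemma A_tot (s t s' t' : 'S_n) (a : homA s t) (b : homA s' t') : s = s' -> t = t' ->
  val a = val b -> @ftot (A_2cat n) tt tt s t a = @ftot (A_2cat n) tt tt s' t' b.
Proof. by move=> es et; destruct es, et => /val_inj->. Qed.

Lemma homAP (s t : 'S_n) (a : homA s t) z x : (z, x) \in val a -> z = s x /\ z = t x.
Proof.
have := valP a; rewrite subsetI => /andP[/subsetP h1 /subsetP h2] h.
by have := h1 _ h; have := h2 _ h; rewrite !graphE => /eqP e1 /eqP e2.
Qed.

(** A 2-morphism is a restriction of two permutations at once, so composing
    its converse with one of them gives a partial identity; this is why the
    converse is the mate. *)
Definition A_duality : fin_duality (A_2cat n).
Proof.
apply: (@FinDuality (A_2cat n) (fun _ _ (s : 'S_n) => s^-1%g) (fun _ _ s t a => A_adj2 a)).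
- by move=> i j s; apply: val_inj; exact: converse_graph.
- move=> i j s t u b a; apply: val_inj; apply/setP => -[z x] /=.
  by rewrite !inE andbC.
- by move=> *; exact: sinv_mul.
- by move=> i; exact: invg1.
- by move=> i j s; exact: invgK.
- by move=> i j s; exact: sinvVl.
- by move=> i j s; exact: sinvVr.
- move=> [] [] [] t t' s s' b a; apply: A_tot; [exact: sinv_mul|exact: sinv_mul|].
  exact: converse_rcomp.
- move=> [] [] s t a; apply: A_tot; [exact: invgK|exact: invgK|].
  by apply/setP => -[z x] /=; rewrite !converseE.
- move=> [] a; apply: A_tot; [exact: invg1|exact: invg1|].
  apply/setP => -[z x] /=; rewrite converseE.
  by apply/idP/idP => h; have [e _] := homAP h; move: h; rewrite e perm1.
- move=> [] [] s t a; apply: A_tot; [by rewrite /= !sinvVl|by []|].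
  apply/setP => -[z x] /=; apply/rcompP/rcompP => -[y].
    rewrite converseE graphE => h /eqP ey; have [e1 e2] := homAP h.
    have ez : z = x by apply: (@perm_inj _ t); rewrite -e2.
    by exists y; rewrite -?ez // graphE e1 permK.
  rewrite graphE => /eqP-> h; have [e1 e2] := homAP h.
  by exists y; rewrite ?converseE ?graphE e1 ?permK -?e1 // -e2.
- move=> [] [] s t a; apply: A_tot; [by []|by rewrite /= !sinvVr|].
  apply/setP => -[z x] /=; apply/rcompP/rcompP => -[y].
    rewrite graphE => h /eqP ey; have [e1 e2] := homAP h.
    have ez : z = x by rewrite e2 ey permKV.
    by exists y; rewrite ?converseE -?ez // graphE -e1.
  rewrite graphE converseE => /eqP-> h; have [e1 e2] := homAP h.
  by exists y; rewrite -?e1 // graphE e2 permK.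
Defined.
End RelationDuality.

Section PartitionDuality.
Variable n : nat.
Notation I2 := ('I_n + 'I_n)%type.
Notation sets := {set {set I2}}.

Definition flip (z : I2) : I2 := match z with inl x => inr x | inr x => inl x end.
Lemma flipK : involutive flip. Proof. by case. Qed.

Definition transposed (P : sets) : sets := [set flip @: A | A : {set I2} in P].

Lemma mem_flip (A : {set I2}) z : (z \in flip @: A) = (flip z \in A).
Proof.
apply/imsetP/idP => [[w hw ->]|h]; first by rewrite flipK.
by exists (flip z); rewrite ?flipK.
Qed.

Lemma same_transposed (P : sets) z w :
  same_part (transposed P) z w = same_part P (flip z) (flip w).
Proof.
apply/same_partP/same_partP => [[_ [/imsetP[A hA ->]]]|[A [hA h1 h2]]].
  by rewrite !mem_flip => h1 h2; exists A.
by exists (flip @: A); rewrite imset_f // !mem_flip.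
Qed.

Lemma transposed_partition (P : sets) : partition P setT -> partition (transposed P) setT.
Proof.
move=> /and3P[/eqP c /trivIsetP tr n0]; apply/and3P; split.
- apply/eqP/setP => z; rewrite inE; apply/bigcupP.
  have : flip z \in cover P by rewrite c inE.
  by move=> /bigcupP[A hA h]; exists (flip @: A); [exact: imset_f|rewrite mem_flip].
- apply/trivIsetP => _ _ /imsetP[A hA ->] /imsetP[B hB ->] ne.
  have {}ne : A != B by apply: contraNneq ne => ->.
  have := tr _ _ hA hB ne; rewrite -!setI_eq0 => /eqP e; apply/eqP/setP => z.
  by rewrite !inE !mem_flip; have /setP/(_ (flip z)) := e; rewrite !inE.
- apply/negP => /imsetP[A hA e]; have /set0Pn[z hz] : A != set0.
    by apply: contraNneq n0 => <-.
  by have := imset_f flip hz; rewrite -e inE.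
Qed.

Lemma const_transposed (P : sets) f g : const (transposed P) f g <-> const P g f.
Proof.
have lf z : lab f g (flip z) = lab g f z by case: z.
split=> h z w; last by rewrite same_transposed => /h; rewrite -!lf !flipK.
by move=> k; rewrite -!lf; apply: h; rewrite same_transposed !flipK.
Qed.

Lemma transposed_isPP (P : sets) : isPP P -> isPP (transposed P).
Proof.
move=> /andP[hP /(propagatingP hP)[hl hr]].
rewrite /isPP transposed_partition //; apply/(propagatingP (transposed_partition hP)).
split=> x; [have [y hy] := hr x|have [y hy] := hl x]; exists y.
all: by rewrite same_transposed /= same_part_sym.
Qed.

Lemma const_pperm_inv (s : 'S_n) f g : const (pperm s^-1%g) f g <-> const (pperm s) g f.
Proof.
split=> /const_perm h; apply/const_perm => x; first by rewrite h permK.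
by rewrite h permKV.
Qed.

Fact B_adj2_subproof (s t : 'S_n) (a : homB s t) :
  [&& isPP (transposed (val a)), refines (pperm t^-1%g) (transposed (val a))
    & refines (pperm s^-1%g) (transposed (val a))].
Proof.
have [h1 h2 h3] := homBP a; have pa := transposed_partition (isPP_partition h1).
rewrite transposed_isPP //=; apply/andP; split.
all: apply/(refines_const (pperm_partition _) pa) => f g /const_transposed h.
  by apply/const_pperm_inv; exact: h3.
by apply/const_pperm_inv; exact: h2.
Qed.
Definition B_adj2 (s t : 'S_n) (a : homB s t) : homB t^-1%g s^-1%g :=
  exist _ (transposed (val a)) (B_adj2_subproof a).

Lemma B_tot (s t s' t' : 'S_n) (a : homB s t) (b : homB s' t') : s = s' -> t = t' ->
  (forall f g, const (val a) f g <-> const (val b) f g) ->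
  @ftot (B_2cat n) tt tt s t a = @ftot (B_2cat n) tt tt s' t' b.
Proof.
move=> es et; destruct es, et => h; congr (ftot _); apply: val_inj.
have [h1 _ _] := homBP a; have [h2 _ _] := homBP b.
exact: (const_inj (isPP_partition h1) (isPP_partition h2)).
Qed.

Lemma homB_eq (s t : 'S_n) (a b : homB s t) :
  (forall f g, const (val a) f g <-> const (val b) f g) -> a = b.
Proof.
move=> h; apply: val_inj; have [h1 _ _] := homBP a; have [h2 _ _] := homBP b.
exact: (const_inj (isPP_partition h1) (isPP_partition h2)).
Qed.

(** On labellings, a partition above a permutation acts as a partial bijection
    contained in that of the permutation, so that the argument for relations
    applies. *)
Definition B_duality : fin_duality (B_2cat n).
Proof.
apply: (@FinDuality (B_2cat n) (fun _ _ (s : 'S_n) => s^-1%g) (fun _ _ s t a => B_adj2 a)).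
- move=> i j s; apply: homB_eq => f g /=.
  by rewrite const_transposed const_pperm_inv.
- move=> i j s t u b a; apply: homB_eq => f g /=.
  by rewrite const_transposed !const_join !const_transposed; tauto.
- by move=> *; exact: sinv_mul.
- by move=> i; exact: invg1.
- by move=> i j s; exact: invgK.
- by move=> i j s; exact: sinvVl.
- by move=> i j s; exact: sinvVr.
- move=> [] [] [] t t' s s' b a; apply: B_tot; [exact: sinv_mul|exact: sinv_mul|] => f g /=.
  have [ha _ _] := homBP a; have [hb _ _] := homBP b.
  rewrite const_transposed !const_mul //; last exact: transposed_isPP.
  by split=> -[h h1 h2]; exists h; move: h1 h2; rewrite ?const_transposed.
- move=> [] [] s t a; apply: B_tot; [exact: invgK|exact: invgK|] => f g /=.
  by rewrite !const_transposed.
- move=> [] a; apply: B_tot; [exact: invg1|exact: invg1|] => f g /=.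
  rewrite const_transposed; have [_ h _] := homBP a.
  by split=> k; have /const_one e := h _ _ k; rewrite e in k *.
- move=> [] [] s t a; apply: B_tot; [by rewrite /= !sinvVl|by []|] => f g /=.
  have [ha hs ht] := homBP a.
  rewrite !const_mul //; last exact: pperm_isPP.
  split=> -[h].
    move=> /const_perm h1 /const_transposed h2; have /const_perm h3 := ht _ _ h2.
    have e : f = g by apply/ffunP => x; rewrite h1 h3.
    by exists h; rewrite ?e //; apply/const_pperm_inv; exact: hs.
  move=> h1 /const_pperm_inv h2; have /const_perm h3 := hs _ _ h1.
  have e : f = g by apply/ffunP => x; have /const_perm h4 := h2; rewrite h3 h4.
  by exists h; [exact: ht|apply/const_transposed; rewrite -e].
- move=> [] [] s t a; apply: B_tot; [by []|by rewrite /= !sinvVr|] => f g /=.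
  have [ha hs ht] := homBP a.
  rewrite !const_mul //; [|exact: transposed_isPP|exact: pperm_isPP].
  split=> -[h].
    move=> /const_pperm_inv /const_perm h1 h2; have /const_perm h3 := ht _ _ h2.
    have e : f = g by apply/ffunP => x; rewrite -(permKV t x) -h3 h1.
    by exists h; [apply/const_transposed; rewrite e|exact: hs].
  move=> /const_transposed h1 /const_perm h2; have /const_perm h3 := hs _ _ h1.
  have e : f = g by apply/ffunP => x; rewrite -(permKV s x) -h3 h2.
  by exists h; [apply/const_pperm_inv; exact: ht|rewrite -e].
Defined.
End PartitionDuality.

(** * The theorem *)

Theorem theorem10 (n : nat) (n_gt0 : (0 < n)%N) (k : fieldType) :
  (fiat (overline (linear_hull k (A_2cat n))) /\
   fiat (overline (linear_hull k (B_2cat n)))) /\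
  ((finitary (linear_hull k (ord_2cat (IS_ordMonoid n))) /\
    ~ fiat (linear_hull k (ord_2cat (IS_ordMonoid n)))) /\
   (finitary (linear_hull k (ord_2cat (F_ordMonoid n))) /\
    ((1 < n)%N -> ~ fiat (linear_hull k (ord_2cat (F_ordMonoid n)))))).
Proof.
split; [split|split; split].
- exact: overline_hull_fiat (A_duality n).
- exact: overline_hull_fiat (B_duality n).
- exact: ord_hull_finitary.
- exact: IS_not_fiat.
- exact: ord_hull_finitary.
- exact: Fstar_not_fiat.
Qed.
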